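(* Let $G$ be a locally compact Hausdorff étale groupoid such that $\operatorname{Iso}(G)^\circ$ is abelian. Then $\iota(C^*(\operatorname{Iso}(G)^\circ))\subseteq C^*_r(G)$ is maximal abelian.
   Context: $\operatorname{Iso}(G)=\{\eta\in G:r(\eta)=s(\eta)\}$ and $\operatorname{Iso}(G)^\circ$ is its interior in $G$, an étale bundle of groups over $G^{(0)}$; it is abelian if each fibre group is abelian. In that case $C^*(\operatorname{Iso}(G)^\circ)=C^*_r(\operatorname{Iso}(G)^\circ)$. The inclusion (extension by zero) $C_c(\operatorname{Iso}(G)^\circ)\hookrightarrow C_c(G)$ extends to an injective homomorphism $\iota:C^*_r(\operatorname{Iso}(G)^\circ)\to C^*_r(G)$. Maximal abelian means abelian and not properly contained in any abelian $C^*$-subalgebra. *)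

(* Defs.v *)
From HB Require Import structures.
From mathcomp Require Import all_boot all_order all_algebra.
From mathcomp Require Import all_classical all_reals all_analysis.
From mathcomp Require Import complex ring lra.
Set Implicit Arguments.
Unset Strict Implicit.
Unset Printing Implicit Defensive.
Import Order.TTheory GRing.Theory Num.Theory numFieldNormedType.Exports.
Local Open Scope classical_set_scope.
Local Open Scope ring_scope.
Local Open Scope complex_scope.

(* A groupoid is presented by its set of arrows: units are arrows and the
   product is total, but it is constrained only on the composable pairs, i.e.
   those with src a = rng b.  The last axiom says that rng is a local
   homeomorphism from G to its unit space with the subspace topology. *)
Structure etaleGroupoid := EtaleGroupoid {
  arrow :> topologicalType;
  src : arrow -> arrow;
  rng : arrow -> arrow;
  ginv : arrow -> arrow;
  gmul : arrow -> arrow -> arrow;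
  src_src : forall a, src (src a) = src a;
  rng_src : forall a, rng (src a) = src a;
  src_rng : forall a, src (rng a) = rng a;
  rng_rng : forall a, rng (rng a) = rng a;
  src_mul : forall a b, src a = rng b -> src (gmul a b) = src b;
  rng_mul : forall a b, src a = rng b -> rng (gmul a b) = rng a;
  gmul_assoc : forall a b c, src a = rng b -> src b = rng c ->
    gmul a (gmul b c) = gmul (gmul a b) c;
  mul_rng : forall a, gmul (rng a) a = a;
  mul_src : forall a, gmul a (src a) = a;
  src_inv : forall a, src (ginv a) = rng a;
  rng_inv : forall a, rng (ginv a) = src a;
  gmul_inv : forall a, gmul a (ginv a) = rng a;
  ginv_mul : forall a, gmul (ginv a) a = src a;
  ginv_continuous : continuous ginv;
  gmul_continuous : {within [set p : arrow * arrow | src p.1 = rng p.2],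
    continuous (fun p : arrow * arrow => gmul p.1 p.2)};
  rng_local_homeo : forall a, exists U : set arrow,
    [/\ open U, U a, {within U, continuous rng}, set_inj U rng &
      forall V, open V -> V `<=` U ->
        exists2 O, open O & rng @` V = O `&` range rng]
}.

Definition unit_space (G : etaleGroupoid) : set G := range (@rng G).
Arguments unit_space : clear implicits.

Definition iso_bundle (G : etaleGroupoid) : set G :=
  [set g | rng g = src g].
Arguments iso_bundle : clear implicits.
Definition iso_interior (G : etaleGroupoid) : set G := (iso_bundle G)°.
Arguments iso_interior : clear implicits.

Section iso_interior_theory.
Variable G : etaleGroupoid.
Implicit Types a b g : G.
Local Notation H := (iso_interior G).

Lemma rng_continuous : continuous (@rng G).
Proof.
move=> a; have [U [oU Ua + _ _]] := rng_local_homeo a.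
by rewrite continuous_open_subspace // => /(_ a); apply; rewrite inE.
Qed.

Lemma ginv_unique a b : src a = rng b -> gmul a b = rng a -> b = ginv a.
Proof.
move=> ab e.
rewrite -(mul_rng b) -ab -ginv_mul -gmul_assoc ?src_inv // e.
by rewrite -src_inv mul_src.
Qed.

Lemma ginvK : involutive (@ginv G).
Proof.
by move=> a; apply/esym/ginv_unique; rewrite ?src_inv ?ginv_mul ?rng_inv.
Qed.

Lemma src_continuous : continuous (@src G).
Proof.
move=> a.
have -> : @src G = @rng G \o @ginv G by apply/funext => x /=; rewrite rng_inv.
by apply: continuous_comp; [exact: ginv_continuous|exact: rng_continuous].
Qed.

Lemma gmul_near a b (W : set G) : src a = rng b -> nbhs (gmul a b) W ->
  exists A B : set G, [/\ open A, open B, A a, B b &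
    forall x y, A x -> B y -> src x = rng y -> W (gmul x y)].
Proof.
move=> ab Wab.
have /subspace_continuousP/(_ (a, b) ab W Wab) := @gmul_continuous G.
rewrite nbhs_simpl/= => -[[P Q] /= [Pa Qb] sPQ].
exists P°, Q°; split; [exact: open_interior|exact: open_interior|exact: Pa|
  exact: Qb|].
move=> x y /interior_subset Px /interior_subset Qy xy.
by apply: (sPQ (x, y)) => //.
Qed.

Lemma iso_interior_sub a : H a -> rng a = src a.
Proof. by move=> /interior_subset. Qed.

Lemma iso_interior_open : open H.
Proof. exact: open_interior. Qed.

Lemma iso_interior_rng a : H (rng a).
Proof.
have [U [oU Ux _ injU _]] := rng_local_homeo (rng a).
have : nbhs (rng a) (U `&` (@rng G) @^-1` U).
  apply: filterI; first exact: open_nbhs_nbhs.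
  by apply: rng_continuous; rewrite rng_rng; exact: open_nbhs_nbhs.
rewrite /iso_interior /interior; apply: filterS => g [/= Ug Urg].
have gE : rng g = g by apply: injU; rewrite ?inE // rng_rng.
by rewrite /iso_bundle /= -gE src_rng rng_rng.
Qed.

Lemma iso_interior_src a : H (src a).
Proof. by rewrite -rng_src; exact: iso_interior_rng. Qed.

Lemma iso_interior_inv a : H a -> H (ginv a).
Proof.
move=> Ha; have : nbhs (ginv a) ((@ginv G) @^-1` H).
  apply: ginv_continuous; rewrite ginvK.
  by apply: open_nbhs_nbhs; split => //; exact: iso_interior_open.
rewrite /iso_interior /interior; apply: filterS => g /= /iso_interior_sub.
by rewrite rng_inv src_inv.
Qed.

Lemma iso_interior_mul a b : src a = rng b -> H a -> H b -> H (gmul a b).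
Proof.
move=> ab Ha Hb.
have ia_ab : gmul (ginv a) (gmul a b) = b.
  by rewrite gmul_assoc ?src_inv // ginv_mul ab mul_rng.
have [A [B [oA oB Aia Bab AB]]] :
  exists A B : set G, [/\ open A, open B, A (ginv a), B (gmul a b) &
    forall x y, A x -> B y -> src x = rng y -> H (gmul x y)].
  apply: gmul_near; first by rewrite src_inv rng_mul.
  rewrite ia_ab; apply: open_nbhs_nbhs; split => //.
  exact: iso_interior_open.
have [U [oU Ua _ _ openU]] := rng_local_homeo a.
have oV : open (U `&` H `&` (@ginv G) @^-1` A).
  apply: openI; first by apply: openI => //; exact: iso_interior_open.
  by apply: open_comp => // x _; exact: ginv_continuous.
have [|O oO VO] := openU _ oV; first by move=> x [[]].
have Oab : O (rng (gmul a b)).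
  have : (O `&` range (@rng G)) (rng a) by rewrite -VO; exists a.
  by rewrite rng_mul // => -[].
have : nbhs (gmul a b) (B `&` (@rng G) @^-1` O).
  apply: filterI; first exact: open_nbhs_nbhs.
  by apply: rng_continuous; exact: open_nbhs_nbhs.
rewrite /iso_interior /interior; apply: filterS => g [Bg Og].
have : (O `&` range (@rng G)) (rng g) by split => //; exists g.
rewrite -VO => -[u [[_ Hu] Au] ug].
have := AB _ _ Au Bg; rewrite src_inv => /(_ ug) /iso_interior_sub.
rewrite rng_mul ?src_inv // src_mul ?src_inv // rng_inv => uE.
by rewrite /iso_bundle /= -uE -ug; exact: iso_interior_sub.
Qed.

End iso_interior_theory.

Section iso_groupoid.
Variable G : etaleGroupoid.

Let H : topologicalType := iso_interior G.

(* Iso(G)^o contains the units and is closed under inverses and products of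
   composable pairs, so that the default values of insubd are only used for the
   product of two arrows which are not composable. *)
Definition iso_src (a : H) : H := insubd a (src (val a)).
Definition iso_rng (a : H) : H := insubd a (rng (val a)).
Definition iso_inv (a : H) : H := insubd a (ginv (val a)).
Definition iso_mul (a b : H) : H := insubd a (gmul (val a) (val b)).

Lemma iso_valP (a : H) : iso_interior G (val a).
Proof. exact/set_mem/(valP a). Qed.

Lemma val_iso_src a : val (iso_src a) = src (val a).
Proof. by rewrite val_insubd mem_set //; exact: iso_interior_src. Qed.

Lemma val_iso_rng a : val (iso_rng a) = rng (val a).
Proof. by rewrite val_insubd mem_set //; exact: iso_interior_rng. Qed.

Lemma val_iso_inv a : val (iso_inv a) = ginv (val a).
Proof.
by rewrite val_insubd mem_set //; exact/iso_interior_inv/iso_valP.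
Qed.

Lemma iso_comp a b : iso_src a = iso_rng b -> src (val a) = rng (val b).
Proof. by move=> /(congr1 val); rewrite val_iso_src val_iso_rng. Qed.

Lemma val_iso_mul a b : iso_src a = iso_rng b ->
  val (iso_mul a b) = gmul (val a) (val b).
Proof.
move=> /iso_comp ab; rewrite val_insubd mem_set //.
by apply: iso_interior_mul => //; exact: iso_valP.
Qed.

Lemma iso_nbhs (a : H) (W : set H) : nbhs a W <->
  exists V : set G, [/\ open V, V (val a) & forall b : H, V (val b) -> W b].
Proof.
split=> [[_ [[V oV <-] Va] sVW]|[V [oV Va sVW]]].
  by exists V; split.
by exists (val @^-1` V); split => //; exists V.
Qed.

Lemma iso_open (W : set H) : open W -> open (val @` W).
Proof.
move=> [V oV <-].
have -> : [set val x | x in (set_val @^-1` V : set H)] = V `&` iso_interior G.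
  apply/seteqP; split=> [_ [x Vx <-]|x [Vx Hx]].
    by split => //; exact: iso_valP.
  by exists (exist _ x (mem_set Hx)).
by apply: openI => //; exact: iso_interior_open.
Qed.

Lemma iso_val_continuous : continuous (val : H -> G).
Proof. exact: initial_continuous. Qed.

Lemma iso_rng_continuous : continuous iso_rng.
Proof.
move=> a W /iso_nbhs[V [oV Va sVW]]; apply/iso_nbhs.
exists ((@rng G) @^-1` V); split; last 2 first.
- by rewrite /= -val_iso_rng.
- by move=> b; rewrite /= -val_iso_rng; exact: sVW.
by apply: open_comp => // x _; exact: rng_continuous.
Qed.

Fact iso_src_src a : iso_src (iso_src a) = iso_src a.
Proof. by apply/val_inj; rewrite !val_iso_src src_src. Qed.
Fact iso_rng_src a : iso_rng (iso_src a) = iso_src a.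
Proof. by apply/val_inj; rewrite val_iso_rng val_iso_src rng_src. Qed.
Fact iso_src_rng a : iso_src (iso_rng a) = iso_rng a.
Proof. by apply/val_inj; rewrite val_iso_src val_iso_rng src_rng. Qed.
Fact iso_rng_rng a : iso_rng (iso_rng a) = iso_rng a.
Proof. by apply/val_inj; rewrite !val_iso_rng rng_rng. Qed.
Fact iso_src_mul a b : iso_src a = iso_rng b ->
  iso_src (iso_mul a b) = iso_src b.
Proof.
move=> ab; apply/val_inj; rewrite !val_iso_src val_iso_mul //.
exact/src_mul/iso_comp.
Qed.
Fact iso_rng_mul a b : iso_src a = iso_rng b ->
  iso_rng (iso_mul a b) = iso_rng a.
Proof.
move=> ab; apply/val_inj; rewrite !val_iso_rng val_iso_mul //.
exact/rng_mul/iso_comp.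
Qed.
Fact iso_mul_assoc a b c : iso_src a = iso_rng b -> iso_src b = iso_rng c ->
  iso_mul a (iso_mul b c) = iso_mul (iso_mul a b) c.
Proof.
move=> ab bc; apply/val_inj.
rewrite !val_iso_mul ?iso_src_mul ?iso_rng_mul //.
by apply: gmul_assoc; exact: iso_comp.
Qed.
Fact iso_mul_rng a : iso_mul (iso_rng a) a = a.
Proof.
by apply/val_inj; rewrite val_iso_mul ?iso_src_rng // val_iso_rng mul_rng.
Qed.
Fact iso_mul_src a : iso_mul a (iso_src a) = a.
Proof.
by apply/val_inj; rewrite val_iso_mul ?iso_rng_src // val_iso_src mul_src.
Qed.
Fact iso_src_inv a : iso_src (iso_inv a) = iso_rng a.
Proof.
by apply/val_inj; rewrite val_iso_src val_iso_inv val_iso_rng src_inv.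
Qed.
Fact iso_rng_inv a : iso_rng (iso_inv a) = iso_src a.
Proof.
by apply/val_inj; rewrite val_iso_rng val_iso_inv val_iso_src rng_inv.
Qed.
Fact iso_mul_inv a : iso_mul a (iso_inv a) = iso_rng a.
Proof.
apply/val_inj; rewrite val_iso_mul ?iso_rng_inv //.
by rewrite val_iso_inv val_iso_rng gmul_inv.
Qed.
Fact iso_inv_mul a : iso_mul (iso_inv a) a = iso_src a.
Proof.
apply/val_inj; rewrite val_iso_mul ?iso_src_inv //.
by rewrite val_iso_inv val_iso_src ginv_mul.
Qed.
Fact iso_inv_continuous : continuous iso_inv.
Proof.
move=> a W /iso_nbhs[V [oV Va sVW]]; apply/iso_nbhs.
exists ((@ginv G) @^-1` V); split; last 2 first.
- by rewrite /= -val_iso_inv.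
- by move=> b; rewrite /= -val_iso_inv; exact: sVW.
by apply: open_comp => // x _; exact: ginv_continuous.
Qed.
Fact iso_mul_continuous : {within [set p : H * H | iso_src p.1 = iso_rng p.2],
  continuous (fun p : H * H => iso_mul p.1 p.2)}.
Proof.
apply/subspace_continuousP => -[a b] /= ab W /iso_nbhs[V [oV]]; rewrite val_iso_mul // => Vab sVW.
have [A [B [oA oB Aa Bb AB]]] := gmul_near (iso_comp ab) (open_nbhs_nbhs (conj oV Vab)).
rewrite nbhs_simpl/=; exists (val @^-1` A, val @^-1` B) => /=.
  by split; apply/iso_nbhs; [exists A|exists B].
move=> [x y] /= [Ax By] xy; apply: sVW; rewrite val_iso_mul //.
by apply: AB => //; exact: iso_comp.
Qed.
Fact iso_rng_local_homeo a : exists U : set H,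
  [/\ open U, U a, {within U, continuous iso_rng}, set_inj U iso_rng &
    forall V, open V -> V `<=` U ->
      exists2 O, open O & iso_rng @` V = O `&` range iso_rng].
Proof.
have [U [oU Ua _ injU openU]] := rng_local_homeo (val a).
exists (val @^-1` U); split => //.
- by exists U.
- exact/continuous_subspaceT/iso_rng_continuous.
- move=> x y; rewrite !inE => Ux Uy /(congr1 val); rewrite !val_iso_rng => xy.
  by apply/val_inj/injU; rewrite ?inE.
- move=> V oV VU; have [|O oO VO] := openU _ (iso_open oV).
    by move=> _ [x Vx <-]; exact: VU.
  exists (val @^-1` O); first by exists O.
  apply/seteqP; split=> [_ [x Vx <-]|t [Ot [x _ xE]]].
    split; last by exists x.
    have : (O `&` range (@rng G)) (rng (val x)).
      by rewrite -VO; exists (val x) => //; exists x.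
    by rewrite /= val_iso_rng => -[].
  have : (O `&` range (@rng G)) (rng (val x)).
    split; last by exists (val x).
    by rewrite -val_iso_rng xE.
  rewrite -VO => -[_ [y Vy <-] yx]; exists y => //.
  by rewrite -xE; apply/val_inj; rewrite !val_iso_rng.
Qed.

Definition iso_groupoid : etaleGroupoid :=
  @EtaleGroupoid H iso_src iso_rng iso_inv iso_mul
    iso_src_src iso_rng_src iso_src_rng iso_rng_rng iso_src_mul iso_rng_mul
    iso_mul_assoc iso_mul_rng iso_mul_src iso_src_inv iso_rng_inv iso_mul_inv
    iso_inv_mul iso_inv_continuous iso_mul_continuous iso_rng_local_homeo.

End iso_groupoid.

Definition abelian_fibres (G : etaleGroupoid) : Prop :=
  forall x : G, unit_space G x -> forall a b : G,
    rng a = x -> src a = x -> rng b = x -> src b = x -> gmul a b = gmul b a.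

Section l2_def.
Variables (R : realType) (X : choiceType).
Local Notation C := (R[i]^o).

Definition l2_pred : {pred X -> C} := fun xi =>
  `[< (\esum_(x in [set: X]) ((Normc.normc (xi x) ^+ 2)%:E : \bar R) < +oo)%E >].

Record l2 := L2 { l2_val :> X -> C; _ : l2_val \in l2_pred }.

HB.instance Definition _ := [isSub for l2_val].
HB.instance Definition _ := [Choice of l2 by <:].

Lemma l2_submod_closed : submod_closed l2_pred.
Proof.
split=> [|a u v /asboolP uoo /asboolP voo]; apply/asboolP.
  by rewrite esum1 ?ltry // => x _; rewrite Normc.normc0 expr0n.
pose k := 2 * Normc.normc a ^+ 2.
apply: (@le_lt_trans _ _ (\esum_(x in [set: X])
  ((k * Normc.normc (u x) ^+ 2)%:E + (2 * Normc.normc (v x) ^+ 2)%:E))%E).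
  apply: le_esum => x _; rewrite -EFinD lee_fin.
  have n0 (z : R[i]) : 0 <= Normc.normc z.
    by case: z => ? ?; exact: sqrtr_ge0.
  have : Normc.normc (a * u x + v x) <=
         Normc.normc a * Normc.normc (u x) + Normc.normc (v x).
    by rewrite -Normc.normcM; exact: le_normcD.
  set p := _ * Normc.normc (u x); set q := Normc.normc (v x) => pq.
  apply: (@le_trans _ _ ((p + q) ^+ 2)).
    by rewrite ler_sqr ?nnegrE ?addr_ge0 ?mulr_ge0 ?n0.
  have -> : k * Normc.normc (u x) ^+ 2 = 2 * p ^+ 2.
    by rewrite /k /p; ring.
  by have := sqr_ge0 (p - q); rewrite !expr2 => ?; nra.
have esumZ (c : R) (w : X -> C) : 0 <= c ->
  (\esum_(x in [set: X]) ((Normc.normc (w x) ^+ 2)%:E : \bar R) < +oo)%E ->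
  (\esum_(x in [set: X]) ((c * Normc.normc (w x) ^+ 2)%:E : \bar R) < +oo)%E.
  move=> c0 woo; apply: (@le_lt_trans _ _ (c%:E *
    \esum_(x in [set: X]) (Normc.normc (w x) ^+ 2)%:E)%E).
    apply: ub_ereal_sup => _ [F FX <-].
    under eq_fsbigr do rewrite EFinM.
    rewrite -ge0_mule_fsumr; last by move=> ?; rewrite lee_fin sqr_ge0.
    by rewrite lee_wpmul2l ?lee_fin //; apply: ereal_sup_ubound; exists F.
  by apply: lte_mul_pinfty.
have k0 : 0 <= k by rewrite mulr_ge0 ?sqr_ge0.
rewrite esumD; first by apply: lte_add_pinfty; apply: esumZ.
- by move=> x _; rewrite lee_fin mulr_ge0 ?sqr_ge0.
- by move=> x _; rewrite lee_fin mulr_ge0 ?sqr_ge0.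
Qed.

HB.instance Definition _ := GRing.isSubmodClosed.Build _ _ l2_pred
  l2_submod_closed.
HB.instance Definition _ := [SubChoice_isSubLmodule of l2 by <:].

Definition l2_norm (xi : l2) : R :=
  Num.sqrt (fine (\esum_(x in [set: X]) (Normc.normc (xi x) ^+ 2)%:E)).

(* rsum and csum are meaningful for absolutely summable families. *)
Definition rsum (f : X -> R) : R :=
  fine (\esum_(x in [set: X]) (Num.max (f x) 0)%:E) -
  fine (\esum_(x in [set: X]) (Num.max (- f x) 0)%:E).

Definition csum (f : X -> C) : C :=
  (rsum (fun x => complex.Re (f x))) +i* (rsum (fun x => complex.Im (f x))).

Definition inner (xi eta : l2) : C := csum (fun x => xi x * conjc (eta x)).

Definition opnorm (T : l2 -> l2) : \bar R :=
  ereal_sup [set (l2_norm (T xi))%:E | xi in [set xi | l2_norm xi <= 1]].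

Definition bounded_op : set (l2 -> l2) :=
  [set T | linear T /\ (opnorm T < +oo)%E].

Definition adjoint (T S : l2 -> l2) : Prop :=
  forall xi eta : l2, inner (T xi) eta = inner xi (S eta).

Definition cstar_subalgebra (A : set (l2 -> l2)) : Prop :=
  [/\ A `<=` bounded_op,
      A 0 /\ (forall (c : R[i]) T S, A T -> A S -> A (c *: T + S)),
      forall T S, A T -> A S -> A (T \o S),
      forall T, A T -> exists2 S, A S & adjoint T S
    & forall T, bounded_op T ->
        (forall e : R, 0 < e -> exists2 S, A S & (opnorm (T - S)%R < e%:E)%E) ->
        A T].

Definition abelian_algebra (A : set (l2 -> l2)) : Prop :=
  forall T S, A T -> A S -> T \o S = S \o T.

Definition maximal_abelian (A M : set (l2 -> l2)) : Prop :=
  [/\ cstar_subalgebra M, M `<=` A, abelian_algebra M &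
    forall B, cstar_subalgebra B -> B `<=` A -> abelian_algebra B ->
      M `<=` B -> B = M].

End l2_def.

Section reduced.
Variables (R : realType) (G : etaleGroupoid).
Local Notation C := (R[i]^o).

Definition Cc : set (G -> C) :=
  [set f | continuous f /\ compact (closure [set g | f g != 0])].

(* (f * xi)(g) is the sum of f(a) xi(b) over the factorisations g = ab, which
   are the pairs (a, a^-1 g) with rng a = rng g; for f in Cc the sum is finite. *)
Definition convolution (f xi : G -> C) : G -> C := fun g =>
  \sum_(a \in [set a | rng a = rng g]) f a * xi (gmul (ginv a) g).

(* The direct sum of the representations of Cc(G) on l^2(G_x), for x a unit and
   G_x the set of arrows of source x: as G is the disjoint union of the G_x, its
   space is l^2(G).  For f in Cc, convolution by f preserves l^2(G), so that the
   default value 0 is not used. *)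
Definition regular_rep (f : G -> C) (xi : l2 R G) : l2 R G :=
  insubd 0 (convolution f xi).

(* C*_r(G): the completion of Cc(G) in the norm of regular_rep, realised as a
   closure in B(l^2(G)). *)
Definition reduced_cstar : set (l2 R G -> l2 R G) :=
  [set T | bounded_op T /\ forall e : R, 0 < e ->
    exists2 f, Cc f & (opnorm (T - regular_rep f)%R < e%:E)%E].

End reduced.

Arguments reduced_cstar : clear implicits.

Section inclusion.
Variables (R : realType) (G : etaleGroupoid).
Local Notation C := (R[i]^o).
Local Notation H := (iso_groupoid G).

Definition extend0 (f : H -> C) : G -> C := fun g =>
  oapp f 0 (insub g : option H).

(* The extension by continuity to C*_r(Iso(G)^o) of the map which sends the
   operator of f in Cc(Iso(G)^o) to the operator of extend0 f: the graph of
   iso_inclusion is the closure of the graph of this map. *)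
Definition iso_inclusion (T : l2 R H -> l2 R H) : l2 R G -> l2 R G :=
  xget 0 [set S | bounded_op S /\ forall e : R, 0 < e ->
    exists f, [/\ Cc f, (opnorm (T - regular_rep f)%R < e%:E)%E &
      (opnorm (S - regular_rep (extend0 f))%R < e%:E)%E]].

End inclusion.

Arguments iso_inclusion : clear implicits.

(* Main.v *)
(* Writing H for Iso(G)^o, an operator T of C*_r(G) commutes with right translations and
   has the kernel k(g) = (T delta_(s g))(g), a uniform limit of functions in Cc(G).  If T
   commutes with Cc(G^0), then k vanishes off Iso(G), hence, being continuous, off H.
   It remains to show that such a T is a limit of Cc(H), although H need not be closed.

   Take f in Cc(G) with |T - f| <= d.  Operators with kernel in H are block diagonal
   along the cosets of H, so their norm is a supremum over the fibres H_x; hence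
   |T - f 1_H| <= d and f 1_(G \ H) has norm at most 2d.  Near a unit x0, replace f 1_H
   by f th, where th in Cc(H) is 1 on the finite set of points of H_(x0) where f is not
   0.  If f (1 - th) had a large norm on H_x for x arbitrarily close to x0, let L be the
   limit of the groups H_x along an ultrafilter of such x.  As G is Hausdorff, L is an
   abelian subgroup of the isotropy group at x0, and on L the function f (1 - th) is
   f 1_(G \ H), of norm at most 2d.  Følner sets of L, which exist because a finitely
   generated abelian group has polynomial growth, transfer this bound to H_x, a
   contradiction.  The local functions th are then glued by a partition of unity. *)
Require Import Defs.
From mathcomp Require Import all_boot all_order all_algebra.
From mathcomp Require Import all_classical all_reals all_analysis.
From mathcomp Require Import complex ring lra zify.
Set Implicit Arguments.
Unset Strict Implicit.
Unset Printing Implicit Defensive.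
Import Order.TTheory GRing.Theory Num.Theory numFieldNormedType.Exports.
Import Normc.
Local Open Scope classical_set_scope.
Local Open Scope ring_scope.
Local Open Scope complex_scope.

(** * Finite submatrices of operators on l2 *)

(** The obstacle is that restriction to H need not map Cc(G) into Cc(H): arrows in the support of f
    over x0 may lie outside H and still be limits of arrows of H. Their contribution is controlled
    by amenability. The regular representations of the groups H_x have as limit a representation of
    L, and for amenable L this is weakly contained in the regular one, where the norm is already
    known. This is carried out with one pair of finite sets A' and A, with |A| <= 2 |A'|; the loss
    is a constant factor, harmless since d is arbitrary. Only finitely many products in L are
    involved, so a map that is multiplicative on a finite set replaces a homomorphism from L to H_x.
    The ultrafilter decides, for each of finitely many sections, whether it runs in H or outside H.
    Norms are read off finite submatrices of kernels ([mxbound]), where restriction to a fibre,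
    block decomposition and translation become manipulations of finite sums. *)

Section complex_norm.
Variable R : realType.
Implicit Types z w : R[i].

Lemma normc_ge0 z : 0 <= normc z.
Proof. by case: z => a b; exact: sqrtr_ge0. Qed.

Lemma normc_conj z : normc (conjc z) = normc z.
Proof. by case: z => a b /=; rewrite sqrrN. Qed.

Lemma normc_sum (I : Type) (s : seq I) (F : I -> R[i]) :
  normc (\sum_(i <- s) F i) <= \sum_(i <- s) normc (F i).
Proof.
elim/big_ind2 : _ => [|x a y b xa yb|//]; first by rewrite normc0.
exact: le_trans (le_normcD _ _) (lerD xa yb).
Qed.

Lemma normcB z w : normc (z - w) = normc (w - z).
Proof. by rewrite -opprB normcN. Qed.

Lemma normcE (z : R[i]) : `|z| = (normc z)%:C.
Proof. by case: z => a b; rewrite normc_def. Qed.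

Lemma mul_conjc z : z * conjc z = ((normc z ^+ 2)%:C : R[i]).
Proof. by rewrite -sqr_normc normcE -rmorphXn. Qed.

Lemma conjc_sum (I : Type) (s : seq I) (F : I -> R[i]) :
  conjc (\sum_(i <- s) F i) = \sum_(i <- s) conjc (F i).
Proof. exact: rmorph_sum. Qed.

Lemma Re_sum (I : Type) (s : seq I) (F : I -> R[i]) :
  complex.Re (\sum_(i <- s) F i) = \sum_(i <- s) complex.Re (F i).
Proof. by elim/big_rec2 : _ => // i _ y _ <-; case: (F i) y => ? ? []. Qed.

Lemma Im_sum (I : Type) (s : seq I) (F : I -> R[i]) :
  complex.Im (\sum_(i <- s) F i) = \sum_(i <- s) complex.Im (F i).
Proof. by elim/big_rec2 : _ => // i _ y _ <-; case: (F i) y => ? ? []. Qed.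

Lemma normc_Re z : `|complex.Re z| <= normc z.
Proof.
by case: z => a b /=; rewrite -sqrtr_sqr ler_sqrt ?lerDl ?sqr_ge0 // addr_ge0 ?sqr_ge0.
Qed.

Lemma normc_Im z : `|complex.Im z| <= normc z.
Proof.
by case: z => a b /=; rewrite -sqrtr_sqr ler_sqrt ?lerDr ?sqr_ge0 // addr_ge0 ?sqr_ge0.
Qed.

Lemma normc_le_ReIm z : normc z <= `|complex.Re z| + `|complex.Im z|.
Proof.
case: z => a b /=; rewrite -(@ler_sqr _ _ (`|a| + `|b|)) ?nnegrE ?sqrtr_ge0 ?addr_ge0 //.
rewrite sqr_sqrtr ?addr_ge0 ?sqr_ge0 // sqrrD !real_normK ?num_real //.
by rewrite -addrA lerD2l lerDr mulrn_wge0 // mulr_ge0.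
Qed.

End complex_norm.

Section finite_norm.
Variables (R : realType) (X : Type).
Local Notation C := R[i].
Implicit Types (s t : seq X) (xi eta : X -> C).

Definition fnorm s xi : R := Num.sqrt (\sum_(x <- s) normc (xi x) ^+ 2).

Lemma sumsq_ge0 s xi : 0 <= \sum_(x <- s) normc (xi x) ^+ 2.
Proof. by apply: sumr_ge0 => x _; exact: sqr_ge0. Qed.

Lemma fnorm_ge0 s xi : 0 <= fnorm s xi.
Proof. exact: sqrtr_ge0. Qed.

Lemma sqr_fnorm s xi : fnorm s xi ^+ 2 = \sum_(x <- s) normc (xi x) ^+ 2.
Proof. by rewrite sqr_sqrtr // sumsq_ge0. Qed.

Lemma CauchySchwarz_real s (a b : X -> R) :
  (\sum_(x <- s) a x * b x) ^+ 2 <=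
  (\sum_(x <- s) a x ^+ 2) * (\sum_(x <- s) b x ^+ 2).
Proof.
elim: s => [|x s]; first by rewrite !big_nil expr0n /= mul0r.
rewrite !big_cons; set P := \sum_(i <- s) _ * _; set A := \sum_(i <- s) _.
set B := \sum_(i <- s) _ => PAB.
have A0 : 0 <= A by apply: sumr_ge0 => i _; exact: sqr_ge0.
have B0 : 0 <= B by apply: sumr_ge0 => i _; exact: sqr_ge0.
(* The cross term of the expanded product. On squares, P^2 <= A B reduces the claim to 4 u v <= (u +
   v)^2 with u = a^2 B and v = b^2 A. *)
suff : 2 * (a x * b x * P) <= a x ^+ 2 * B + b x ^+ 2 * A.
  move: PAB; move: (a x) (b x) => u v; rewrite !expr2 => ? ?; nra.
apply: le_trans (ler_norm _) _.
rewrite -ler_sqr ?nnegrE //; last by rewrite addr_ge0 // mulr_ge0 // sqr_ge0.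
rewrite real_normK ?num_real //.
apply: (@le_trans _ _ (4 * (a x * b x) ^+ 2 * (A * B))).
  have -> : (2 * (a x * b x * P)) ^+ 2 = 4 * (a x * b x) ^+ 2 * P ^+ 2 by ring.
  by rewrite ler_wpM2l // mulr_ge0 // sqr_ge0.
have := sqr_ge0 (a x ^+ 2 * B - b x ^+ 2 * A).
move: (a x) (b x) => u v; rewrite !expr2 => ?; nra.
Qed.

Lemma CauchySchwarz s xi eta :
  \sum_(x <- s) normc (xi x * eta x) <= fnorm s xi * fnorm s eta.
Proof.
rewrite -ler_sqr ?nnegrE ?mulr_ge0 ?fnorm_ge0 //; last first.
  by apply: sumr_ge0 => x _; exact: normc_ge0.
under eq_bigr do rewrite normcM.
by rewrite exprMn !sqr_fnorm; exact: CauchySchwarz_real.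
Qed.

Lemma fnorm_triangle s xi eta :
  fnorm s (fun x => xi x + eta x) <= fnorm s xi + fnorm s eta.
Proof.
rewrite -ler_sqr ?nnegrE ?addr_ge0 ?fnorm_ge0 // sqrrD !sqr_fnorm.
apply: (@le_trans _ _ (\sum_(x <- s) (normc (xi x) + normc (eta x)) ^+ 2)).
  apply: ler_sum => x _; rewrite ler_sqr ?nnegrE ?addr_ge0 ?normc_ge0 //.
  exact: le_normcD.
under eq_bigr do rewrite sqrrD.
rewrite !big_split /= !lerD2r lerD2l -mulr2n.
rewrite -[X in X <= _]sumrMnl -[X in _ <= X](mulr_natl _ 2) mulr2n -mulr2n.
under eq_bigr do rewrite -mulr_natl -normcM.
by rewrite -mulr_sumr ler_pM2l //; exact: CauchySchwarz.
Qed.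

Lemma fnormZ s (a : C) xi : fnorm s (fun x => a * xi x) = normc a * fnorm s xi.
Proof.
rewrite /fnorm; under eq_bigr do rewrite normcM exprMn.
by rewrite -mulr_sumr sqrtrM ?sqr_ge0 // sqrtr_sqr ger0_norm ?normc_ge0.
Qed.

Lemma fnorm0 s : fnorm s (fun=> 0) = 0.
Proof. by rewrite /fnorm big1 ?sqrtr0 // => x _; rewrite normc0 expr0n. Qed.

Lemma fnorm_nil xi : fnorm [::] xi = 0.
Proof. by rewrite /fnorm big_nil sqrtr0. Qed.

Lemma fnorm_le_const s xi (c : R) : 0 <= c -> (forall x, normc (xi x) <= c) ->
  fnorm s xi <= Num.sqrt (size s)%:R * c.
Proof.
move=> c0 h; rewrite -[X in _ * X](ger0_norm c0) -sqrtr_sqr -sqrtrM //.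
rewrite ler_sqrt ?mulr_ge0 ?sqr_ge0 //.
elim: s => [|x s ih]; first by rewrite big_nil mul0r.
rewrite big_cons /= -natr1 mulrDl mul1r addrC lerD //.
by rewrite ler_sqr ?nnegrE ?normc_ge0.
Qed.

Lemma fnorm_sqr_le s xi t eta (c : R) : 0 <= c ->
  (\sum_(x <- s) normc (xi x) ^+ 2 <= c ^+ 2 * \sum_(x <- t) normc (eta x) ^+ 2) ->
  fnorm s xi <= c * fnorm t eta.
Proof.
move=> c0 h; rewrite -ler_sqr ?nnegrE ?mulr_ge0 ?fnorm_ge0 //.
by rewrite exprMn !sqr_fnorm.
Qed.

End finite_norm.

Lemma eq_fnorm (R : realType) (X : eqType) (s : seq X) (xi eta : X -> R[i]) :
  {in s, xi =1 eta} -> fnorm s xi = fnorm s eta.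
Proof.
by move=> h; rewrite /fnorm; congr Num.sqrt; apply: eq_big_seq => x /h ->.
Qed.

Lemma fnorm_map (R : realType) (X Y : Type) (f : X -> Y) (s : seq X)
  (xi : Y -> R[i]) : fnorm (map f s) xi = fnorm s (xi \o f).
Proof. by rewrite /fnorm big_map. Qed.

Lemma sum_uniq_sub (R : realType) (X : eqType) (s t : seq X) (F : X -> R) :
  uniq s -> {subset s <= t} -> (forall x, 0 <= F x) ->
  \sum_(x <- s) F x <= \sum_(x <- t) F x.
Proof.
elim: s t => [|x s ih] t; first by rewrite big_nil => _ _ ?; exact: sumr_ge0.
move=> /= /andP[xs us] st F0; have xt : x \in t by apply: st; rewrite mem_head.
rewrite big_cons (perm_big _ (perm_to_rem xt)) big_cons lerD2l.
apply: ih => // y ys; have : y \in t by apply: st; rewrite inE ys orbT.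
rewrite (perm_mem (perm_to_rem xt)) inE => /orP[/eqP yx|//].
by rewrite yx in ys; rewrite ys in xs.
Qed.

Lemma fnorm_sub (R : realType) (X : eqType) (s t : seq X) (xi : X -> R[i]) :
  uniq s -> {subset s <= t} -> fnorm s xi <= fnorm t xi.
Proof.
move=> us st; rewrite ler_sqrt ?sumsq_ge0 //; apply: sum_uniq_sub => // x.
exact: sqr_ge0.
Qed.

Section matrix_bounds.
Variables (R : realType) (X : eqType).
Local Notation C := R[i].
Implicit Types (A : set X) (K : X -> X -> C) (c : R).

Definition mxapp K (t : seq X) (xi : X -> C) : X -> C :=
  fun x => \sum_(y <- t) K x y * xi y.

(* The finite submatrices of K with indices in A have operator norm at most c. *)
Definition mxbound A K c := forall s t, uniq s -> uniq t ->
  (forall x, x \in s -> A x) -> (forall x, x \in t -> A x) ->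
  forall xi, fnorm s (mxapp K t xi) <= c * fnorm t xi.

Lemma mxbound_ext A K K' c : (forall x y, A x -> A y -> K x y = K' x y) ->
  mxbound A K c -> mxbound A K' c.
Proof.
move=> KK' Kc s t us ut sA tA xi; apply: le_trans (Kc s t us ut sA tA xi).
rewrite (eq_fnorm (eta := mxapp K t xi)) // => x xs.
by apply: eq_big_seq => y yt; rewrite KK' //; [exact: sA|exact: tA].
Qed.

Lemma mxbound_le A K c c' : c <= c' -> mxbound A K c -> mxbound A K c'.
Proof.
move=> cc' Kc s t us ut sA tA xi; apply: le_trans (Kc s t us ut sA tA xi) _.
by rewrite ler_wpM2r ?fnorm_ge0.
Qed.

Lemma mxbound_sub A B K c : A `<=` B -> mxbound B K c -> mxbound A K c.
Proof.
by move=> AB Kc s t us ut sA tA; apply: Kc => // x => [/sA|/tA]; exact: AB.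
Qed.

Lemma mxboundD A K K' c c' : mxbound A K c -> mxbound A K' c' ->
  mxbound A (fun x y => K x y + K' x y) (c + c').
Proof.
move=> Kc Kc' s t us ut sA tA xi.
rewrite mulrDl; apply: le_trans (lerD (Kc _ _ us ut sA tA xi) (Kc' _ _ us ut sA tA xi)).
apply: le_trans (fnorm_triangle _ _ _).
rewrite (eq_fnorm (eta := fun x => mxapp K t xi x + mxapp K' t xi x)) //.
by move=> x _; rewrite /mxapp -big_split; apply: eq_bigr => y _; rewrite mulrDl.
Qed.

Lemma mxboundZ A K c (a : C) : mxbound A K c ->
  mxbound A (fun x y => a * K x y) (normc a * c).
Proof.
move=> Kc s t us ut sA tA xi.
rewrite -mulrA; apply: le_trans (ler_wpM2l (normc_ge0 a) (Kc _ _ us ut sA tA xi)).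
rewrite -fnormZ (eq_fnorm (eta := fun x => a * mxapp K t xi x)) //.
by move=> x _; rewrite /mxapp mulr_sumr; apply: eq_bigr => y _; rewrite mulrA.
Qed.

Lemma mxboundN A K c : mxbound A K c -> mxbound A (fun x y => - K x y) c.
Proof.
move=> /(mxboundZ (-1)); rewrite normcN normc1 mul1r.
by apply: mxbound_ext => x y _ _; rewrite mulN1r.
Qed.

Lemma mxboundB A K K' c c' : mxbound A K c -> mxbound A K' c' ->
  mxbound A (fun x y => K x y - K' x y) (c + c').
Proof. by move=> Kc /mxboundN; exact: mxboundD. Qed.

Lemma mxbound0 A : mxbound A (fun _ _ => 0) 0.
Proof.
move=> s t us ut sA tA xi; rewrite mul0r (eq_fnorm (eta := fun=> 0)) ?fnorm0 //.
by move=> x _; rewrite /mxapp big1 // => y _; rewrite mul0r.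
Qed.

(** Testing [K] on the conjugate of its own row returns the squared norm of that row at the
    coordinate [x]. *)
Lemma mxbound_row A K c x t : 0 <= c -> mxbound A K c -> A x -> uniq t ->
  (forall y, y \in t -> A y) -> fnorm t (K x) <= c.
Proof.
move=> c0 Kc Ax ut tA; have := Kc [:: x] t isT ut _ tA (fun y => conjc (K x y)).
have -> : fnorm t (fun y => conjc (K x y)) = fnorm t (K x).
  by rewrite /fnorm; under eq_bigr do rewrite normc_conj.
have -> : fnorm [:: x] (mxapp K t (fun y => conjc (K x y))) = fnorm t (K x) ^+ 2.
  rewrite /fnorm big_seq1 sqrtr_sqr ger0_norm ?normc_ge0 //.
  rewrite /mxapp; under eq_bigr do rewrite mul_conjc.
  rewrite -rmorph_sum /= expr0n /= addr0 sqrtr_sqr ger0_norm ?sqr_sqrtr //.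
    exact: sumsq_ge0.
  exact: sumsq_ge0.
move=> h; have [z|n0] := eqVneq (fnorm t (K x)) 0; first by rewrite z.
have p : 0 < fnorm t (K x) by rewrite lt_def n0 fnorm_ge0.
rewrite -(ler_pM2r p) -expr2; apply: h => y.
by rewrite inE => /eqP ->.
Qed.

Lemma mxbound_entry A K c x y : 0 <= c -> mxbound A K c -> A x -> A y ->
  normc (K x y) <= c.
Proof.
move=> c0 Kc Ax Ay; have := @mxbound_row A K c x [:: y] c0 Kc Ax isT.
rewrite /fnorm big_seq1 sqrtr_sqr ger0_norm ?normc_ge0 //; apply => z.
by rewrite inE => /eqP ->.
Qed.

(** For z the image of xi under the adjoint, |z|^2 is the pairing of xi with K z, at most c |xi| |z|
    by Cauchy-Schwarz; one factor |z| cancels. *)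
Lemma mxbound_adj A K c : 0 <= c -> mxbound A K c ->
  mxbound A (fun x y => conjc (K y x)) c.
Proof.
move=> c0 Kc s t us ut sA tA xi.
set K' := fun x y => _; set z := mxapp K' t xi.
have e : fnorm s z ^+ 2 <= (c * fnorm t xi) * fnorm s z.
  have -> : fnorm s z ^+ 2 = normc (\sum_(x <- s) z x * conjc (z x)).
    under eq_bigr do rewrite mul_conjc.
    rewrite -rmorph_sum /= expr0n /= addr0 sqrtr_sqr sqr_fnorm ger0_norm //.
    exact: sumsq_ge0.
  have -> : \sum_(x <- s) z x * conjc (z x) =
            \sum_(y <- t) xi y * conjc (mxapp K s z y).
    rewrite /z {1}/mxapp; under eq_bigr do rewrite mulr_suml.
    rewrite exchange_big /=; apply: eq_bigr => y _.
    rewrite /mxapp conjc_sum mulr_sumr; apply: eq_bigr => x _.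
    by rewrite /K' rmorphM /= -/(mxapp K' t xi x); ring.
  apply: le_trans (normc_sum _ _) _; apply: le_trans (CauchySchwarz _ _ _) _.
  rewrite [leLHS]mulrC [leRHS]mulrAC ler_wpM2r ?fnorm_ge0 //.
  rewrite (_ : fnorm t _ = fnorm t (mxapp K s z)) ?Kc //.
  by rewrite /fnorm; under eq_bigr do rewrite normc_conj.
have [->|n0] := eqVneq (fnorm s z) 0; first by rewrite mulr_ge0 ?fnorm_ge0.
have p : 0 < fnorm s z by rewrite lt_def n0 fnorm_ge0.
by rewrite -(ler_pM2r p) -expr2.
Qed.

(** A Schur test for sparse kernels: Cauchy-Schwarz in each row costs a factor n, exchanging the
    sums another, and the root of n^2 M^2 is the bound. *)
Lemma mxbound_schur A K (n : nat) (M : R) : 0 <= M ->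
  (forall x y, A x -> A y -> normc (K x y) <= M) ->
  (forall x t, A x -> uniq t -> (forall y, y \in t -> A y /\ K x y != 0) ->
    (size t <= n)%N) ->
  (forall y s, A y -> uniq s -> (forall x, x \in s -> A x /\ K x y != 0) ->
    (size s <= n)%N) ->
  mxbound A K (n%:R * M).
Proof.
move=> M0 KM rows cols s t us ut sA tA xi.
apply: fnorm_sqr_le; first by rewrite mulr_ge0.
have nK x : A x -> \sum_(y <- t) (K x y != 0)%:R <= n%:R :> R.
  move=> Ax; rewrite -natr_sum ler_nat.
  rewrite -[X in (X <= _)%N](_ : size [seq y <- t | K x y != 0] = _).
    apply: (rows x) => //; first exact: filter_uniq.
    by move=> y; rewrite mem_filter => /andP[? /tA].
  by rewrite size_filter -sum1_count big_mkcond.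
have nK' y : A y -> \sum_(x <- s) (K x y != 0)%:R <= n%:R :> R.
  move=> Ay; rewrite -natr_sum ler_nat.
  rewrite -[X in (X <= _)%N](_ : size [seq x <- s | K x y != 0] = _).
    apply: (cols y) => //; first exact: filter_uniq.
    by move=> x; rewrite mem_filter => /andP[? /sA].
  by rewrite size_filter -sum1_count big_mkcond.
apply: (@le_trans _ _ (\sum_(x <- s) n%:R * \sum_(y <- t)
  (K x y != 0)%:R * (M ^+ 2 * normc (xi y) ^+ 2))).
  rewrite big_seq [leRHS]big_seq; apply: ler_sum => x xs.
  (* The indicator of the support is written twice, once for each factor of Cauchy-Schwarz: the
     first sums to the number of nonzero entries, the second keeps the other factor on the
     support. *)
  apply: (@le_trans _ _ ((\sum_(y <- t) (K x y != 0)%:R *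
     (M * normc (xi y) * (K x y != 0)%:R)) ^+ 2)).
    rewrite ler_sqr ?nnegrE ?normc_ge0 //; last first.
      by apply: sumr_ge0 => y _; rewrite !mulr_ge0 ?normc_ge0.
    apply: le_trans (normc_sum _ _) _; rewrite big_seq [leRHS]big_seq.
    apply: ler_sum => y yt; rewrite normcM.
    have [->|_] := eqVneq (K x y) 0; first by rewrite normc0 !mul0r.
    by rewrite mul1r mulr1 ler_wpM2r ?normc_ge0 // KM //; [exact: sA|exact: tA].
  apply: le_trans (CauchySchwarz_real _ _ _) _.
  apply: ler_pM; try by apply: sumr_ge0 => y _; exact: sqr_ge0.
    apply: le_trans (nK x (sA _ xs)); apply: ler_sum => y _.
    by rewrite -natrX; case: (_ != _).
  apply: ler_sum => y _; rewrite !exprMn mulrC -natrX.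
  by case: (_ != _); rewrite ?mul0r ?mul1r.
rewrite -mulr_sumr exchange_big /= exprMn expr2 -!mulrA ler_wpM2l //.
rewrite !mulr_sumr big_seq [leRHS]big_seq; apply: ler_sum => y yt.
rewrite -mulr_suml -mulrA ler_wpM2r ?mulr_ge0 ?normc_ge0 //.
exact: nK' (tA _ yt).
Qed.

End matrix_bounds.

Lemma mxbound_reindex (R : realType) (X Y : eqType) (phi : X -> Y) (A : set X)
  (B : set Y) (K : X -> X -> R[i]) (K' : Y -> Y -> R[i]) c :
  {in A &, injective phi} -> (forall x, A x -> B (phi x)) ->
  (forall x y, A x -> A y -> K x y = K' (phi x) (phi y)) ->
  mxbound B K' c -> mxbound A K c.
Proof.
move=> injphi AB KK' Kc s t us ut sA tA xi.
have ui (u : seq X) : uniq u -> (forall x, x \in u -> A x) -> uniq (map phi u).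
  move=> uu uA; rewrite map_inj_in_uniq // => x y /uA xA /uA yA.
  by apply: injphi; rewrite inE.
have uB (u : seq X) : (forall x, x \in u -> A x) -> forall y, y \in map phi u -> B y.
  by move=> uA y /mapP[x /uA xA ->]; exact: AB.
(* [K'] has to be tested on a vector over [Y]: the push-forward of [xi], whose fibres inside [t] are
   single points by injectivity. *)
pose zeta y := \sum_(x <- t | phi x == y) xi x.
have zetaE x : x \in t -> zeta (phi x) = xi x.
  move=> xt; rewrite /zeta big_mkcond (bigD1_seq x) //= eqxx big1_seq ?addr0 //.
  move=> y /andP[yx yt]; case: eqP => // /injphi e.
  by rewrite e ?eqxx ?inE // in yx; [exact: tA|exact: tA].
have := Kc (map phi s) (map phi t) (ui _ us sA) (ui _ ut tA) (uB _ sA) (uB _ tA) zeta.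
rewrite !fnorm_map.
rewrite [X in _ <= _ * X -> _](eq_fnorm (eta := xi)); last first.
  by move=> x xt; exact: zetaE.
rewrite [X in X <= _ -> _](eq_fnorm (eta := mxapp K t xi)) // => x xs.
rewrite /mxapp /= big_map; apply: eq_big_seq => y yt.
by rewrite zetaE // KK' //; [exact: sA|exact: tA].
Qed.

(** Distinct classes do not interact, so both squared norms split over the finitely many classes
    that meet [s] or [t], and the bounds add up. *)
Lemma mxbound_block (R : realType) (X Z : eqType) (cl : X -> Z)
  (A : set X) (K : X -> X -> R[i]) c : 0 <= c ->
  (forall x y, A x -> A y -> K x y != 0 -> cl x = cl y) ->
  (forall z, mxbound [set x | A x /\ cl x = z] K c) -> mxbound A K c.
Proof.
move=> c0 Kcl Kc s t us ut sA tA xi; apply: fnorm_sqr_le => //.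
pose Zs := undup (map cl (s ++ t)).
have clZ (u : seq X) (F : X -> R) : {subset u <= s ++ t} ->
    \sum_(x <- u) F x = \sum_(z <- Zs) \sum_(x <- u | cl x == z) F x.
  move=> ust; rewrite (exchange_big_dep predT) //= big_seq [RHS]big_seq; apply: eq_bigr => x xu.
  rewrite big_mkcond (bigD1_seq (cl x)) ?undup_uniq //=; last first.
    by rewrite mem_undup map_f // ust.
  rewrite eqxx big1 ?addr0 // => z; rewrite eq_sym => /negbTE -> //.
rewrite (clZ s); last by move=> x; rewrite mem_cat => ->.
rewrite (clZ t); last by move=> x; rewrite mem_cat orbC => ->.
rewrite mulr_sumr; apply: ler_sum => z _.
rewrite -!(big_filter _ (fun x => cl x == z)).
set s' := [seq x <- s | cl x == z]; set t' := [seq x <- t | cl x == z].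
have s'A x : x \in s' -> A x /\ cl x = z.
  by rewrite mem_filter => /andP[/eqP ? /sA].
have t'A x : x \in t' -> A x /\ cl x = z.
  by rewrite mem_filter => /andP[/eqP ? /tA].
have : fnorm s' (mxapp K t' xi) ^+ 2 <= (c * fnorm t' xi) ^+ 2.
  rewrite ler_sqr ?nnegrE ?mulr_ge0 ?fnorm_ge0 //.
  exact: (Kc z) (filter_uniq _ us) (filter_uniq _ ut) s'A t'A xi.
rewrite exprMn !sqr_fnorm.
congr (_ <= _); apply: eq_big_seq => x /s'A[Ax clx].
rewrite /mxapp [in RHS](bigID (fun y => cl y == z)) /= -[X in X + _]big_filter.
rewrite [X in _ + X]big1_seq ?addr0 // => y /andP[yz yt].
have [->|/(Kcl _ _ Ax (tA _ yt)) e] := eqVneq (K x y) 0; first by rewrite mul0r.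
by rewrite -e clx eqxx in yz.
Qed.

(** * Operators on l2 and their matrices *)

Section unordered_sums.
Variables (R : realType) (X : choiceType).
Local Notation C := (R[i]^o).
Implicit Types (f : X -> C) (g : X -> R) (s t : seq X).

Lemma esum_ge_seq g s : (forall x, 0 <= g x) -> uniq s ->
  ((\sum_(x <- s) g x)%:E <= \esum_(x in [set: X]) (g x)%:E)%E.
Proof.
move=> g0 us; apply: ereal_sup_ubound; exists [set` s].
  by split => //; exact: finite_seq.
by rewrite -fsbig_seq // sumEFin.
Qed.

Lemma esum_le_seq g (c : \bar R) :
  (forall s, uniq s -> ((\sum_(x <- s) g x)%:E <= c)%E) ->
  (\esum_(x in [set: X]) (g x)%:E <= c)%E.
Proof.
move=> h; apply: ge_ereal_sup => _ [F [finF _] <-].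
by rewrite fsbig_finite //= sumEFin; apply: h; exact: finmap.fset_uniq.
Qed.

Lemma esum_fin g (M : R) : (forall x, 0 <= g x) ->
  (forall s, uniq s -> \sum_(x <- s) g x <= M) ->
  exists2 S : R, (\esum_(x in [set: X]) (g x)%:E)%E = S%:E &
    (forall s, uniq s -> \sum_(x <- s) g x <= S) /\
    forall e, 0 < e -> exists2 s, uniq s & S - e < \sum_(x <- s) g x.
Proof.
move=> g0 gM; have M0 : (\esum_(x in [set: X]) (g x)%:E <= M%:E)%E.
  by apply: esum_le_seq => s us; rewrite lee_fin gM.
have S0 : (0 <= \esum_(x in [set: X]) (g x)%:E)%E.
  by apply: esum_ge0 => x _; rewrite lee_fin.
case E : (\esum_(x in _) _)%E M0 S0 => [S| |] //= _ _.
exists S => //; split=> [s us|e e0]; first by rewrite -lee_fin -E esum_ge_seq.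
apply: contrapT => h; have : (\esum_(x in [set: X]) (g x)%:E <= (S - e)%:E)%E.
  apply: esum_le_seq => s us; rewrite lee_fin leNgt; apply/negP => ?.
  by apply: h; exists s.
by rewrite E lee_fin; lra.
Qed.

(** Convergence of the net of finite partial sums. After [csumP], [csum] is handled through this and
    [sums_to_unique], without the positive and negative parts that define it. *)
Definition sums_to f (z : C) := forall e : R, 0 < e -> exists2 t0, uniq t0 &
  forall t, uniq t -> {subset t0 <= t} -> normc (z - \sum_(x <- t) f x) <= e.

Definition abs_summable f := exists M : R, forall t, uniq t ->
  \sum_(x <- t) normc (f x) <= M.

Lemma uniq_join t0 t1 : exists2 t, uniq t & {subset t0 <= t} /\ {subset t1 <= t}.
Proof.
exists (undup (t0 ++ t1)); first exact: undup_uniq.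
by split=> x xt; rewrite mem_undup mem_cat xt ?orbT.
Qed.

Lemma rsum_approx g (M : R) : (forall s, uniq s -> \sum_(x <- s) `|g x| <= M) ->
  forall e : R, 0 < e -> exists2 t0, uniq t0 &
    forall t, uniq t -> {subset t0 <= t} -> `|rsum g - \sum_(x <- t) g x| <= e.
Proof.
move=> gM e e0; pose gp x := Num.max (g x) 0; pose gn x := Num.max (- g x) 0.
have gp0 x : 0 <= gp x by rewrite /gp le_max lexx orbT.
have gn0 x : 0 <= gn x by rewrite /gn le_max lexx orbT.
have gpn x : gp x <= `|g x| /\ gn x <= `|g x|.
  by rewrite /gp /gn !ge_max normr_ge0 ler_norm -normrN ler_norm.
have [|S SE [Sub Sap]] := @esum_fin gp M gp0.
  move=> s us; apply: le_trans (gM s us); apply: ler_sum => x _.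
  by have [] := gpn x.
have [|S' SE' [Sub' Sap']] := @esum_fin gn M gn0.
  move=> s us; apply: le_trans (gM s us); apply: ler_sum => x _.
  by have [] := gpn x.
have e2 : 0 < e / 2 by lra.
have [t1 ut1 h1] := Sap _ e2; have [t2 ut2 h2] := Sap' _ e2.
have [t0 ut0 [t10 t20]] := uniq_join t1 t2.
exists t0 => // t ut t0t; rewrite /rsum SE SE' /=.
have -> : \sum_(x <- t) g x = \sum_(x <- t) gp x - \sum_(x <- t) gn x.
  rewrite -sumrB; apply: eq_bigr => x _; rewrite /gp /gn.
  by case: (leP (g x) 0) => ?; case: (leP (- g x) 0) => ?; lra.
have := Sub _ ut; have := Sub' _ ut.
have : \sum_(x <- t1) gp x <= \sum_(x <- t) gp x.
  by apply: sum_uniq_sub => // x /t10/t0t.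
have : \sum_(x <- t2) gn x <= \sum_(x <- t) gn x.
  by apply: sum_uniq_sub => // x /t20/t0t.
by rewrite ler_norml => ? ? ? ?; apply/andP; split; lra.
Qed.

Lemma csumP f : abs_summable f -> sums_to f (csum f).
Proof.
move=> [M fM] e e0; have e2 : 0 < e / 2 by lra.
have [|t1 ut1 h1] := @rsum_approx (fun x => complex.Re (f x)) M _ _ e2.
  by move=> s us; apply: le_trans (fM s us); apply: ler_sum => x _; exact: normc_Re.
have [|t2 ut2 h2] := @rsum_approx (fun x => complex.Im (f x)) M _ _ e2.
  by move=> s us; apply: le_trans (fM s us); apply: ler_sum => x _; exact: normc_Im.
have [t0 ut0 [t10 t20]] := uniq_join t1 t2.
exists t0 => // t ut t0t; apply: le_trans (normc_le_ReIm _) _.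
have -> : e = e / 2 + e / 2 by lra.
have ReB (z w : R[i]) : complex.Re (z - w) = complex.Re z - complex.Re w.
  by case: z w => ? ? [].
have ImB (z w : R[i]) : complex.Im (z - w) = complex.Im z - complex.Im w.
  by case: z w => ? ? [].
rewrite ReB ImB Re_sum Im_sum; apply: lerD.
  by apply: h1 => // x /t10/t0t.
by apply: h2 => // x /t20/t0t.
Qed.

Lemma sums_to_unique f z w : sums_to f z -> sums_to f w -> z = w.
Proof.
move=> fz fw; apply/eqP; rewrite -subr_eq0; apply/eqP/eq0_normc/eqP.
rewrite eq_le normc_ge0 andbT; apply/ler_addgt0Pr => e e0; rewrite add0r.
have e2 : 0 < e / 2 by lra.
have [t1 ut1 h1] := fz _ e2; have [t2 ut2 h2] := fw _ e2.
have [t0 ut0 [t10 t20]] := uniq_join t1 t2.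
have -> : z - w = (z - \sum_(x <- t0) f x) + (\sum_(x <- t0) f x - w).
  by rewrite addrA subrK.
apply: le_trans (le_normcD _ _) _; have := h1 _ ut0 t10.
by have := h2 _ ut0 t20; rewrite normcB; lra.
Qed.

Lemma sums_to_linear f f' z w (a : C) : sums_to f z -> sums_to f' w ->
  sums_to (fun x => a * f x + f' x) (a * z + w).
Proof.
move=> fz fw e e0; have e2 : 0 < e / 2 by lra.
(* The 1 keeps the denominator positive when a = 0; the same device returns wherever an error is
   divided by a constant that may vanish. *)
have e3 : 0 < e / 2 / (normc a + 1).
  by rewrite divr_gt0 // ltr_wpDl ?normc_ge0.
have [t1 ut1 h1] := fz _ e3; have [t2 ut2 h2] := fw _ e2.
have [t0 ut0 [t10 t20]] := uniq_join t1 t2.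
exists t0 => // t ut t0t; rewrite big_split /= -mulr_sumr.
have -> (p q : C) : a * z + w - (a * p + q) = a * (z - p) + (w - q) by ring.
apply: le_trans (le_normcD _ _) _; rewrite normcM.
have := h1 _ ut (fun _ x => t0t _ (t10 _ x)).
have := h2 _ ut (fun _ x => t0t _ (t20 _ x)).
set p := normc (w - _); set q := normc (z - _) => pe.
rewrite ler_pdivlMr; last by rewrite ltr_wpDl ?normc_ge0.
have := normc_ge0 (z - \sum_(i <- t) f i); rewrite -/q.
by have := normc_ge0 a; move: (normc a) => n ? ?; nra.
Qed.

Lemma sums_to_conj f z : sums_to f z -> sums_to (fun x => conjc (f x)) (conjc z).
Proof.
move=> fz e e0; have [t0 ut0 h] := fz _ e0; exists t0 => // t ut t0t.
have -> : conjc z - \sum_(x <- t) conjc (f x) = conjc (z - \sum_(x <- t) f x).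
  by rewrite -conjc_sum rmorphB.
by rewrite normc_conj h.
Qed.

Lemma sums_to_finite f t0 : uniq t0 -> (forall x, x \notin t0 -> f x = 0) ->
  sums_to f (\sum_(x <- t0) f x).
Proof.
move=> ut0 f0 e e0; exists t0 => // t ut t0t.
rewrite (_ : \sum_(x <- t) f x = \sum_(x <- t0) f x) ?subrr ?normc0 ?ltW //.
rewrite (bigID (mem t0)) /= addrC big1 ?add0r // -big_filter.
apply: perm_big; apply: uniq_perm; rewrite ?filter_uniq // => x.
by rewrite mem_filter; case: (boolP (x \in t0)) => //= /t0t.
Qed.

End unordered_sums.

Section l2_theory.
Variables (R : realType) (X : choiceType).
Local Notation C := (R[i]^o).
Implicit Types (xi eta : l2 R X) (s t : seq X) (T S : l2 R X -> l2 R X).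

Lemma l2_ext xi eta : (forall x, xi x = eta x) -> xi = eta.
Proof. by move=> h; apply/val_inj/funext. Qed.

Lemma l2E (a : R[i]) xi eta x : (a *: xi + eta : l2 R X) x = a * xi x + eta x.
Proof. by []. Qed.

Lemma l2BE xi eta x : (xi - eta : l2 R X) x = xi x - eta x.
Proof. by []. Qed.

Lemma l2_sumE (I : Type) (r : seq I) (F : I -> l2 R X) x :
  (\sum_(i <- r) F i) x = \sum_(i <- r) F i x.
Proof. by elim: r => [|i r ih]; rewrite ?big_nil ?big_cons // -ih. Qed.

Lemma l2_predP (f : X -> C) (c : R) : (forall s, uniq s -> fnorm s f <= c) ->
  f \in @l2_pred R X.
Proof.
move=> h; apply/asboolP; apply: (@le_lt_trans _ _ (c ^+ 2)%:E); last exact: ltry.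
apply: esum_le_seq => s us; rewrite lee_fin -sqr_fnorm ler_sqr ?nnegrE ?fnorm_ge0 ?h //.
exact: le_trans (fnorm_ge0 s f) (h _ us).
Qed.

Lemma l2_norm_ge0 xi : 0 <= l2_norm xi.
Proof. exact: sqrtr_ge0. Qed.

Let n0 xi x : 0 <= normc (xi x) ^+ 2. Proof. exact: sqr_ge0. Qed.

Lemma l2_esum xi : exists2 S : R,
  (\esum_(x in [set: X]) (normc (xi x) ^+ 2)%:E)%E = S%:E & 0 <= S.
Proof.
have /asboolP : l2_val xi \in @l2_pred R X by case: xi.
have : (0 <= \esum_(x in [set: X]) (normc (xi x) ^+ 2)%:E)%E.
  by apply: esum_ge0 => x _; rewrite lee_fin.
case: (esum _ _) => [S| |] // S0 _.
by exists S => //; rewrite -lee_fin.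
Qed.

Lemma fnorm_le_l2 xi s : uniq s -> fnorm s xi <= l2_norm xi.
Proof.
move=> us; rewrite /l2_norm; have [S SE S0] := l2_esum xi.
rewrite SE ler_sqrt //= -lee_fin -SE; exact: esum_ge_seq.
Qed.

Lemma l2_norm_le xi (c : R) : 0 <= c -> (forall s, uniq s -> fnorm s xi <= c) ->
  l2_norm xi <= c.
Proof.
move=> c0 h; rewrite /l2_norm; have [S SE S0] := l2_esum xi.
rewrite SE /= -[leRHS](ger0_norm c0) -sqrtr_sqr ler_sqrt ?sqr_ge0 // -lee_fin -SE.
apply: esum_le_seq => s us.
by rewrite lee_fin -sqr_fnorm ler_sqr ?nnegrE ?fnorm_ge0 ?h.
Qed.

Lemma normc_le_l2 xi x : normc (xi x) <= l2_norm xi.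
Proof.
have := @fnorm_le_l2 xi [:: x] isT.
by rewrite /fnorm big_seq1 sqrtr_sqr ger0_norm ?normc_ge0.
Qed.

Lemma l2_norm0 : l2_norm (0 : l2 R X) = 0.
Proof.
apply/le_anti; rewrite l2_norm_ge0 andbT; apply: l2_norm_le => // s us.
by rewrite (eq_fnorm (eta := fun=> 0)) ?fnorm0.
Qed.

Lemma l2_norm_eq0 xi : l2_norm xi <= 0 -> xi = 0.
Proof.
move=> h; apply: l2_ext => x; apply/eq0_normc/le_anti.
by rewrite normc_ge0 andbT (le_trans (normc_le_l2 _ _)).
Qed.

Lemma l2_normD xi eta : l2_norm (xi + eta) <= l2_norm xi + l2_norm eta.
Proof.
apply: l2_norm_le => [|s us]; first by rewrite addr_ge0 ?l2_norm_ge0.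
by apply: le_trans (fnorm_triangle _ _ _) _; rewrite lerD ?fnorm_le_l2.
Qed.

Lemma l2_normZ_le (a : R[i]) xi : l2_norm (a *: xi) <= normc a * l2_norm xi.
Proof.
apply: l2_norm_le => [|s us]; first by rewrite mulr_ge0 ?normc_ge0 ?l2_norm_ge0.
by rewrite fnormZ ler_wpM2l ?normc_ge0 ?fnorm_le_l2.
Qed.

Lemma l2_normN xi : l2_norm (- xi) = l2_norm xi.
Proof.
have le eta : l2_norm (- eta) <= l2_norm eta.
  by have := l2_normZ_le (-1) eta; rewrite scaleN1r normcN normc1 mul1r.
by apply/le_anti; rewrite le -{1}(opprK xi) le.
Qed.

Fact delta_subproof y : (fun x => (x == y)%:R : C) \in @l2_pred R X.
Proof.
apply: (@l2_predP _ 1) => s us; rewrite -sqrtr1 ler_sqrt //.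
have [ys|ys] := boolP (y \in s); last first.
  rewrite big1_seq // => x /= xs; case: eqP => [xy|_]; last by rewrite normc0 expr0n.
  by rewrite -xy xs in ys.
rewrite (bigD1_seq y) //= eqxx normc1 expr1n big1 ?addr0 // => x /negbTE ->.
by rewrite normc0 expr0n.
Qed.

Definition delta y : l2 R X := L2 (delta_subproof y).

Lemma deltaE y x : delta y x = (x == y)%:R.
Proof. by []. Qed.

Definition trunc t (f : X -> C) : l2 R X := \sum_(y <- t) f y *: delta y.

Lemma truncE t (f : X -> C) x : uniq t -> trunc t f x = if x \in t then f x else 0.
Proof.
move=> ut; rewrite l2_sumE.
rewrite (eq_bigr (fun y => f y * (x == y)%:R)) //.
case: ifPn => xt.
  rewrite (bigD1_seq x) //= eqxx mulr1 big1 ?addr0 // => y.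
  by rewrite eq_sym => /negbTE ->; rewrite mulr0.
rewrite big1_seq // => y /= yt; case: eqP => [xy|_]; last by rewrite mulr0.
by rewrite xy yt in xt.
Qed.

Lemma l2_norm_trunc t (f : X -> C) : uniq t -> l2_norm (trunc t f) <= fnorm t f.
Proof.
move=> ut; apply: l2_norm_le => [|s us]; first exact: fnorm_ge0.
rewrite (_ : fnorm s _ = fnorm [seq x <- s | x \in t] f).
  apply: fnorm_sub; first exact: filter_uniq.
  by move=> x; rewrite mem_filter => /andP[].
rewrite /fnorm big_filter [in RHS]big_mkcond; congr Num.sqrt.
apply: eq_bigr => x _; rewrite truncE //.
by case: ifP => //; rewrite normc0 expr0n.
Qed.

Lemma trunc_approx xi (e : R) : 0 < e ->
  exists2 t, uniq t & l2_norm (xi - trunc t xi) <= e.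
Proof.
move=> e0; have [S SE S0] := l2_esum xi.
have bd s : uniq s -> \sum_(x <- s) normc (xi x) ^+ 2 <= S.
  by move=> us; rewrite -lee_fin -SE esum_ge_seq.
have [S' S'E [_ ap]] := esum_fin (n0 xi) bd.
have SS : S' = S by apply/EFin_inj; rewrite -SE -S'E.
have e20 : 0 < e ^+ 2 by rewrite exprn_gt0.
have [t ut ht] := ap _ e20; exists t => //.
apply: l2_norm_le => [|s us]; first exact: ltW.
rewrite -ler_sqr ?nnegrE ?fnorm_ge0 ?(ltW e0) // sqr_fnorm.
(* [s'] and [t] are disjoint, so together they sum to at most S, while [t] alone exceeds S - e^2:
   the tail over [s'] is below e^2. *)
pose s' := [seq x <- s | x \notin t].
have -> : \sum_(x <- s) normc ((xi - trunc t xi) x) ^+ 2 =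
          \sum_(x <- s') normc (xi x) ^+ 2.
  rewrite big_filter [in RHS]big_mkcond; apply: eq_bigr => x _.
  rewrite l2BE truncE //; case: (x \in t) => /=; last by rewrite subr0.
  by rewrite subrr normc0 expr0n.
have : uniq (s' ++ t).
  rewrite cat_uniq ut filter_uniq //= andbT; apply/hasPn => x xt.
  by rewrite mem_filter xt.
by move=> /bd; rewrite big_cat /=; lra.
Qed.

(** A real-valued form of [opnorm T <= c], equivalent to it for linear T and c >= 0; it keeps
    estimates out of the extended reals. *)
Definition lipschitz T (c : R) := forall xi, l2_norm (T xi) <= c * l2_norm xi.

Lemma linear_op0 T : linear T -> T 0 = 0.
Proof.
by move=> lT; have := lT (-1) 0 0; rewrite scaler0 addr0 scaleN1r addNr.
Qed.

Lemma linear_opD T xi eta : linear T -> T (xi + eta) = T xi + T eta.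
Proof. by move=> lT; have := lT 1 xi eta; rewrite !scale1r. Qed.

Lemma linear_opZ T a xi : linear T -> T (a *: xi) = a *: T xi.
Proof. by move=> lT; have := lT a xi 0; rewrite (linear_op0 lT) !addr0. Qed.

Lemma linear_opB T xi eta : linear T -> T (xi - eta) = T xi - T eta.
Proof.
by move=> lT; rewrite addrC -scaleN1r lT scaleN1r addrC.
Qed.

Lemma linear_op_sum (I : Type) (r : seq I) (F : I -> l2 R X) T : linear T ->
  T (\sum_(i <- r) F i) = \sum_(i <- r) T (F i).
Proof.
move=> lT; elim: r => [|i r ih]; first by rewrite !big_nil linear_op0.
by rewrite !big_cons linear_opD // ih.
Qed.

Lemma opnorm_le T (c : R) : 0 <= c -> lipschitz T c -> (opnorm T <= c%:E)%E.
Proof.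
move=> c0 h; apply: ge_ereal_sup => _ [xi /= xi1 <-]; rewrite lee_fin.
by apply: le_trans (h xi) _; rewrite ler_piMr.
Qed.

Lemma opnorm_lipschitz T (c : R) : linear T -> (opnorm T <= c%:E)%E ->
  lipschitz T c.
Proof.
move=> lT h xi; have [xi0|xi0] := leP (l2_norm xi) 0.
  by rewrite (l2_norm_eq0 xi0) linear_op0 // l2_norm0 mulr0.
have nz : normc ((l2_norm xi)^-1)%:C = (l2_norm xi)^-1.
  by rewrite /= expr0n /= addr0 sqrtr_sqr ger0_norm // invr_ge0 ltW.
have : (l2_norm (T (((l2_norm xi)^-1)%:C *: xi)) <= c).
  rewrite -lee_fin; apply: le_trans h; apply: ereal_sup_ubound.
  exists (((l2_norm xi)^-1)%:C *: xi) => //=.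
  apply: le_trans (l2_normZ_le _ _) _.
  by rewrite nz mulVf // gt_eqF.
move=> h'; apply: (@le_trans _ _ (l2_norm xi *
    l2_norm (T (((l2_norm xi)^-1)%:C *: xi)))); last first.
  by rewrite mulrC ler_wpM2r // ltW.
rewrite linear_opZ // {1}(_ : T xi = (l2_norm xi)%:C *: (((l2_norm xi)^-1)%:C *: T xi)).
  apply: le_trans (l2_normZ_le _ _) _.
  by rewrite /= expr0n /= addr0 sqrtr_sqr ger0_norm // ltW.
rewrite scalerA -rmorphM /= divff ?scale1r // gt_eqF //.
Qed.

Lemma bounded_opP T : bounded_op T <->
  linear T /\ exists2 c : R, 0 <= c & lipschitz T c.
Proof.
split=> [[lT h]|[lT [c c0 h]]]; split=> //; last first.
  by apply: le_lt_trans (opnorm_le c0 h) _; exact: ltry.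
have opn0 : (0 <= opnorm T)%E.
  apply: ereal_sup_ubound; exists 0; first by rewrite /= l2_norm0.
  by rewrite linear_op0 // l2_norm0.
case E : (opnorm T) h opn0 => [c| |] // _ c0.
by exists c => //; apply: opnorm_lipschitz => //; rewrite E.
Qed.

Lemma bounded_opB T S : bounded_op T -> bounded_op S -> bounded_op (T - S)%R.
Proof.
move=> /bounded_opP[lT [c c0 hc]] /bounded_opP[lS [d d0 hd]].
apply/bounded_opP; split=> [a u v|].
  by rewrite !fctE lT lS; apply: l2_ext => x; rewrite !(l2BE, l2E); ring.
exists (c + d) => [|u]; first by rewrite addr_ge0.
rewrite fctE mulrDl; apply: le_trans (l2_normD _ _) _.
by rewrite l2_normN lerD.
Qed.

Definition mx_of T : X -> X -> C := fun x y => T (delta y) x.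

Lemma mx_of_trunc T t (f : X -> C) x : linear T ->
  T (trunc t f) x = mxapp (mx_of T) t f x.
Proof.
move=> lT; rewrite linear_op_sum // l2_sumE; apply: eq_bigr => y _.
by rewrite linear_opZ // mulrC.
Qed.

Lemma mx_of_bound T (c : R) : linear T -> 0 <= c -> lipschitz T c ->
  mxbound setT (mx_of T) c.
Proof.
move=> lT c0 h s t us ut _ _ xi.
rewrite (eq_fnorm (eta := T (trunc t xi))); last first.
  by move=> x _; rewrite mx_of_trunc.
apply: le_trans (fnorm_le_l2 _ us) _; apply: le_trans (h _) _.
by rewrite ler_wpM2l // l2_norm_trunc.
Qed.

(** Finite submatrices see only vectors of finite support; a priori boundedness of [T], with any
    constant c', carries the constant c over to all of l2 by truncation. *)
Lemma mxbound_lipschitz T (c : R) : bounded_op T -> 0 <= c ->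
  mxbound setT (mx_of T) c -> lipschitz T c.
Proof.
move=> /bounded_opP[lT [c' c'0 h']] c0 h xi.
apply: l2_norm_le => [|s us]; first by rewrite mulr_ge0 ?l2_norm_ge0.
apply/ler_addgt0Pr => e e0.
have e1 : 0 < e / (c' + 1) by rewrite divr_gt0 // ltr_wpDl.
have [t ut ht] := trunc_approx xi e1.
rewrite (eq_fnorm (eta := fun x => T (trunc t xi) x + T (xi - trunc t xi) x)).
  apply: le_trans (fnorm_triangle _ _ _) _; apply: lerD.
    rewrite (eq_fnorm (eta := mxapp (mx_of T) t xi)); last first.
      by move=> x _; rewrite mx_of_trunc.
    apply: le_trans (h s t us ut _ _ xi) _ => //.
    by rewrite ler_wpM2l // fnorm_le_l2.
  apply: le_trans (fnorm_le_l2 _ us) _; apply: le_trans (h' _) _.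
  apply: (@le_trans _ _ (c' * (e / (c' + 1)))); first by rewrite ler_wpM2l.
  by rewrite mulrCA ler_piMr ?(ltW e0) // ler_pdivrMr ?ltr_wpDl // mul1r lerDl.
by move=> x _; rewrite linear_opB // l2BE addrC subrK.
Qed.

Lemma mx_of_inj T S : bounded_op T -> bounded_op S ->
  (forall x y, mx_of T x y = mx_of S x y) -> T = S.
Proof.
move=> bT bS TS; have bTS := bounded_opB bT bS.
apply/funext => xi; apply/eqP; rewrite -subr_eq0; apply/eqP/l2_norm_eq0.
rewrite -(mul0r (l2_norm xi)).
apply: (@mxbound_lipschitz (T - S)%R 0 bTS) => //.
apply: mxbound_ext (@mxbound0 R X setT) => x y _ _.
by have := TS x y; rewrite /mx_of fctE l2BE => ->; rewrite subrr.
Qed.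

Definition op_of (K : X -> X -> C) (xi : l2 R X) : l2 R X :=
  insubd 0 (fun x => csum (fun y => K x y * xi y)).

Section op_of_bounded.
Variables (K : X -> X -> C) (c : R).
Hypotheses (c0 : 0 <= c) (Kc : mxbound setT K c).

Lemma row_summable x xi : abs_summable (fun y => K x y * xi y).
Proof.
exists (c * l2_norm xi) => t ut; apply: le_trans (CauchySchwarz _ _ _) _.
apply: ler_pM; rewrite ?fnorm_ge0 //; last exact: fnorm_le_l2.
exact: mxbound_row Kc _ ut _.
Qed.

Let f xi : X -> C := fun x => csum (fun y => K x y * xi y).

Lemma sums_to_app s xi (e : R) : 0 < e -> exists2 t, uniq t &
  forall x, x \in s -> normc (f xi x - mxapp K t xi x) <= e.
Proof.
(* Strengthened to all lists containing [t0], because the induction over the rows in [s] has to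
   enlarge the list. *)
move=> e0; suff [t0 ut0 h] : exists2 t0, uniq t0 & forall t, uniq t ->
    {subset t0 <= t} -> forall x, x \in s -> normc (f xi x - mxapp K t xi x) <= e.
  by exists t0 => // x; exact: h.
elim: s => [|x s [t1 ut1 h1]]; first by exists [::].
have [t2 ut2 h2] := csumP (row_summable x xi) e0.
have [t0 ut0 [t10 t20]] := uniq_join t1 t2; exists t0 => // t ut t0t y.
rewrite inE => /orP[/eqP ->|ys]; first by apply: h2 => // z /t20/t0t.
by apply: h1 => // z /t10/t0t.
Qed.

Lemma fnorm_app s xi : uniq s -> fnorm s (f xi) <= c * l2_norm xi.
Proof.
move=> us; apply/ler_addgt0Pr => e e0.
have e1 : 0 < e / (Num.sqrt (size s)%:R + 1).
  by rewrite divr_gt0 // ltr_wpDl ?sqrtr_ge0.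
have [t ut ht] := sums_to_app s xi e1.
(* Set to 0 off [s], because [fnorm_le_const] asks for a bound at every point. *)
pose d x := if x \in s then f xi x - mxapp K t xi x else 0.
rewrite (eq_fnorm (eta := fun x => mxapp K t xi x + d x)); last first.
  by move=> x xs; rewrite /d xs addrC subrK.
apply: le_trans (fnorm_triangle _ _ _) _; apply: lerD.
  by apply: le_trans (Kc us ut _ _ _) _ => //; rewrite ler_wpM2l // fnorm_le_l2.
apply: le_trans (fnorm_le_const _ (ltW e1) _) _ => [x|].
  by rewrite /d; case: ifP => [/ht//|_]; rewrite normc0 ltW.
rewrite mulrCA ler_piMr ?(ltW e0) // ler_pdivrMr ?ltr_wpDl ?sqrtr_ge0 //.
by rewrite mul1r lerDl.
Qed.

Lemma op_ofE xi x : op_of K xi x = csum (fun y => K x y * xi y).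
Proof.
have f_l2 : f xi \in @l2_pred R X.
  by apply: (@l2_predP _ (c * l2_norm xi)) => s; exact: fnorm_app.
have := val_insubd (0 : l2 R X) (f xi); rewrite f_l2.
by move=> /(congr1 (fun h : X -> C => h x)).
Qed.

Lemma op_of_sums xi x : sums_to (fun y => K x y * xi y) (op_of K xi x).
Proof. by rewrite op_ofE; exact/csumP/row_summable. Qed.

Lemma op_of_linear : linear (op_of K).
Proof.
move=> a u v; apply: l2_ext => x; rewrite l2E; apply: sums_to_unique (op_of_sums _ _) _.
rewrite (_ : (fun y => _) = fun y => a * (K x y * u y) + K x y * v y).
  by apply: sums_to_linear; exact: op_of_sums.
by apply/funext => y; rewrite l2E; ring.
Qed.

Lemma op_of_lipschitz : lipschitz (op_of K) c.
Proof.
move=> xi; apply: l2_norm_le => [|s us]; first by rewrite mulr_ge0 ?l2_norm_ge0.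
rewrite (eq_fnorm (eta := f xi)) ?fnorm_app // => x _; exact: op_ofE.
Qed.

Lemma op_of_bounded : bounded_op (op_of K).
Proof.
apply/bounded_opP; split; first exact: op_of_linear.
by exists c => //; exact: op_of_lipschitz.
Qed.

Lemma op_of_finite xi x t : uniq t -> (forall y, y \notin t -> K x y * xi y = 0) ->
  op_of K xi x = \sum_(y <- t) K x y * xi y.
Proof.
move=> ut t0; apply: sums_to_unique (op_of_sums _ _) _; exact: sums_to_finite.
Qed.

Lemma mx_of_op_of x y : mx_of (op_of K) x y = K x y.
Proof.
rewrite /mx_of (@op_of_finite _ _ [:: y]) ?big_seq1 ?deltaE ?eqxx ?mulr1 //.
by move=> z; rewrite inE deltaE => /negbTE ->; rewrite mulr0.
Qed.

End op_of_bounded.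

Lemma inner_sums xi eta : sums_to (fun x => xi x * conjc (eta x)) (inner xi eta).
Proof.
apply: csumP; exists (l2_norm xi * l2_norm eta) => t ut.
apply: le_trans (CauchySchwarz t xi (fun x => conjc (eta x))) _.
apply: ler_pM; rewrite ?fnorm_ge0 ?fnorm_le_l2 //.
rewrite (_ : fnorm _ _ = fnorm t eta) ?fnorm_le_l2 //.
by rewrite /fnorm; under eq_bigr do rewrite normc_conj.
Qed.

Lemma normc_inner xi eta : normc (inner xi eta) <= l2_norm xi * l2_norm eta.
Proof.
apply/ler_addgt0Pr => e e0; have [t ut ht] := inner_sums xi eta e0.
rewrite -[inner xi eta](subrK (\sum_(x <- t) xi x * conjc (eta x))) addrC.
apply: le_trans (le_normcD _ _) _; rewrite lerD ?ht //.
apply: le_trans (normc_sum _ _) _.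
apply: le_trans (CauchySchwarz t xi (fun x => conjc (eta x))) _.
apply: ler_pM; rewrite ?fnorm_ge0 ?fnorm_le_l2 //.
rewrite (_ : fnorm _ _ = fnorm t eta) ?fnorm_le_l2 //.
by rewrite /fnorm; under eq_bigr do rewrite normc_conj.
Qed.

Lemma innerDl (a : R[i]) (u v eta : l2 R X) : inner (a *: u + v) eta = a * inner u eta + inner v eta.
Proof.
apply: sums_to_unique (inner_sums _ _) _.
rewrite (_ : (fun x => _) =
  fun x => a * (u x * conjc (eta x)) + v x * conjc (eta x)).
  by apply: sums_to_linear; exact: inner_sums.
by apply/funext => x; rewrite l2E; ring.
Qed.

Lemma inner_conj (u v : l2 R X) : inner u v = conjc (inner v u).
Proof.
apply: sums_to_unique (inner_sums _ _) _.
rewrite (_ : (fun x => _) = fun x => conjc (v x * conjc (u x))).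
  by apply: sums_to_conj; exact: inner_sums.
by apply/funext => x; rewrite rmorphM /= conjcK mulrC.
Qed.

Lemma inner_delta (u : l2 R X) y : inner u (delta y) = u y.
Proof.
apply: sums_to_unique (inner_sums _ _) _.
have -> : u y = \sum_(x <- [:: y]) u x * conjc (delta y x).
  by rewrite big_seq1 deltaE eqxx rmorph1 mulr1.
apply: sums_to_finite => // x; rewrite inE deltaE => /negbTE ->.
by rewrite rmorph0 mulr0.
Qed.

Lemma innerB (u v w : l2 R X) : inner (u - v) w = inner u w - inner v w.
Proof. by rewrite addrC -scaleN1r innerDl mulN1r addrC. Qed.

Lemma inner_sum (I : Type) (r : seq I) (a : I -> C) (F : I -> l2 R X) w :
  inner (\sum_(i <- r) a i *: F i) w = \sum_(i <- r) a i * inner (F i) w.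
Proof.
elim: r => [|i r ih]; last by rewrite !big_cons innerDl ih.
rewrite !big_nil; have := innerDl (-1) 0 0 w.
by rewrite scaler0 addr0 mulN1r addNr => ->.
Qed.

(** The matrices give the identity on the vectors [delta], and both sides are continuous in each
    argument: [eta] is truncated first, with [xi] a [delta], and then [xi]. *)
Lemma mx_adjoint T S : bounded_op T -> bounded_op S ->
  (forall x y, mx_of S x y = conjc (mx_of T y x)) -> adjoint T S.
Proof.
move=> /bounded_opP[lT [c c0 hc]] /bounded_opP[lS [d d0 hd]] TS.
have small (z : R[i]) : (forall e, 0 < e -> normc z <= e) -> z = 0.
  move=> h; apply/eq0_normc/le_anti; rewrite normc_ge0 andbT.
  by apply/ler_addgt0Pr => e /h; rewrite add0r.
have step1 y eta : inner (T (delta y)) eta = inner (delta y) (S eta).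
  rewrite [RHS]inner_conj inner_delta.
  apply/eqP; rewrite -subr_eq0; apply/eqP/small => e e0.
  have e1 : 0 < e / (c * l2_norm (delta y) + d + 1).
    by rewrite divr_gt0 // ltr_wpDl // addr_ge0 // mulr_ge0 ?l2_norm_ge0.
  have [t ut ht] := trunc_approx eta e1.
  have tE : inner (T (delta y)) (trunc t eta) = conjc (S (trunc t eta) y).
    rewrite inner_conj inner_sum mx_of_trunc //; congr conjc.
    apply: eq_bigr => x _; rewrite inner_conj inner_delta mulrC TS.
    by rewrite /mx_of.
  have -> : inner (T (delta y)) eta - conjc (S eta y) =
    conjc (inner (eta - trunc t eta) (T (delta y))) -
    conjc (S (eta - trunc t eta) y).
    rewrite innerB linear_opB // l2BE [inner (T _) eta]inner_conj.
    move: tE; rewrite inner_conj => /(congr1 conjc); rewrite !conjcK => ->.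
    by rewrite -!rmorphB; congr conjc; ring.
  apply: le_trans (le_normcD _ _) _; rewrite normcN !normc_conj.
  have h1 := normc_inner (eta - trunc t eta) (T (delta y)).
  have h2 := le_trans (normc_le_l2 (S (eta - trunc t eta)) y) (hd _).
  have h3 := hc (delta y).
  move: ht; rewrite ler_pdivlMr; last first.
    by rewrite ltr_wpDl // addr_ge0 // mulr_ge0 ?l2_norm_ge0.
  have := l2_norm_ge0 (eta - trunc t eta); have := l2_norm_ge0 (delta y).
  have := l2_norm_ge0 (T (delta y)).
  move: (normc _) (normc _) (l2_norm _) (l2_norm _) (l2_norm _) h1 h2 h3 => p q r u w *.
  nra.
move=> xi eta; apply/eqP; rewrite -subr_eq0; apply/eqP/small => e e0.
have k0 : 0 < c * l2_norm eta + l2_norm (S eta) + 1.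
  by rewrite ltr_wpDl // addr_ge0 ?l2_norm_ge0 // mulr_ge0 ?l2_norm_ge0.
have e1 : 0 < e / (c * l2_norm eta + l2_norm (S eta) + 1) by rewrite divr_gt0.
have [t ut ht] := trunc_approx xi e1.
have tE : inner (T (trunc t xi)) eta = inner (trunc t xi) (S eta).
  rewrite linear_op_sum //; under eq_bigr do rewrite linear_opZ //.
  by rewrite !inner_sum; apply: eq_bigr => y _; rewrite step1.
have -> : inner (T xi) eta - inner xi (S eta) =
   inner (T (xi - trunc t xi)) eta - inner (xi - trunc t xi) (S eta).
  by rewrite linear_opB // !innerB tE; ring.
apply: le_trans (le_normcD _ _) _; rewrite normcN.
have h1 := normc_inner (T (xi - trunc t xi)) eta.
have h2 := normc_inner (xi - trunc t xi) (S eta).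
have h3 := hc (xi - trunc t xi).
move: ht; rewrite ler_pdivlMr //.
have := l2_norm_ge0 (xi - trunc t xi); have := l2_norm_ge0 eta.
have := l2_norm_ge0 (S eta); have := l2_norm_ge0 (T (xi - trunc t xi)).
move: (normc _) (normc _) (l2_norm _) (l2_norm _) (l2_norm _) (l2_norm _) h1 h2 h3 => p q r u w z *.
nra.
Qed.

End l2_theory.

(** * Local structure of an étale groupoid *)

Section topology.
Variable T : topologicalType.

(** If no finite subfamily covers [K], the remainders [B s] generate a proper filter on [K], but the
    neighbourhood [V p] of a cluster point p misses [B [:: p]]. *)
Lemma compact_finite_cover (K : set T) (V : T -> set T) : compact K ->
  (forall a, K a -> nbhs a (V a)) ->
  exists2 s : seq T, (forall a, a \in s -> K a) &
    forall g, K g -> exists2 a, a \in s & V a g.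
Proof.
move=> cK KV; apply: contrapT => no_cover.
pose B (s : seq T) := [set g | K g /\ forall a, a \in s -> ~ V a g].
pose F := filter_from [set s : seq T | forall a, a \in s -> K a] B.
have FF : ProperFilter F.
  apply: filter_from_proper; last first.
    move=> s sK; apply: contrapT => Bs; apply: no_cover; exists s => // g Kg.
    apply: contrapT => nV; apply: Bs; exists g; split => // a sa Vag.
    by apply: nV; exists a.
  apply: filter_from_filter; first by exists [::].
  move=> s t sK tK; exists (s ++ t) => [a|g [Kg h]].
    by rewrite mem_cat => /orP[/sK|/tK].
  by split; split => // a ain; apply: h; rewrite mem_cat ain ?orbT.
have FK : F K by exists [::] => // g [].
have [p [Kp /(_ (B [:: p]) (V p))[]]] := cK F FF FK.
- by exists [:: p] => // a; rewrite inE => /eqP ->.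
- exact: KV.
by move=> g [[_ h] Vg]; exact: (h p (mem_head _ _)).
Qed.

Lemma hausdorff_separate (x y : T) : hausdorff_space T -> x <> y ->
  exists A B : set T, [/\ nbhs x A, nbhs y B & A `&` B = set0].
Proof.
move=> h xy; apply: contrapT => hn; apply: xy; apply: h => A B xA yB.
apply: contrapT => AB; apply: hn; exists A, B; split => //.
by apply/seteqP; split => // z zAB; apply: AB; exists z.
Qed.

Variable R : realType.
Local Notation C := (R[i]^o).

Lemma complex_gt0 (e : R[i]) : 0 < e -> exists2 d : R, 0 < d & e = d%:C.
Proof.
case: e => a b; rewrite ltcE /= => /andP[/eqP -> a0].
by exists a.
Qed.

Lemma cvg_normcP (F : set_system T) (FF : Filter F) (f : T -> C) (z : C) :
  f @ F --> z <-> forall e : R, 0 < e -> \forall y \near F, normc (z - f y) < e.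
Proof.
split=> [/cvgrPdist_lt h e e0|h].
  have := h e%:C; rewrite ltcR => /(_ e0); apply: filterS => y.
  by rewrite normcE ltcR.
apply/cvgrPdist_lt => e /complex_gt0[d d0 ->]; apply: filterS (h d d0) => y.
by rewrite normcE ltcR.
Qed.

Lemma continuous_conj (f : T -> C) : continuous f ->
  continuous (fun x => conjc (f x) : C).
Proof.
move=> cf x; apply/cvg_normcP => e e0; move/cvg_normcP: (cf x) => /(_ e e0).
by apply: filterS => y; rewrite -rmorphB normc_conj.
Qed.

Lemma continuous_complex (u : T -> R) : continuous u ->
  continuous (fun x => (u x)%:C : C).
Proof.
move=> cu x; apply/cvg_normcP => e e0; move/cvgrPdist_lt: (cu x) => /(_ e e0).
apply: filterS => y; rewrite -rmorphB /= expr0n /= addr0 sqrtr_sqr.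
by [].
Qed.

Lemma cvg_sum_seq (I : eqType) (F : set_system T) (FF : Filter F) (r : seq I)
  (f : I -> T -> C) (z : I -> C) : (forall i, i \in r -> f i @ F --> z i) ->
  (fun x => \sum_(i <- r) f i x) @ F --> \sum_(i <- r) z i.
Proof.
elim: r => [|i r ih] h.
  rewrite big_nil; under eq_fun do rewrite big_nil; exact: cvg_cst.
rewrite big_cons; under eq_fun do rewrite big_cons.
apply: cvgD; first by apply: h; rewrite mem_head.
by apply: ih => j jr; apply: h; rewrite inE jr orbT.
Qed.

End topology.

Section groupoid_algebra.
Variable G : etaleGroupoid.
Implicit Types a b c g : G.

Lemma ginv_src a : ginv (src a) = src a.
Proof.
apply/esym/ginv_unique; first by rewrite rng_src src_src.
by rewrite -{2}(src_src a) mul_src rng_src.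
Qed.

Lemma ginv_rng a : ginv (rng a) = rng a.
Proof. by rewrite -src_inv ginv_src. Qed.

Lemma gmulKV a b : src a = rng b -> gmul (ginv a) (gmul a b) = b.
Proof. by move=> ab; rewrite gmul_assoc ?src_inv // ginv_mul ab mul_rng. Qed.

Lemma gmulVK a b : rng a = rng b -> gmul a (gmul (ginv a) b) = b.
Proof.
by move=> ab; rewrite gmul_assoc ?rng_inv ?src_inv // gmul_inv ab mul_rng.
Qed.

Lemma ginv_mulE a b : src a = rng b -> ginv (gmul a b) = gmul (ginv b) (ginv a).
Proof.
move=> ab; apply/esym/ginv_unique; first by rewrite src_mul // rng_mul ?rng_inv ?src_inv.
rewrite rng_mul // -gmul_assoc ?src_inv ?rng_mul ?rng_inv ?src_inv //.
by rewrite gmulVK ?rng_inv ?gmul_inv.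
Qed.

Definition gdiv g b := gmul g (ginv b).

Lemma src_div g b : src g = src b -> src (gdiv g b) = rng b.
Proof. by move=> gb; rewrite src_mul ?rng_inv ?src_inv. Qed.

Lemma rng_div g b : src g = src b -> rng (gdiv g b) = rng g.
Proof. by move=> gb; rewrite rng_mul ?rng_inv. Qed.

Lemma divK g b : src g = src b -> gmul (gdiv g b) b = g.
Proof.
by move=> gb; rewrite -gmul_assoc ?rng_inv ?src_inv // ginv_mul -gb mul_src.
Qed.

Lemma mulK a b : src a = rng b -> gdiv (gmul a b) b = a.
Proof.
move=> ab; rewrite /gdiv -gmul_assoc ?rng_inv // gmul_inv -ab mul_src //.
Qed.

Lemma ginv_div g b : src g = src b -> ginv (gdiv g b) = gdiv b g.
Proof. by move=> gb; rewrite ginv_mulE ?rng_inv // ginvK. Qed.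

(** Right translation leaves quotients unchanged; this identifies the kernel of a convolution on a
    coset of H with its kernel on a fibre of H. *)
Lemma div_div g b c : src g = src c -> src b = src c ->
  gdiv (gdiv g c) (gdiv b c) = gdiv g b.
Proof.
move=> gc bc; rewrite /gdiv -/(gdiv b c) ginv_div // /gdiv.
by rewrite -gmul_assoc ?rng_mul ?rng_inv ?src_inv // gmulKV ?src_inv ?rng_inv.
Qed.

Lemma div_src g : gdiv g (src g) = g.
Proof. by rewrite /gdiv ginv_src mul_src. Qed.

Lemma div_inj b g h : src g = src b -> src h = src b ->
  gdiv g b = gdiv h b -> g = h.
Proof. by move=> gb hb e; rewrite -(divK gb) e divK. Qed.

Lemma divr_inj g b c : src g = src b -> src g = src c ->
  gdiv g b = gdiv g c -> b = c.
Proof.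
move=> gb gc /(congr1 (@ginv G)); rewrite !ginv_div // => h.
by apply: (@div_inj g) => //; rewrite ?gb ?gc.
Qed.

Lemma iso_interior_div a b : src a = src b -> iso_interior G a ->
  iso_interior G b -> iso_interior G (gdiv a b).
Proof.
move=> ab Ha Hb; apply: iso_interior_mul => //; first by rewrite rng_inv.
exact: iso_interior_inv.
Qed.

End groupoid_algebra.

Section local_sections.
Variable G : etaleGroupoid.
Implicit Types a b c g x : G.

Definition bisection a : set G := projT1 (cid (rng_local_homeo a)).

Lemma bisection_open a : open (bisection a).
Proof. by rewrite /bisection; case: cid => U []. Qed.

Lemma bisection_refl a : bisection a a.
Proof. by rewrite /bisection; case: cid => U []. Qed.

Lemma bisection_inj a b c : bisection a b -> bisection a c -> rng b = rng c -> b = c.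
Proof.
rewrite /bisection; case: cid => U [_ _ _ injU _] /= Ub Uc.
by apply: injU; rewrite inE.
Qed.

Lemma bisection_image a (V : set G) : open V -> V `<=` bisection a ->
  exists2 O, open O & (@rng G) @` V = O `&` range (@rng G).
Proof. by rewrite /bisection; case: cid => U /= [_ _ _ _]; exact. Qed.

Lemma bisection_nbhs a : nbhs a (bisection a).
Proof.
by apply: open_nbhs_nbhs; split; [exact: bisection_open|exact: bisection_refl].
Qed.

(** The local inverse of [rng] through [a]; the default [a] is its value at points outside the image
    of the bisection. *)
Definition sec a x := xget a [set b | bisection a b /\ rng b = x].

Lemma secE a b : bisection a b -> sec a (rng b) = b.
Proof.
move=> ab; rewrite /sec; case: xgetP => [c -> [ac /esym cb]|/(_ b)].
  exact: bisection_inj ac ab _.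
by case.
Qed.

Lemma sec_self a : sec a (rng a) = a.
Proof. exact/secE/bisection_refl. Qed.

(** Images of open bisections are open relative to the unit space, so sections are controlled at
    units only; hence [within]. *)
Definition unit_filter x : set_system G := within (unit_space G) (nbhs x).

Lemma sec_near a (V : set G) : nbhs a V ->
  \forall x \near unit_filter (rng a), V (sec a x) /\ rng (sec a x) = x.
Proof.
rewrite nbhsE => -[W [oW Wa] WV].
have [|O oO OE] := @bisection_image a (W `&` bisection a) (openI oW (@bisection_open a)).
  by move=> ? [].
have [Oa _] : (O `&` range (@rng G)) (rng a).
  by rewrite -OE; exists a => //; split => //; exact: bisection_refl.
apply: filterS (open_nbhs_nbhs (conj oO Oa)) => x Ox ux.
have : (O `&` range (@rng G)) x by [].
rewrite -OE => -[b [Wb ab] <-]; rewrite secE //.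
by split => //; exact: WV.
Qed.

Lemma unit_filter_proper x : unit_space G x -> ProperFilter (unit_filter x).
Proof.
move=> ux; apply: Build_ProperFilter_ex => P h.
by exists x; exact: (nbhs_singleton (h : nbhs x _)).
Qed.

End local_sections.

Section compact_support.
Variables (R : realType) (G : etaleGroupoid).
Hypothesis hausG : hausdorff_space G.
Local Notation C := (R[i]^o).
Implicit Types (f : G -> C).

Lemma support_sub_compact f (K : set G) : compact K ->
  (forall g, f g != 0 -> K g) -> closure [set g | f g != 0] `<=` K.
Proof.
move=> cK fK; rewrite [X in _ `<=` X](_ : K = closure K).
  by apply: closureS => g; exact: fK.
by apply/closure_id; exact: compact_closed hausG cK.
Qed.

Lemma Cc_compact f (K : set G) : continuous f -> compact K ->
  (forall g, f g != 0 -> K g) -> Cc f.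
Proof.
move=> cf cK fK; have sK := support_sub_compact cK fK; split=> //.
by apply: subclosed_compact cK sK; exact: closed_closure.
Qed.

Lemma Cc_support f g : f g != 0 -> closure [set g | f g != 0] g.
Proof. by move=> h; exact: (@subset_closure G [set g | f g != 0]). Qed.

(** Finitely many bisections cover the compact support, and each meets a fibre of [rng] in at most
    one arrow, the value of its section; one list of sections serves all fibres. *)
Lemma Cc_fibre f : Cc f -> exists s : seq G,
  forall a, f a != 0 -> a \in [seq sec c (rng a) | c <- s].
Proof.
move=> [cf cK].
have [a Ka|s _ sK] := @compact_finite_cover G _ (@bisection G) cK.
  exact: bisection_nbhs.
exists s => a /Cc_support /sK[c cs ca].
by apply/mapP; exists c => //; rewrite secE.
Qed.

Lemma Cc_count f : Cc f -> exists n : nat, forall (x : G) t, uniq t ->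
  (forall a, a \in t -> rng a = x /\ f a != 0) -> (size t <= n)%N.
Proof.
move=> /Cc_fibre[s sP]; exists (size s) => x t ut tP.
rewrite -(size_map (fun c => sec c x)); apply: uniq_leq_size => // a /tP[<-].
exact: sP.
Qed.

Lemma Cc_bounded f : Cc f -> exists2 M : R, 0 <= M & forall a, normc (f a) <= M.
Proof.
move=> [cf cK].
have [a Ka|s _ sK] := @compact_finite_cover G _
    (fun a => [set g | normc (f a - f g) < 1]) cK.
  by move/cvg_normcP: (cf a); exact.
exists (\sum_(a <- s) (normc (f a) + 1)).
  by apply: sumr_ge0 => a _; rewrite addr_ge0 ?normc_ge0.
move=> g; have [->|/Cc_support /sK[a sa /= h]] := eqVneq (f g) 0.
  by rewrite normc0; apply: sumr_ge0 => a _; rewrite addr_ge0 ?normc_ge0.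
apply: (@le_trans _ _ (normc (f a) + 1)).
  rewrite -[f g](subKr (f a)); apply: le_trans (le_normcD _ _) _.
  by rewrite lerD2l normcN ltW.
rewrite (big_rem a) //= lerDl; apply: sumr_ge0 => b _.
by rewrite addr_ge0 ?normc_ge0.
Qed.

Lemma Cc_mull f (u : G -> C) : Cc f -> continuous u -> Cc (fun g => u g * f g).
Proof.
move=> [cf cK] cu; apply: Cc_compact cK _.
  by move=> x; apply: cvgM; [exact: cu|exact: cf].
move=> g ufg; apply: Cc_support; apply: contra ufg => /eqP ->.
by rewrite mulr0.
Qed.

Lemma Cc_lin (a : C) f f' : Cc f -> Cc f' -> Cc (fun g => a * f g + f' g).
Proof.
move=> [cf cK] [cf' cK']; apply: Cc_compact (compactU cK cK') _.
  by move=> x; apply: cvgD; [apply: cvgM; [exact: cvg_cst|exact: cf]|exact: cf'].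
move=> g fg; have [f0|/Cc_support] := eqVneq (f g) 0; last by left.
right; apply: Cc_support; apply: contra fg => /eqP ->.
by rewrite f0 mulr0 addr0.
Qed.

Lemma Cc_0 : Cc ((fun=> 0) : G -> C).
Proof.
by apply: Cc_compact (@compact0 G) _ => [x|g]; [exact: cvg_cst|rewrite eqxx].
Qed.

Definition involution f : G -> C := fun g => conjc (f (ginv g)).

Lemma Cc_involution f : Cc f -> Cc (involution f).
Proof.
move=> [cf cK].
apply: (@Cc_compact _ ((@ginv G) @` closure [set g | f g != 0])).
- apply: continuous_conj => x.
  by apply: continuous_comp; [exact: ginv_continuous|exact: cf].
- apply: continuous_compact cK; apply: continuous_subspaceT.
  exact: ginv_continuous.
- move=> g h; exists (ginv g); last by rewrite ginvK.
  by apply: Cc_support; apply: contra h => /eqP; rewrite /involution => ->; rewrite rmorph0.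
Qed.

End compact_support.

(** * Convolution operators *)

Section convolution_kernels.
Variables (R : realType) (G : etaleGroupoid).
Local Notation C := (R[i]^o).
Implicit Types (f k : G -> C) (T : l2 R G -> l2 R G).

(** The matrix of left convolution by [k], with the sum over factorisations rewritten by b = a^-1
    g. *)
Definition conv_ker k : G -> G -> C :=
  fun g b => if src g == src b then k (gdiv g b) else 0.

Lemma conv_kerE k g b : src g = src b -> conv_ker k g b = k (gdiv g b).
Proof. by move=> gb; rewrite /conv_ker gb eqxx. Qed.

Lemma conv_ker_src k g : conv_ker k g (src g) = k g.
Proof. by rewrite conv_kerE ?src_src // div_src. Qed.

Lemma conv_ker_ext k k' : k =1 k' -> forall g b, conv_ker k g b = conv_ker k' g b.
Proof. by move=> kk' g b; rewrite /conv_ker kk'. Qed.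

Lemma conv_ker_lin (a : C) k k' g b :
  conv_ker (fun g => a * k g + k' g) g b = a * conv_ker k g b + conv_ker k' g b.
Proof. by rewrite /conv_ker; case: ifP => // _; rewrite mulr0 addr0. Qed.

Lemma conv_kerB k k' g b :
  conv_ker (fun g => k g - k' g) g b = conv_ker k g b - conv_ker k' g b.
Proof. by rewrite /conv_ker; case: ifP => // _; rewrite subr0. Qed.

Lemma conv_ker_involution k g b :
  conv_ker (involution k) g b = conjc (conv_ker k b g).
Proof.
rewrite /conv_ker eq_sym; case: eqP => [gb|_]; last by rewrite rmorph0.
by rewrite /involution ginv_div.
Qed.

Lemma convolution_seq f (xi : G -> C) g t : uniq t ->
  (forall a, a \in t -> rng a = rng g) ->
  (forall a, rng a = rng g -> f a != 0 -> a \in t) ->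
  convolution f xi g = \sum_(a <- t) f a * xi (gmul (ginv a) g).
Proof.
move=> ut tr ft; rewrite /convolution (@fsbigE _ _ _ _ _ t) //; last first.
  move=> a /= ar at'; have [->|fa] := eqVneq (f a) 0; first by rewrite mul0r.
  by rewrite ft in at'.
by rewrite big_seq_cond [RHS]big_seq; apply: eq_bigl => a; apply/andP/idP => [[]|at'] //;
  rewrite inE; split => //; exact: tr.
Qed.

Hypothesis hausG : hausdorff_space G.

(** The Schur test applies: the nonzero entries of a row are counted on a range fibre of [f], those
    of a column on a range fibre of [involution f]. *)
Lemma Cc_mxbound f : Cc f -> exists2 c : R, 0 <= c & mxbound setT (conv_ker f) c.
Proof.
move=> fC; have [n fn] := Cc_count fC.
have [n' fn'] := Cc_count (Cc_involution hausG fC).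
have [M M0 fM] := Cc_bounded fC.
exists ((maxn n n')%:R * M); first by rewrite mulr_ge0.
have nz g b : conv_ker f g b != 0 -> src g = src b /\ f (gdiv g b) != 0.
  by rewrite /conv_ker; case: (src g =P src b) => [gb fb|_]; [split|rewrite eqxx].
apply: mxbound_schur => //.
- move=> g b _ _; rewrite /conv_ker; case: ifP => // _.
  by rewrite normc0.
- move=> g t _ ut tP; rewrite -(size_map (gdiv g)).
  apply: leq_trans (leq_maxl n n'); apply: (fn (rng g)).
    rewrite map_inj_in_uniq // => b c /tP[_ /nz[gb _]] /tP[_ /nz[gc _]].
    exact: divr_inj gb gc.
  by move=> _ /mapP[b /tP[_ /nz[gb fb]] ->]; rewrite rng_div.
- move=> b s _ us sP; rewrite -(size_map (gdiv b)).
  apply: leq_trans (leq_maxr n n'); apply: (fn' (rng b)).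
    rewrite map_inj_in_uniq // => g h /sP[_ /nz[gb _]] /sP[_ /nz[hb _]].
    exact: divr_inj (esym gb) (esym hb).
  move=> _ /mapP[g /sP[_ /nz[gb fb]] ->]; rewrite rng_div //; split=> //.
  rewrite /involution ginv_div //; apply: contra fb => /eqP/(congr1 conjc).
  by rewrite conjcK rmorph0 => ->.
Qed.

Lemma Cc_fibre_seq f x : Cc f -> exists2 t : seq G, uniq t &
  (forall a, a \in t -> rng a = x) /\ (forall a, rng a = x -> f a != 0 -> a \in t).
Proof.
move=> /Cc_fibre[s sP].
exists (undup [seq a <- [seq sec c x | c <- s] | rng a == x]).
  exact: undup_uniq.
split=> [a|a ax fa]; rewrite mem_undup mem_filter; first by case/andP => /eqP.
by rewrite ax eqxx /= -ax sP.
Qed.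

Lemma op_of_conv_ker f xi g : Cc f ->
  op_of (conv_ker f) xi g = convolution f xi g.
Proof.
move=> fC; have [c c0 fc] := Cc_mxbound fC.
have [t ut [tr ft]] := Cc_fibre_seq (rng g) fC.
rewrite (convolution_seq _ ut tr ft).
have src_t a : a \in t -> src g = src (gmul (ginv a) g).
  by move=> /tr ag; rewrite src_mul // src_inv.
have div_t a : a \in t -> gdiv g (gmul (ginv a) g) = a.
  by move=> /tr ag; rewrite /gdiv ginv_mulE ?src_inv // ginvK gmulVK.
rewrite (@op_of_finite _ _ _ _ c0 fc _ _ [seq gmul (ginv a) g | a <- t]).
- rewrite big_map; apply: eq_big_seq => a at'.
  by rewrite conv_kerE ?div_t // -src_t.
- rewrite map_inj_in_uniq // => a b at' bt' ab.
  by rewrite -(div_t a at') ab div_t.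
move=> b bt; rewrite /conv_ker; case: eqP => [gb|_]; last by rewrite mul0r.
have [->|fa] := eqVneq (f (gdiv g b)) 0; first by rewrite mul0r.
exfalso; move/negP: bt; apply; apply/mapP; exists (gdiv g b).
  by apply: ft => //; rewrite rng_div.
by rewrite ginv_div // -{1}(divK (esym gb)).
Qed.

Lemma regular_repE f : Cc f -> regular_rep f = op_of (conv_ker f).
Proof.
move=> fC; apply/funext => xi.
have e : convolution f xi = op_of (conv_ker f) xi.
  by apply/funext => g; rewrite op_of_conv_ker.
apply/val_inj; rewrite /regular_rep val_insubd e ifT //.
by case: (op_of _ _).
Qed.

Lemma regular_rep_conv f xi g : Cc f -> regular_rep f xi g = convolution f xi g.
Proof. by move=> fC; rewrite regular_repE // op_of_conv_ker. Qed.

Lemma regular_rep_bounded f : Cc f -> bounded_op (regular_rep f).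
Proof.
by move=> fC; have [c c0 fc] := Cc_mxbound fC; rewrite regular_repE //; exact: op_of_bounded c0 fc.
Qed.

Lemma mx_of_regular_rep f g b : Cc f -> mx_of (regular_rep f) g b = conv_ker f g b.
Proof.
by move=> fC; have [c c0 fc] := Cc_mxbound fC; rewrite regular_repE // (mx_of_op_of c0 fc).
Qed.

(** The predicate [fun=> True] gives C*_r(G) ([reduced_cstarP]) and [iso_supported] the image of
    iota ([iso_inclusion_image]), so that both are treated at once. *)
Definition approximable (P : (G -> C) -> Prop) T := bounded_op T /\
  forall e : R, 0 < e -> exists f, [/\ Cc f, P f & lipschitz (T - regular_rep f)%R e].

(** Renault's injection of C*_r(G) into the functions on G. *)
Definition kernel_of T : G -> C := fun g => T (delta R (src g)) g.

Lemma mx_ofB (X : choiceType) (T S : l2 R X -> l2 R X) x y :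
  mx_of (T - S)%R x y = mx_of T x y - mx_of S x y.
Proof. by []. Qed.

Lemma reduced_cstarP T : reduced_cstar R G T <-> approximable (fun=> True) T.
Proof.
split=> -[bT h]; split=> // e e0.
  have [f fC fe] := h e e0; exists f; split => //.
  apply: opnorm_lipschitz (ltW fe).
  by have [] := bounded_opB bT (regular_rep_bounded fC).
have e2 : 0 < e / 2 by lra.
have [f [fC _ fe]] := h _ e2; exists f => //.
apply: le_lt_trans (opnorm_le (ltW e2) fe) _.
by rewrite lte_fin; lra.
Qed.

(** A convolution matrix depends on (g, b) only through g b^-1, and entries are continuous in the
    operator norm, so this invariance passes to limits. *)
Lemma mx_of_approximable P T g b : approximable P T ->
  mx_of T g b = conv_ker (kernel_of T) g b.
Proof.
move=> [bT h]; apply/eqP; rewrite -subr_eq0; apply/eqP/eq0_normc/le_anti.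
rewrite normc_ge0 andbT; apply/ler_addgt0Pr => e e0; rewrite add0r.
have e2 : 0 < e / 2 by lra.
have [f [fC _ fe]] := h _ e2.
have [lTf _] := bounded_opB bT (regular_rep_bounded fC).
have fe' := mx_of_bound lTf (ltW e2) fe.
have ent x y : normc (mx_of T x y - conv_ker f x y) <= e / 2.
  rewrite -(mx_of_regular_rep x y fC) -mx_ofB.
  exact: mxbound_entry (ltW e2) fe' _ _.
have -> : conv_ker (kernel_of T) g b =
    if src g == src b then mx_of T (gdiv g b) (src (gdiv g b)) else 0 by [].
have := ent g b; rewrite /conv_ker; case: eqP => [gb|_]; last first.
  by rewrite !subr0; move=> ?; lra.
move=> h1; have := ent (gdiv g b) (src (gdiv g b)); rewrite conv_ker_src => h2.
set z := f (gdiv g b) in h1 h2; move: h1 h2.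
set p := mx_of T g b; set q := mx_of _ _ _ => h1 h2.
rewrite (_ : p - q = (p - z) + (z - q)); last by ring.
apply: le_trans (le_normcD _ _) _.
by rewrite (normcB z q) (splitr e) lerD.
Qed.

Lemma approximable_ker P T (e : R) : approximable P T -> 0 < e ->
  exists f, [/\ Cc f, P f &
    mxbound setT (conv_ker (fun g => kernel_of T g - f g)) e].
Proof.
move=> aT e0; have [bT h] := aT; have [f [fC Pf fe]] := h _ e0.
have [lTf _] := bounded_opB bT (regular_rep_bounded fC).
exists f; split => //; apply: mxbound_ext (mx_of_bound lTf (ltW e0) fe) => x y _ _.
by rewrite mx_ofB mx_of_regular_rep // conv_kerB (mx_of_approximable _ _ aT).
Qed.

Lemma ker_lipschitz T f k (e : R) : bounded_op T -> Cc f -> 0 <= e ->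
  (forall g b, mx_of T g b = conv_ker k g b) ->
  mxbound setT (conv_ker (fun g => k g - f g)) e ->
  lipschitz (T - regular_rep f)%R e.
Proof.
move=> bT fC e0 Tk ke; apply: mxbound_lipschitz => //.
  exact: bounded_opB bT (regular_rep_bounded fC).
apply: mxbound_ext ke => x y _ _.
by rewrite mx_ofB mx_of_regular_rep // conv_kerB Tk.
Qed.

Lemma ker_approximable P T k : bounded_op T ->
  (forall g b, mx_of T g b = conv_ker k g b) ->
  (forall e : R, 0 < e -> exists f, [/\ Cc f, P f &
    mxbound setT (conv_ker (fun g => k g - f g)) e]) -> approximable P T.
Proof.
move=> bT Tk h; split=> // e e0; have [f [fC Pf fe]] := h e e0.
by exists f; split => //; apply: ker_lipschitz (ltW e0) Tk fe.
Qed.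

Lemma kernel_of_nz_open P T g : approximable P T -> kernel_of T g != 0 ->
  \forall h \near g, kernel_of T h != 0.
Proof.
move=> aT kg; have n0 : 0 < normc (kernel_of T g).
  rewrite lt_def normc_ge0 andbT; apply: contra kg => /eqP/eq0_normc ->.
  by [].
(* One third for each of the passages from k(g) to f(g), to f(h) and to k(h): with k(h) = 0 they
   would make |k(g)| smaller than itself. *)
have e0 : 0 < normc (kernel_of T g) / 3 by lra.
have [f [fC _ fe]] := approximable_ker aT e0.
have ent h : normc (kernel_of T h - f h) <= normc (kernel_of T g) / 3.
  have := mxbound_entry (ltW e0) fe (x := h) (y := src h) I I.
  by rewrite conv_ker_src.
have [cf _] := fC; move/cvg_normcP: (cf g) => /(_ _ e0); apply: filterS => h fgh.
apply/eqP => kh; have := ent h; rewrite kh sub0r normcN => h1.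
have h2 := ent g.
have : normc (kernel_of T g) <=
   normc (kernel_of T g - f g) + (normc (f g - f h) + normc (f h)).
  rewrite -{1}(subrK (f g) (kernel_of T g)); apply: le_trans (le_normcD _ _) _.
  by rewrite lerD2l -{1}(subrK (f h) (f g)) le_normcD.
by lra.
Qed.

(** As G is Hausdorff, an arrow whose range is not [x] has a neighbourhood whose ranges avoid a
    neighbourhood of [x]; by compactness only finitely many bisections, through arrows over [x],
    matter near [x]. *)
Lemma Cc_local f x : Cc f -> exists2 s : seq G, uniq s &
  (forall a, a \in s -> rng a = x) /\
  \forall y \near x, forall a, rng a = y -> f a != 0 -> a \in [seq sec c y | c <- s].
Proof.
move=> [cf cK].
(* A neighbourhood of [a] and a neighbourhood of [x]. For [a] over [x] the latter is no constraint;
   otherwise it avoids the ranges of the former, and the default of [xget] is not taken. *)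
pose A a := if rng a == x then (bisection a, setT) else
  xget (set0, set0) [set AB : set G * set G | nbhs a AB.1 /\
    (nbhs x AB.2 /\ forall b, AB.1 b -> ~ AB.2 (rng b))].
have AP a : nbhs a (A a).1 /\ nbhs x (A a).2.
  rewrite /A; case: eqP => [ax|ax].
    by split; [exact: bisection_nbhs|exact: filterT].
  case: xgetP => [[U V] _ [? []]//|].
  have [B1 [B2 [aB1 xB2 B12]]] := hausdorff_separate hausG ax.
  move=> /(_ ((@rng G) @^-1` B1, B2)); case => /=; split; last split => //.
    exact: rng_continuous.
  by move=> b Bb Bb'; have : (B1 `&` B2) (rng b) by []; rewrite B12.
have AN a b : rng a != x -> (A a).1 b -> ~ (A a).2 (rng b).
  rewrite /A => /negbTE ->; case: xgetP => [[U V] _ [_ [_ h]]|]; first exact: h.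
  by [].
have [a _|s _ sK] := @compact_finite_cover G _ (fun a => (A a).1) cK.
  by have [] := AP a.
exists (undup [seq a <- s | rng a == x]); first exact: undup_uniq.
split=> [a|]; first by rewrite mem_undup mem_filter => /andP[/eqP].
have : \forall y \near x, forall a, a \in s -> (A a).2 y.
  elim: (s) => [|a r ih]; first by apply: filterE.
  have [_ xA] := AP a; apply: filterS2 xA ih => y Ay h b.
  by rewrite inE => /orP[/eqP ->|/h].
apply: filterS => y Ay b bx /Cc_support/sK[a as_ Ab].
have [ax|ax] := eqVneq (rng a) x; last first.
  by have := Ay _ as_; rewrite -bx => /(AN _ _ ax Ab).
apply/mapP; exists a; first by rewrite mem_undup mem_filter ax eqxx.
by rewrite -bx secE //; move: Ab; rewrite /A ax eqxx.
Qed.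

(** Distinct arrows over [x] have disjoint neighbourhoods, so their sections stay distinct. *)
Lemma sec_uniq x (s : seq G) : uniq s -> (forall a, a \in s -> rng a = x) ->
  \forall y \near unit_filter x, uniq [seq sec c y | c <- s].
Proof.
have FF : Filter (unit_filter x) by exact: within_filter.
elim: s => [|a s ih] /=; first by move=> _ _; apply: filterE.
move=> /andP[as_ us] sx; have ax : rng a = x by apply: sx; rewrite mem_head.
have {ih} ih : \forall y \near unit_filter x, uniq [seq sec c y | c <- s].
  by apply: ih => // b bs; apply: sx; rewrite inE bs orbT.
have : \forall y \near unit_filter x, forall b, b \in s -> sec a y <> sec b y.
  have {us ih} : forall b, b \in s -> rng b = x.
    by move=> b bs; apply: sx; rewrite inE bs orbT.
  elim: s as_ {sx} => [|b s ih] as_ sx; first by apply: filterE.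
  have /ih : a \notin s by move: as_; rewrite inE negb_or => /andP[].
  have sx' c : c \in s -> rng c = x by move=> cs; apply: sx; rewrite inE cs orbT.
  move=> /(_ sx') {}ih.
  have ab : a <> b by move=> e; rewrite e mem_head in as_.
  have bx : rng b = x by apply: sx; rewrite mem_head.
  have [A [B [aA bB AB]]] := hausdorff_separate hausG ab.
  have := sec_near aA; have := sec_near bB; rewrite ax bx => hB hA.
  apply: filterS3 hA hB ih => y [Ay _] [By _] h c.
  rewrite inE => /orP[/eqP ->|/h//] e.
  suff : (A `&` B) (sec b y) by rewrite AB.
  by split => //; rewrite -e.
apply: filterS2 ih => y uy h; rewrite uy andbT; apply/mapP => -[b bs].
exact: h.
Qed.

Lemma rng_unit_filter (g : G) (P : G -> Prop) :
  (\forall x \near unit_filter (rng g), P x) ->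
  \forall h \near g, P (rng h).
Proof.
move=> FP; have : \forall h \near g, (unit_space G (rng h) -> P (rng h)).
  exact: (rng_continuous FP).
by apply: filterS => h; apply; exists h.
Qed.

(** By [Cc_local] and [sec_uniq] the sum near g runs over a fixed list of distinct sections, and
    each of its terms is continuous at g. *)
Lemma convolution_continuous f f' : Cc f -> Cc f' -> continuous (convolution f f').
Proof.
move=> fC f'C g; have [s us [sx sloc]] := Cc_local (rng g) fC.
have [cf _] := fC; have [cf' _] := f'C.
have cvS : (fun h => \sum_(c <- s) f (sec c (rng h)) *
      f' (gmul (ginv (sec c (rng h))) h)) @ g -->
    \sum_(c <- s) f c * f' (gmul (ginv c) g).
  apply: cvg_sum_seq => c cs; have cg := sx _ cs.
  have sec_cvg : (fun h => sec c (rng h)) @ g --> c.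
    move=> V cV; have := sec_near cV; rewrite cg => /rng_unit_filter.
    by apply: filterS => h [].
  apply: cvgM; first by apply: cvg_comp sec_cvg _; exact: cf.
  apply: (@cvg_comp _ _ _ (fun h => gmul (ginv (sec c (rng h))) h) f' _
      (nbhs (gmul (ginv c) g))); last exact: cf'.
  move=> W Wcg; have [|A [B [oA oB Ac Bg AB]]] := gmul_near _ Wcg.
    by rewrite src_inv.
  have nA : nbhs c ((@ginv G) @^-1` A).
    by apply: ginv_continuous; exact: open_nbhs_nbhs.
  have := sec_near nA; rewrite cg => /rng_unit_filter.
  apply: filterS2 (open_nbhs_nbhs (conj oB Bg)) => h Bh [Ah ch].
  by apply: AB => //; rewrite src_inv.
have nearE : \forall h \near g, convolution f f' h =
    \sum_(c <- s) f (sec c (rng h)) * f' (gmul (ginv (sec c (rng h))) h).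
  have h1 : \forall h \near g, forall a, rng a = rng h -> f a != 0 ->
      a \in [seq sec c (rng h) | c <- s] by exact: (rng_continuous sloc).
  have h2 := rng_unit_filter (sec_uniq us sx).
  have h3 : \forall h \near g, forall c, c \in s -> rng (sec c (rng h)) = rng h.
    elim: (s) sx => [|c r ih] sx'; first by apply: filterE.
    have := sec_near (bisection_nbhs c).
    rewrite (sx' c (mem_head _ _)).
    move=> /rng_unit_filter.
    have {}ih : \forall h \near g, forall c, c \in r -> rng (sec c (rng h)) = rng h.
      by apply: ih => d dr; apply: sx'; rewrite inE dr orbT.
    apply: filterS2 ih => h hr [_ hc] d; rewrite inE => /orP[/eqP ->//|].
    exact: hr.
  apply: filterS3 h1 h2 h3 => h h1 h2 h3.
  rewrite (@convolution_seq f f' h _ h2) ?big_map // => a.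
  by move=> /mapP[c cs ->]; exact: h3.
rewrite /continuous_at (nbhs_singleton nearE).
rewrite (_ : \sum_(c <- s) _ = \sum_(c <- s) f c * f' (gmul (ginv c) g)); last first.
  by apply: eq_big_seq => c cs; rewrite -(sx _ cs) sec_self.
apply: cvg_trans cvS; apply: near_eq_cvg.
by apply: filterS nearE => h ->.
Qed.

Let support f := closure [set g | f g != 0].

(** Composable pairs form a closed set as G is Hausdorff, so those in the product of the supports
    are compact; [K] is their image. The factorisation of its points puts [K] inside H when both
    supports are. *)
Lemma convolution_support f f' : Cc f -> Cc f' -> exists K, [/\ compact K,
  (forall g, convolution f f' g != 0 -> K g) &
  forall g, K g -> exists a b, [/\ support f a, support f' b, src a = rng b &
    g = gmul a b]].
Proof.
move=> fC f'C; have [cf cK] := fC; have [cf' cK'] := f'C.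
pose D := [set p : G * G | src p.1 = rng p.2].
pose K := (closure [set g | f g != 0] `*` closure [set g | f' g != 0]) `&` D.
have cDs : {within K, continuous (fun p : G * G => gmul p.1 p.2)}.
  by apply: continuous_subspaceW (@gmul_continuous G) => p [].
have cptK : compact K.
  apply: subclosed_compact (compact_setX cK cK') _; last by move=> p [].
  move=> [a b] /= ab; split; first split=> /=.
  - apply: closed_closure => V aV.
    have [|[a' b'] [[[Ka _] _] [Va _]]] := ab (V `*` setT); last by exists a'.
    by exists (V, setT) => //=; split=> //; exact: filterT.
  - apply: closed_closure => V bV.
    have [|[a' b'] [[[_ Kb] _] [_ Vb]]] := ab (setT `*` V); last by exists b'.
    by exists (setT, V) => //=; split=> //; exact: filterT.
  apply: contrapT => nab.
  have [A [B [aA bB AB]]] := hausdorff_separate hausG nab.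
  have [|[a' b'] [[_ /= e] [/= Aa Bb]]] := ab ((@src G) @^-1` A `*` (@rng G) @^-1` B).
    exists ((@src G) @^-1` A, (@rng G) @^-1` B) => //=.
    by split; [exact: src_continuous|exact: rng_continuous].
  suff : (A `&` B) (src a') by rewrite AB.
  by split => //=; rewrite e.
exists ((fun p : G * G => gmul p.1 p.2) @` K); split; last 1 first.
- by move=> _ [[a b] [[/= Ka Kb] ab] <-]; exists a, b.
- exact: continuous_compact.
move=> g; have [t ut [tr ft]] := Cc_fibre_seq (rng g) fC.
rewrite (convolution_seq _ ut tr ft) => h.
have [a at' fa] : exists2 a, a \in t & f a * f' (gmul (ginv a) g) != 0.
  apply: contrapT => hn; move/eqP: h; apply; rewrite big1_seq // => a /= at'.
  by apply/eqP; apply: contrapT => /negP ?; apply: hn; exists a.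
move: fa; rewrite mulf_eq0 negb_or => /andP[fa fa'].
exists (a, gmul (ginv a) g); last by rewrite /= gmulVK // tr.
split; first by split; exact: Cc_support.
by rewrite /D /= rng_mul ?rng_inv // src_inv tr.
Qed.

Lemma Cc_convolution f f' : Cc f -> Cc f' -> Cc (convolution f f').
Proof.
move=> fC f'C; have [K [cK fK _]] := convolution_support fC f'C.
exact: Cc_compact (convolution_continuous fC f'C) cK fK.
Qed.

End convolution_kernels.

(** * The C*-algebra generated by a *-subalgebra of Cc(G) *)

Section approximable_algebra.
Variables (R : realType) (G : etaleGroupoid).
Hypothesis hausG : hausdorff_space G.
Local Notation C := (R[i]^o).
Local Notation lambda := (@regular_rep R G).
Implicit Types (f k : G -> C) (T S : l2 R G -> l2 R G).

Lemma bounded_op_lin (X : choiceType) (a : R[i]) (T S : l2 R X -> l2 R X) :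
  bounded_op T -> bounded_op S -> bounded_op (a *: T + S).
Proof.
move=> /bounded_opP[lT [c c0 hc]] /bounded_opP[lS [d d0 hd]].
apply/bounded_opP; split=> [b u v|].
  by rewrite !fctE lT lS; apply: l2_ext => x; rewrite !l2E; ring.
exists (normc a * c + d) => [|u]; first by rewrite addr_ge0 // mulr_ge0 ?normc_ge0.
rewrite fctE mulrDl; apply: le_trans (l2_normD _ _) _.
rewrite lerD //; apply: le_trans (l2_normZ_le _ _) _.
by rewrite -mulrA ler_wpM2l ?normc_ge0.
Qed.

Lemma bounded_op_comp (X : choiceType) (T S : l2 R X -> l2 R X) :
  bounded_op T -> bounded_op S -> bounded_op (T \o S).
Proof.
move=> /bounded_opP[lT [c c0 hc]] /bounded_opP[lS [d d0 hd]].
apply/bounded_opP; split=> [b u v|]; first by rewrite /= lS lT.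
exists (c * d) => [|u]; first by rewrite mulr_ge0.
by apply: le_trans (hc _) _; rewrite -mulrA ler_wpM2l.
Qed.

Lemma regular_rep_lin (a : C) f f' : Cc f -> Cc f' ->
  lambda (fun g => a * f g + f' g) = a *: lambda f + lambda f'.
Proof.
move=> fC f'C; have ffC := Cc_lin hausG a fC f'C.
apply: mx_of_inj.
- exact: regular_rep_bounded.
- by apply: bounded_op_lin; exact: regular_rep_bounded.
move=> x y; rewrite mx_of_regular_rep // conv_ker_lin /mx_of fctE l2E.
by rewrite -!/(mx_of _ x y) !mx_of_regular_rep.
Qed.

Lemma regular_rep_comp f f' : Cc f -> Cc f' ->
  lambda (convolution f f') = lambda f \o lambda f'.
Proof.
move=> fC f'C; have ffC := Cc_convolution hausG fC f'C.
apply: mx_of_inj.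
- exact: regular_rep_bounded.
- by apply: bounded_op_comp; exact: regular_rep_bounded.
move=> g b; rewrite mx_of_regular_rep // /mx_of /= regular_rep_conv //.
have [t ut [tr ft]] := Cc_fibre_seq (rng g) fC.
rewrite (convolution_seq _ ut tr ft).
rewrite (eq_big_seq (fun a => f a * conv_ker f' (gmul (ginv a) g) b)); last first.
  by move=> a at'; rewrite -mx_of_regular_rep.
have sE a : a \in t -> src (gmul (ginv a) g) = src g.
  by move=> /tr ag; rewrite src_mul // src_inv.
rewrite {1}/conv_ker; case: eqP => [gb|gb]; last first.
  rewrite big1_seq // => a /= at'; rewrite /conv_ker sE //.
  by case: eqP => // _; rewrite mulr0.
rewrite (@convolution_seq _ _ _ _ _ t) ?rng_div //.
apply: eq_big_seq => a at'; rewrite conv_kerE ?sE // /gdiv -gmul_assoc //.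
  by rewrite src_inv tr.
by rewrite rng_inv.
Qed.

(** The commutator of T with S equals its commutator with S - S', of norm at most 2 c times the
    error. *)
Lemma commute_closed (X : choiceType) (T S : l2 R X -> l2 R X) :
  bounded_op T -> bounded_op S ->
  (forall e : R, 0 < e -> exists S' : l2 R X -> l2 R X, [/\ bounded_op S', T \o S' = S' \o T &
    lipschitz (S - S')%R e]) -> T \o S = S \o T.
Proof.
move=> /bounded_opP[lT [c c0 hc]] /bounded_opP[lS _] h.
apply/funext => xi /=; apply/eqP; rewrite -subr_eq0; apply/eqP/l2_norm_eq0.
apply/ler_addgt0Pr => e e0; rewrite add0r.
have d0 : 0 < 2 * c * l2_norm xi + 1.
  by rewrite ltr_wpDl // !mulr_ge0 ?l2_norm_ge0.
have e1 : 0 < e / (2 * c * l2_norm xi + 1) by rewrite divr_gt0.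
have [S' [/bounded_opP[lS' _] TS' hS']] := h _ e1.
have -> : T (S xi) - S (T xi) = T ((S - S')%R xi) - (S - S')%R (T xi).
  rewrite !fctE linear_opB //; have /= -> := congr1 (@^~ xi) TS'.
  by apply: l2_ext => x; rewrite !l2BE; ring.
apply: le_trans (l2_normD _ _) _; rewrite l2_normN.
have h1 := hc ((S - S')%R xi); have h2 := hS' xi; have h3 := hS' (T xi).
have h4 := hc xi; move: e1 h2 h3.
set k := e / _ => k0 h2 h3; have ke : k * (2 * c * l2_norm xi + 1) = e.
  by rewrite /k divfK // gt_eqF.
have := l2_norm_ge0 xi; move: ke h1 h2 h3 h4; rewrite !fctE.
move: (l2_norm _) (l2_norm _) (l2_norm _) (l2_norm _) (l2_norm _) => p q r u w *.
nra.
Qed.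

Variable P : (G -> C) -> Prop.
Hypothesis P0 : P (fun=> 0).
Hypothesis Plin : forall a f f', Cc f -> Cc f' -> P f -> P f' ->
  P (fun g => a * f g + f' g).
Hypothesis Pconv : forall f f', Cc f -> Cc f' -> P f -> P f' ->
  P (convolution f f').
Hypothesis Pinv : forall f, Cc f -> P f -> P (involution f).

Lemma approximable_reduced T : approximable P T -> reduced_cstar R G T.
Proof.
move=> [bT h]; apply/(reduced_cstarP hausG); split=> // e /h[f [fC _ fe]].
by exists f.
Qed.

Lemma approximable_regular_rep f : Cc f -> P f -> approximable P (lambda f).
Proof.
move=> fC Pf; split=> [|e e0]; first exact: regular_rep_bounded.
exists f; split => // xi; rewrite !fctE subrr l2_norm0.
by rewrite mulr_ge0 ?l2_norm_ge0 // ltW.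
Qed.

Lemma approximable_lin (a : R[i]) T S : approximable P T -> approximable P S ->
  approximable P (a *: T + S).
Proof.
move=> [bT hT] [bS hS]; split=> [|e e0]; first exact: bounded_op_lin.
have e2 : 0 < e / 2 by lra.
have a0 : 0 < normc a + 1 by rewrite ltr_wpDl ?normc_ge0.
have e1 : 0 < e / 2 / (normc a + 1) by rewrite divr_gt0.
have [f [fC Pf fe]] := hT _ e1; have [f' [f'C Pf' fe']] := hS _ e2.
exists (fun g => a * f g + f' g); split.
- exact: Cc_lin.
- exact: Plin.
move=> xi; rewrite regular_rep_lin //.
have -> : (a *: T + S - (a *: lambda f + lambda f'))%R xi =
    a *: (T - lambda f)%R xi + (S - lambda f')%R xi.
  by rewrite !fctE; apply: l2_ext => x; rewrite !(l2BE, l2E); ring.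
rewrite (splitr e) mulrDl; apply: le_trans (l2_normD _ _) _; apply: lerD => //.
apply: le_trans (l2_normZ_le _ _) _.
apply: le_trans (ler_wpM2l (normc_ge0 a) (fe xi)) _.
rewrite mulrA ler_wpM2r ?l2_norm_ge0 // mulrCA ler_piMr ?(ltW e2) //.
by rewrite ler_pdivrMr // mul1r lerDl.
Qed.

(** T S - f f' = (T - f) S + f (S - f'): [f] is chosen first, since the precision asked of [f']
    depends on the norm of the operator of [f]. *)
Lemma approximable_comp T S : approximable P T -> approximable P S ->
  approximable P (T \o S).
Proof.
move=> [bT hT] [bS hS]; split=> [|e e0]; first exact: bounded_op_comp.
have e2 : 0 < e / 2 by lra.
have small (c : R) : 0 <= c -> 0 < e / 2 / (c + 1) /\ e / 2 / (c + 1) * c <= e / 2.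
  move=> c0; have c1 : 0 < c + 1 by rewrite ltr_wpDl.
  split; first by rewrite divr_gt0.
  by rewrite mulrAC ler_pdivrMr // ler_wpM2l ?(ltW e2) // lerDl.
have /bounded_opP[lS [d d0 hd]] := bS.
have [e1 e1d] := small d d0.
have [f [fC Pf fe]] := hT _ e1.
have /bounded_opP[lf [c c0 hc]] := regular_rep_bounded hausG fC.
have [e3 e3c] := small c c0.
have [f' [f'C Pf' fe']] := hS _ e3.
exists (convolution f f'); split; [exact: Cc_convolution|exact: Pconv|].
move=> xi; rewrite regular_rep_comp //.
have -> : ((T \o S) - (lambda f \o lambda f'))%R xi =
    (T - lambda f)%R (S xi) + lambda f ((S - lambda f')%R xi).
  by rewrite !fctE linear_opB // addrA subrK.
rewrite (splitr e) mulrDl; apply: le_trans (l2_normD _ _) _; apply: lerD.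
  apply: le_trans (fe _) _; apply: le_trans (ler_wpM2l (ltW e1) (hd xi)) _.
  by rewrite mulrA ler_wpM2r ?l2_norm_ge0.
apply: le_trans (hc _) _; apply: le_trans (ler_wpM2l c0 (fe' xi)) _.
by rewrite mulrA [c * _]mulrC ler_wpM2r ?l2_norm_ge0.
Qed.

Lemma approximable_adjoint T : approximable P T ->
  exists2 S, approximable P S & adjoint T S.
Proof.
move=> aT; have [bT hT] := aT; have /bounded_opP[lT [c c0 hc]] := bT.
have Tc := mx_of_bound lT c0 hc.
have Tc' := mxbound_adj c0 Tc.
pose S := op_of (fun x y => conjc (mx_of T y x)).
have mxS x y : mx_of S x y = conjc (mx_of T y x) by exact: mx_of_op_of c0 Tc' x y.
have bS : bounded_op S by exact: op_of_bounded c0 Tc'.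
exists S; last exact: mx_adjoint.
apply: (ker_approximable hausG (k := involution (kernel_of T))) => // [g b|e e0].
  by rewrite mxS conv_ker_involution (mx_of_approximable hausG _ _ aT).
have [f [fC Pf fe]] := approximable_ker hausG aT e0.
exists (involution f); split; [exact: Cc_involution|exact: Pinv|].
apply: mxbound_ext (mxbound_adj (ltW e0) fe) => x y _ _.
by rewrite !conv_kerB rmorphB /= !conv_ker_involution.
Qed.

Lemma approximable_closed T : bounded_op T ->
  (forall e : R, 0 < e -> exists2 S, approximable P S & (opnorm (T - S)%R < e%:E)%E) ->
  approximable P T.
Proof.
move=> bT h; split=> // e e0; have e2 : 0 < e / 2 by lra.
have [S [bS hS] TS] := h _ e2; have [f [fC Pf fe]] := hS _ e2.
exists f; split => // xi.
have -> : (T - lambda f)%R xi = (T - S)%R xi + (S - lambda f)%R xi.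
  by rewrite !fctE addrA subrK.
rewrite (splitr e) mulrDl; apply: le_trans (l2_normD _ _) _; apply: lerD => //.
by apply: opnorm_lipschitz (ltW TS) xi; have [] := bounded_opB bT bS.
Qed.

Lemma approximable0 : approximable P 0.
Proof.
have C0 : Cc ((fun=> 0) : G -> C) by exact: Cc_0.
have -> : 0 = lambda (fun=> 0); last exact: approximable_regular_rep.
have b0 : bounded_op (0 : l2 R G -> l2 R G).
  apply/bounded_opP; split=> [a u v|]; first by rewrite scaler0 addr0.
  by exists 0 => // xi; rewrite l2_norm0 mul0r.
apply: mx_of_inj => //; first exact: regular_rep_bounded.
by move=> x y; rewrite mx_of_regular_rep // /conv_ker; case: ifP.
Qed.

Lemma approximable_cstar : cstar_subalgebra (approximable P).
Proof.
split.
- by move=> T [].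
- by split; [exact: approximable0|move=> a T S; exact: approximable_lin].
- by move=> T S; exact: approximable_comp.
- exact: approximable_adjoint.
- exact: approximable_closed.
Qed.

Lemma approximable_abelian :
  (forall f f', Cc f -> Cc f' -> P f -> P f' -> convolution f f' =1 convolution f' f) ->
  abelian_algebra (approximable P).
Proof.
move=> Pcomm T S [bT hT] [bS hS].
have comm f f' : Cc f -> Cc f' -> P f -> P f' ->
    lambda f \o lambda f' = lambda f' \o lambda f.
  move=> fC f'C Pf Pf'; rewrite -!regular_rep_comp //; congr regular_rep.
  exact/funext/Pcomm.
(* One factor at a time: S is replaced by the operator of [f], then T by that of [f']. *)
apply: commute_closed => // e e0; have [f [fC Pf fe]] := hS _ e0.
exists (lambda f); split => //; first exact: regular_rep_bounded.
apply/esym/commute_closed => [||e' e'0] //; first exact: regular_rep_bounded.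
have [f' [f'C Pf' fe']] := hT _ e'0.
by exists (lambda f'); split; [exact: regular_rep_bounded|exact: comm|].
Qed.

End approximable_algebra.

(** * Functions with compact support in Iso(G)^o *)

Section iso_supported.
Variables (R : realType) (G : etaleGroupoid).
Hypothesis hausG : hausdorff_space G.
Local Notation C := (R[i]^o).
Local Notation H := (iso_interior G).
Implicit Types (f : G -> C).

(** The closure matters: when H is not closed, a function of Cc(G) may vanish off H without being
    the extension of a function of Cc(H). *)
Definition iso_supported f := closure [set g | f g != 0] `<=` H.

Lemma iso_supported_nz f g : iso_supported f -> f g != 0 -> H g.
Proof. by move=> h /Cc_support /h. Qed.

Lemma iso_supported0 : iso_supported (fun=> 0).
Proof.
rewrite /iso_supported (_ : [set g | _] = set0) ?closure0 //.
by apply/seteqP; split=> g //=; rewrite eqxx.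
Qed.

Lemma iso_supported_lin (a : C) f f' : Cc f -> Cc f' ->
  iso_supported f -> iso_supported f' -> iso_supported (fun g => a * f g + f' g).
Proof.
move=> [cf cK] [cf' cK'] Hf Hf'.
apply: subset_trans (support_sub_compact hausG (compactU cK cK') _) _.
  move=> g fg; have [f0|/Cc_support] := eqVneq (f g) 0; last by left.
  right; apply: Cc_support; apply: contra fg => /eqP ->.
  by rewrite f0 mulr0 addr0.
by move=> g [/Hf|/Hf'].
Qed.

Lemma iso_supported_conv f f' : Cc f -> Cc f' ->
  iso_supported f -> iso_supported f' -> iso_supported (convolution f f').
Proof.
move=> fC f'C Hf Hf'; have [K [cK fK KE]] := convolution_support hausG fC f'C.
apply: subset_trans (support_sub_compact hausG cK fK) _ => g /KE.
move=> [a [b [/Hf Ha /Hf' Hb ab ->]]]; exact: iso_interior_mul.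
Qed.

Lemma iso_supported_inv f : Cc f -> iso_supported f -> iso_supported (involution f).
Proof.
move=> [cf cK] Hf.
apply: subset_trans
  (support_sub_compact hausG (K := (@ginv G) @` closure [set g | f g != 0]) _ _) _.
- apply: continuous_compact cK; apply: continuous_subspaceT.
  exact: ginv_continuous.
- move=> g h; exists (ginv g); last by rewrite ginvK.
  by apply: Cc_support; apply: contra h => /eqP; rewrite /involution => ->; rewrite rmorph0.
- by move=> _ [g /Hf Hg <-]; exact: iso_interior_inv.
Qed.

Hypothesis abelH : forall a b : G, H a -> H b -> rng a = rng b ->
  gmul a b = gmul b a.

(** For g in H, commutativity makes a |-> a^-1 g an involution of the fibre of H over rng g, which
    exchanges the two sums; for g off H both vanish, H being closed under products. *)
Lemma iso_supported_comm f f' : Cc f -> Cc f' ->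
  iso_supported f -> iso_supported f' -> convolution f f' =1 convolution f' f.
Proof.
move=> fC f'C Hf Hf' g.
have [t ut [tr ft]] := Cc_fibre_seq (rng g) fC.
have [t' ut' [tr' ft']] := Cc_fibre_seq (rng g) f'C.
have [Hg|Hg] := pselect (H g); last first.
  have zero f1 f2 t1 : iso_supported f1 -> iso_supported f2 ->
      (forall a, a \in t1 -> rng a = rng g) ->
      \sum_(a <- t1) f1 a * f2 (gmul (ginv a) g) = 0.
    move=> Hf1 Hf2 t1r; rewrite big1_seq // => a /= /t1r ag.
    have [->|/(iso_supported_nz Hf1) Ha] := eqVneq (f1 a) 0; first by rewrite mul0r.
    have [->|/(iso_supported_nz Hf2) Hag] := eqVneq (f2 (gmul (ginv a) g)) 0.
      by rewrite mulr0.
    exfalso; apply: Hg; rewrite -(gmulVK ag); apply: iso_interior_mul => //.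
    by rewrite rng_mul ?rng_inv // src_inv.
  by rewrite (convolution_seq _ ut tr ft) (convolution_seq _ ut' tr' ft') !zero.
pose phi a := gmul (ginv a) g.
have gs := iso_interior_sub Hg.
have phiP a : H a -> rng a = rng g -> H (phi a) /\ rng (phi a) = rng g.
  move=> Ha ag; have as_ := iso_interior_sub Ha.
  rewrite /phi rng_mul ?src_inv // rng_inv -as_; split => //.
  by apply: iso_interior_mul; rewrite ?src_inv //; exact: iso_interior_inv.
have phiK a : H a -> rng a = rng g -> phi (phi a) = a.
  move=> Ha ag; have as_ := iso_interior_sub Ha; rewrite /phi.
  rewrite ginv_mulE ?src_inv // ginvK (abelH (iso_interior_inv Hg) Ha) ?rng_inv -?gs //.
  by apply: divK; rewrite -as_ ag.
(* Large enough for both sums: [w] contains the arrows of H in [t], and its image under [phi]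
   contains those in [t']. *)
pose w := undup ([seq a <- t | `[< H a >]] ++ map phi [seq b <- t' | `[< H b >]]).
have wP a : a \in w -> H a /\ rng a = rng g.
  rewrite mem_undup mem_cat mem_filter => /orP[/andP[/asboolP Ha /tr]//|].
  move=> /mapP[b]; rewrite mem_filter => /andP[/asboolP Hb /tr' bg] ->.
  exact: phiP.
have uw : uniq w by exact: undup_uniq.
have uphi : uniq (map phi w).
  rewrite map_inj_in_uniq // => a b /wP[Ha ag] /wP[Hb bg] ab.
  by rewrite -(phiK a) // ab phiK.
rewrite (@convolution_seq _ _ f f' g w) //; last 2 first.
- by move=> a /wP[].
- move=> a ag fa; rewrite mem_undup mem_cat mem_filter ft // andbT.
  by rewrite (asboolT (iso_supported_nz Hf fa)).
rewrite (@convolution_seq _ _ f' f g (map phi w)) //; last 2 first.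
- by move=> _ /mapP[a /wP[Ha ag] ->]; have [] := phiP a Ha ag.
- move=> b bg fb; have Hb := iso_supported_nz Hf' fb.
  apply/mapP; exists (phi b); last by rewrite phiK.
  rewrite mem_undup mem_cat; apply/orP; right; apply: map_f.
  by rewrite mem_filter ft' // andbT; exact/asboolP.
rewrite big_map; apply: eq_big_seq => a /wP[Ha ag].
by rewrite mulrC -/(phi a) -/(phi (phi a)) phiK.
Qed.

Lemma iso_approximable_cstar : cstar_subalgebra (approximable iso_supported).
Proof.
apply: approximable_cstar => //.
- exact: iso_supported0.
- exact: iso_supported_lin.
- exact: iso_supported_conv.
- exact: iso_supported_inv.
Qed.

Lemma iso_approximable_abelian : abelian_algebra (approximable iso_supported).
Proof. by apply: approximable_abelian => // f f'; exact: iso_supported_comm. Qed.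

End iso_supported.

(** * The inclusion of the isotropy bundle *)

Section isotropy_blocks.
Variables (R : realType) (G : etaleGroupoid).
Local Notation C := (R[i]^o).
Local Notation H := (iso_interior G).
Implicit Types (q : G -> C) (a b g h x : G).

Definition iso_fibre x : set G := [set u | H u /\ src u = x].

Lemma div_mul a b g : src a = src b -> src b = src g ->
  gmul (gdiv a b) (gdiv b g) = gdiv a g.
Proof.
move=> ab bg; rewrite /gdiv -gmul_assoc ?rng_mul ?rng_inv ?src_inv //.
by rewrite gmulKV // rng_inv.
Qed.

(* The kernel of q is block diagonal along the cosets Hg, and g |-> g h^-1 carries
   the coset of h to the fibre of H at rng h. *)
Lemma mxbound_iso_fibres q (c : R) : 0 <= c -> (forall g, q g != 0 -> H g) ->
  (forall x, mxbound (iso_fibre x) (conv_ker q) c) -> mxbound setT (conv_ker q) c.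
Proof.
move=> c0 qH qc.
(* The coset Hg itself serves as the label of its block. *)
pose cl g : set G := [set b | src b = src g /\ H (gdiv g b)].
have clS g b : src g = src b -> H (gdiv g b) -> cl b `<=` cl g.
  move=> gb Hgb h [hb Hbh]; split; first by rewrite gb.
  rewrite -(div_mul gb (esym hb)); apply: iso_interior_mul => //.
  by rewrite src_div // rng_div.
apply: (mxbound_block (cl := cl)) => // [g b _ _|z].
  rewrite /conv_ker; case: (src g =P src b) => [gb /qH Hgb|_]; last by rewrite eqxx.
  apply/seteqP; split; last exact: clS.
  by apply: clS => //; rewrite -ginv_div //; exact: iso_interior_inv.
have [[h hz]|hz] := pselect (exists h, cl h = z); last first.
  move=> [|g s] t us ut sA tA xi; first by rewrite fnorm_nil mulr_ge0 ?fnorm_ge0.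
  by exfalso; apply: hz; exists g; have [] := sA g (mem_head _ _).
have clP g : cl g = z -> src g = src h /\ H (gdiv g h).
  move=> gz; have : cl g g by split => //; rewrite /gdiv gmul_inv; exact: iso_interior_rng.
  rewrite gz -hz => -[gh Hhg]; split=> //.
  by rewrite -ginv_div //; exact: iso_interior_inv.
apply: (mxbound_reindex (phi := fun g => gdiv g h)) (qc (rng h)).
- move=> a b; rewrite !inE => -[_ /clP[ah _]] [_ /clP[bh _]]; exact: div_inj ah bh.
- by move=> a [_ /clP[ah Hah]]; split=> //; rewrite src_div.
- move=> a b [_ /clP[ah _]] [_ /clP[bh _]].
  by rewrite !conv_kerE ?div_div ?src_div // ah bh.
Qed.

End isotropy_blocks.

Section iso_groupoid_inclusion.
Variables (R : realType) (G : etaleGroupoid).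
Hypothesis hausG : hausdorff_space G.
Local Notation C := (R[i]^o).
Local Notation I := (iso_groupoid G).
Local Notation H := (iso_interior G).
Implicit Types (f : I -> C) (q : G -> C).

Definition iso_val (u : I) : G := val (u : set_type H).

Lemma iso_val_inj : injective iso_val.
Proof. exact: val_inj. Qed.

Lemma iso_valH u : H (iso_val u).
Proof. exact: iso_valP. Qed.

Lemma iso_val_surj g : H g -> exists u : I, iso_val u = g.
Proof. by move=> Hg; exists (exist _ g (mem_set Hg) : set_type H). Qed.

Lemma iso_val_src (u : I) : iso_val (src u) = src (iso_val u).
Proof. exact: val_iso_src. Qed.

Lemma iso_val_div (u v : I) : src u = src v ->
  iso_val (gdiv u v) = gdiv (iso_val u) (iso_val v).
Proof.
move=> uv; rewrite /gdiv /iso_val /= val_iso_mul ?val_iso_inv //.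
by rewrite -[iso_src u]/(src u) uv -[iso_rng _]/(rng (ginv v)) rng_inv.
Qed.

Lemma conv_ker_iso_val q u v :
  conv_ker (q \o iso_val) u v = conv_ker q (iso_val u) (iso_val v).
Proof.
rewrite /conv_ker -!iso_val_src (inj_eq iso_val_inj).
by case: eqP => // uv; rewrite /= iso_val_div.
Qed.

Lemma extend0_val f u : extend0 f (iso_val u) = f u.
Proof. by rewrite /extend0 /iso_val valK. Qed.

Lemma extend0_out f g : ~ H g -> extend0 f g = 0.
Proof. by move=> Hg; rewrite /extend0 insubF //; apply/negbTE/negP; rewrite inE. Qed.

Lemma extend0_nz f g : extend0 f g != 0 -> H g.
Proof.
by move=> fg; apply: contrapT => Hg; rewrite extend0_out ?eqxx in fg.
Qed.

Lemma extend0K q : (forall g, q g != 0 -> H g) -> extend0 (q \o iso_val) = q.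
Proof.
move=> qH; apply/funext => g; have [/iso_val_surj[u <-]|Hg] := pselect (H g).
  exact: extend0_val.
rewrite extend0_out //; apply/esym/eqP; apply: contrapT => /negP /qH //.
Qed.

Lemma extend0B f f' g : extend0 (fun u => f u - f' u) g = extend0 f g - extend0 f' g.
Proof.
have [/iso_val_surj[u <-]|Hg] := pselect (H g); first by rewrite !extend0_val.
by rewrite !extend0_out ?subr0.
Qed.

Lemma iso_hausdorff : hausdorff_space I.
Proof.
move=> u v uv; apply: iso_val_inj; apply: hausG => A B uA vB.
have [w [Aw Bw]] := uv (iso_val @^-1` A) (iso_val @^-1` B)
  (iso_val_continuous uA) (iso_val_continuous vB).
by exists (iso_val w).
Qed.

Lemma iso_val_cts : continuous iso_val.
Proof. exact: iso_val_continuous. Qed.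

(** Off the compact, hence closed, set [K] the extension vanishes nearby; on [K] continuity is
    inherited because H is open in G. *)
Lemma Cc_extend0 f : Cc f -> Cc (extend0 f) /\ iso_supported (extend0 f).
Proof.
move=> [cf cK]; pose K := iso_val @` closure [set u | f u != 0].
have cptK : compact K.
  by apply: continuous_compact cK; exact/continuous_subspaceT/iso_val_cts.
have fK g : extend0 f g != 0 -> K g.
  move=> fg; have [u ug] := iso_val_surj (extend0_nz fg).
  by exists u => //; apply: Cc_support; rewrite -extend0_val ug.
split; last first.
  apply: subset_trans (support_sub_compact hausG cptK fK) _.
  by move=> _ [u _ <-]; exact: iso_valH.
apply: (Cc_compact hausG _ cptK fK) => g.
have [[u _ <-]|Kg] := pselect (K g); last first.
  have z h : ~ K h -> extend0 f h = 0.
    by move=> Kh; apply/eqP; apply: contrapT => /negP /fK.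
  have : \forall h \near g, (~` K) h.
    apply: open_nbhs_nbhs; split => //; apply/closed_openC.
    exact: compact_closed hausG cptK.
  rewrite /continuous_at z // => Kn; apply/cvg_normcP => e e0.
  by apply: filterS Kn => h /z ->; rewrite subrr normc0.
rewrite /continuous_at extend0_val; apply/cvg_normcP => e e0.
move/cvg_normcP: (cf u) => /(_ e e0) /iso_nbhs[V [oV Vu VW]].
have : nbhs (iso_val u) (V `&` H).
  apply: open_nbhs_nbhs; split; first exact: openI oV (@iso_interior_open G).
  by split => //; exact: iso_valH.
apply: filterS => g' [Vg' /iso_val_surj[v vg]].
by rewrite -vg extend0_val; apply: VW; rewrite -[val v]/(iso_val v) vg.
Qed.

(** A cluster point found in G lies in the closed support, hence in H: here the closure in
    [iso_supported] is used. *)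
Lemma Cc_iso_val q : Cc q -> iso_supported q -> Cc (q \o iso_val).
Proof.
move=> [cq cK] qH; apply: (@Cc_compact R _ iso_hausdorff _
    (iso_val @^-1` closure [set g | q g != 0])).
- by move=> u; apply: continuous_comp; [exact: iso_val_cts|exact: cq].
- move=> F FF FK; have [p [Kp clp]] := cK (iso_val @ F) _ FK.
  have [u up] := iso_val_surj (qH _ Kp); exists u; split; first by rewrite /= up.
  move=> A B FA /iso_nbhs[V [oV Vu VB]].
  have FA' : F (iso_val @^-1` (iso_val @` A)) by apply: filterS FA => v Av; exists v.
  have Vp : V p by rewrite -up.
  have [_ [[v Av <-] Vv]] := clp _ _ FA' (open_nbhs_nbhs (conj oV Vp)).
  by exists v; split => //; exact: VB.
- by move=> u qu; exact: (@Cc_support R G q (iso_val u) qu).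
Qed.

(** With [mxbound_iso_val] this is the isometry of iota: the extended kernel is block diagonal, and
    its blocks are copies of submatrices over H. *)
Lemma mxbound_extend0 q (c : R) : 0 <= c -> (forall g, q g != 0 -> H g) ->
  mxbound setT (conv_ker (q \o iso_val)) c -> mxbound setT (conv_ker q) c.
Proof.
move=> c0 qH qc; apply: mxbound_iso_fibres => // x.
have [[u0 _]|noH] := pselect (exists u0 : I, True); last first.
  move=> [|g s] t us ut sA tA xi; first by rewrite fnorm_nil mulr_ge0 ?fnorm_ge0.
  exfalso; apply: noH; have [/iso_val_surj[u _] _] := sA g (mem_head _ _).
  by exists u.
pose phi g : I := xget u0 [set u | iso_val u = g].
have phiK g : H g -> iso_val (phi g) = g.
  by move=> /iso_val_surj Hg; rewrite /phi; exact: (xgetPex u0 Hg).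
apply: (mxbound_reindex (phi := phi)) qc => //.
- move=> a b; rewrite !inE => -[Ha _] [Hb _] ab.
  by rewrite -(phiK a) // ab phiK.
- by move=> a b [Ha _] [Hb _]; rewrite conv_ker_iso_val !phiK.
Qed.

Lemma mxbound_iso_val q (c : R) : mxbound setT (conv_ker q) c ->
  mxbound setT (conv_ker (q \o iso_val)) c.
Proof.
by apply: (mxbound_reindex (phi := iso_val)) => // u v _ _; exact: conv_ker_iso_val.
Qed.

(* The set in which iso_inclusion T is chosen. *)
Let graph (T : l2 R I -> l2 R I) := [set S : l2 R G -> l2 R G | bounded_op S /\
  forall e : R, 0 < e ->
    exists f, [/\ Cc f, (opnorm (T - regular_rep f)%R < e%:E)%E &
      (opnorm (S - regular_rep (extend0 f))%R < e%:E)%E]].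

Let graph_lipschitz T S (e : R) : bounded_op T -> graph T S -> 0 < e ->
  exists f, [/\ Cc f, lipschitz (T - regular_rep f)%R e &
    lipschitz (S - regular_rep (extend0 f))%R e].
Proof.
move=> bT [bS h] e0; have [f [fC Tf Sf]] := h e e0; exists f.
have [fC' _] := Cc_extend0 fC; split => //.
  apply: opnorm_lipschitz (ltW Tf).
  by have [] := bounded_opB bT (regular_rep_bounded iso_hausdorff fC).
apply: opnorm_lipschitz (ltW Sf).
by have [] := bounded_opB bS (regular_rep_bounded hausG fC').
Qed.

Let graph_approximable T S : bounded_op T -> graph T S ->
  approximable (@iso_supported R G) S.
Proof.
move=> bT gS; have [bS _] := gS; split=> // e e0.
have [f [fC _ Sf]] := graph_lipschitz bT gS e0.
by have [fC' fH] := Cc_extend0 fC; exists (extend0 f).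
Qed.

(** Approximants of the kernel [k] extend by zero with the same error, by [mxbound_extend0]. *)
Let kernels_graph T S k : bounded_op T -> bounded_op S ->
  (forall u v, mx_of T u v = conv_ker k u v) ->
  (forall g h, mx_of S g h = conv_ker (extend0 k) g h) ->
  (forall e : R, 0 < e -> exists2 f, Cc f &
     mxbound setT (conv_ker (fun u => k u - f u)) e) -> graph T S.
Proof.
move=> bT bS Tk Sk h; split=> // e e0; have e2 : 0 < e / 2 by lra.
have [f fC fe] := h _ e2; have [fC' _] := Cc_extend0 fC; exists f.
have lt : ((e / 2)%:E < e%:E)%E by rewrite lte_fin; lra.
split => //; apply: le_lt_trans lt; apply: opnorm_le (ltW e2) _.
  exact: (ker_lipschitz iso_hausdorff bT fC (ltW e2) Tk fe).
apply: (ker_lipschitz hausG bS fC' (ltW e2) Sk).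
apply: mxbound_ext (mxbound_extend0 (q := extend0 (fun u => k u - f u)) (ltW e2) _ _).
- by move=> g h' _ _; apply: conv_ker_ext => g'; rewrite extend0B.
- exact: extend0_nz.
apply: mxbound_ext fe => u v _ _.
by apply: conv_ker_ext => w; rewrite /= extend0_val.
Qed.

(** Two approximants of T are uniformly close on H, so their extensions are uniformly close on G and
    the matrices of S and S' agree. *)
Let graph_unique T S S' : bounded_op T -> graph T S -> graph T S' -> S = S'.
Proof.
move=> bT gS gS'; have aS := graph_approximable bT gS.
have aS' := graph_approximable bT gS'; have [bS _] := aS; have [bS' _] := aS'.
apply: mx_of_inj => // g h; apply/eqP; rewrite -subr_eq0; apply/eqP/eq0_normc/le_anti.
rewrite normc_ge0 andbT; apply/ler_addgt0Pr => e e0; rewrite add0r.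
have e4 : 0 < e / 4 by lra.
have [f [fC Tf Sf]] := graph_lipschitz bT gS e4.
have [f' [f'C Tf' Sf']] := graph_lipschitz bT gS' e4.
have [eC eH] := Cc_extend0 fC; have [eC' eH'] := Cc_extend0 f'C.
have ent (X : choiceType) (U V : l2 R X -> l2 R X) x y : bounded_op U -> bounded_op V ->
    lipschitz (U - V)%R (e / 4) -> normc (mx_of U x y - mx_of V x y) <= e / 4.
  move=> bU bV UV; rewrite -mx_ofB.
  have [l _] := bounded_opB bU bV.
  exact: mxbound_entry (ltW e4) (mx_of_bound l (ltW e4) UV) _ _.
have ff' u : normc (f u - f' u) <= e / 4 + e / 4.
  have := ent _ _ _ u (src u) bT (regular_rep_bounded iso_hausdorff fC) Tf.
  have := ent _ _ _ u (src u) bT (regular_rep_bounded iso_hausdorff f'C) Tf'.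
  rewrite !(mx_of_regular_rep iso_hausdorff) // !conv_ker_src => h1 h2.
  have -> : f u - f' u = (mx_of T u (src u) - f' u) - (mx_of T u (src u) - f u) by ring.
  by apply: le_trans (le_normcD _ _) _; rewrite normcN lerD.
have h1 := ent _ _ _ g h bS (regular_rep_bounded hausG eC) Sf.
have h2 := ent _ _ _ g h bS' (regular_rep_bounded hausG eC') Sf'.
have h3 : normc (conv_ker (extend0 f) g h - conv_ker (extend0 f') g h) <= e / 4 + e / 4.
  rewrite -conv_kerB /conv_ker; case: ifP => _; last by rewrite normc0; lra.
  rewrite -extend0B; have [/iso_val_surj[u <-]|Hg] := pselect (H (gdiv g h)).
    by rewrite extend0_val.
  by rewrite extend0_out // normc0; lra.
rewrite !(mx_of_regular_rep hausG) // in h1 h2.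
rewrite (_ : mx_of S g h - mx_of S' g h =
  (mx_of S g h - conv_ker (extend0 f) g h) +
  ((conv_ker (extend0 f) g h - conv_ker (extend0 f') g h) -
   (mx_of S' g h - conv_ker (extend0 f') g h))); last by ring.
apply: le_trans (le_normcD _ _) _.
apply: le_trans (lerD (lexx _) (le_normcD _ _)) _.
by rewrite normcN; lra.
Qed.

(** Forward, the zero extension of the kernel of T shows that [xget] has something to choose.
    Backward, S is the value at the operator whose kernel is restricted to H, by [graph_unique]. *)
Lemma iso_inclusion_image : iso_inclusion R G @` reduced_cstar R I =
  approximable (@iso_supported R G).
Proof.
apply/seteqP; split=> [_ [T /(reduced_cstarP iso_hausdorff) aT <-]|S aS].
  have [bT _] := aT; have /bounded_opP[lT [c c0 hc]] := bT.
  have kc := mx_of_bound lT c0 hc.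
  have kb : mxbound setT (conv_ker (extend0 (kernel_of T))) c.
    apply: mxbound_extend0 => //; first exact: extend0_nz.
    apply: mxbound_ext kc => u v _ _; rewrite (mx_of_approximable iso_hausdorff _ _ aT).
    by apply: conv_ker_ext => w; rewrite /= extend0_val.
  apply: (graph_approximable bT); apply: (xgetPex 0).
  exists (op_of (conv_ker (extend0 (kernel_of T)))).
  apply: (kernels_graph (k := kernel_of T)) => //.
  - exact: op_of_bounded c0 kb.
  - by move=> u v; exact: (mx_of_approximable iso_hausdorff _ _ aT).
  - by move=> g h; exact: (mx_of_op_of c0 kb).
  - move=> e e0; have [f [fC _ fe]] := approximable_ker iso_hausdorff aT e0.
    by exists f.
have [bS _] := aS; have /bounded_opP[lS [c c0 hc]] := bS.
have kc := mx_of_bound lS c0 hc.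
have kH g : kernel_of S g != 0 -> H g.
  move=> kg; apply: contrapT => Hg; move/negP: kg; apply; apply/eqP/eq0_normc/le_anti.
  rewrite normc_ge0 andbT; apply/ler_addgt0Pr => e e0; rewrite add0r.
  have [f [fC fH fe]] := approximable_ker hausG aS e0.
  have := mxbound_entry (ltW e0) fe (x := g) (y := src g) Logic.I Logic.I.
  rewrite conv_ker_src (_ : f g = 0) ?subr0 //.
  by apply/eqP; apply: contrapT => /negP /(iso_supported_nz fH).
have kb : mxbound setT (conv_ker (kernel_of S \o iso_val)) c.
  apply: mxbound_iso_val; apply: mxbound_ext kc => g h _ _.
  exact: (mx_of_approximable hausG _ _ aS).
pose T := op_of (conv_ker (kernel_of S \o iso_val)).
have bT : bounded_op T by exact: op_of_bounded c0 kb.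
have Tk u v : mx_of T u v = conv_ker (kernel_of S \o iso_val) u v.
  exact: (mx_of_op_of c0 kb).
have Tap e : 0 < e -> exists2 f, Cc f &
    mxbound setT (conv_ker (fun u => (kernel_of S \o iso_val) u - f u)) e.
  move=> e0; have [f [fC fH fe]] := approximable_ker hausG aS e0.
  exists (f \o iso_val); first exact: Cc_iso_val.
  exact: mxbound_iso_val fe.
have gTS : graph T S.
  apply: kernels_graph bT bS Tk _ Tap => g h.
  by rewrite extend0K // (mx_of_approximable hausG _ _ aS).
exists T.
  apply/(reduced_cstarP iso_hausdorff); apply: (ker_approximable iso_hausdorff bT Tk).
  by move=> e /Tap[f fC fe]; exists f.
apply: (graph_unique bT _ gTS); apply: (xgetPex 0).
by exists S; exact: gTS.
Qed.

End iso_groupoid_inclusion.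

(** * The commutant of the isotropy bundle *)

Section bump_functions.
Variables (R : realType) (X : topologicalType).
Hypothesis hausX : hausdorff_space X.
Hypothesis lcX : locally_compact [set: X].

Lemma bump_function (x : X) (V : set X) : nbhs x V -> exists u : X -> R,
  [/\ continuous u, forall y, 0 <= u y <= 1, \forall y \near x, u y = 1,
      compact (closure [set y | u y != 0]) &
      closure [set y | u y != 0] `<=` V].
Proof.
move=> xV; have [K xK [cK clK]] := lcX (I : [set: X] x).
have {}xK : nbhs x K.
  have xK' : \forall y \near x, ([set: X] y -> K y) := xK.
  by apply: filterS xK' => y; exact.
pose W := (V `&` K)°.
have Wx : W x by exact: (filterI xV xK).
have clW : closed (~` W) by apply/open_closedC/open_interior.
have sep := @locally_compact_completely_regular X R lcX hausX x (~` W) clW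
  (fun h => h Wx).
pose f : X -> R^o := Urysohn [set x] (~` W).
have cf : continuous f by exact: Urysohn_continuous.
have fx : f x = 0.
  by apply: (Urysohn_sub0 sep); exists x.
have fW y : ~ W y -> f y = 1.
  by move=> Wy; apply: (Urysohn_sub1 sep); exists y.
(* The truncation of 2 - 3 f to [0, 1]: it is 1 where f <= 1/3 and 0 where f >= 2/3, so its closed
   support stays in {f <= 2/3}, inside [W]. *)
pose u : X -> R^o := (fun=> 0) \max ((fun=> 1) \min (fun y => 2 - 3 * f y)).
have cu : continuous u.
  move=> y; apply: continuous_max; first exact: cvg_cst.
  apply: continuous_min; first exact: cvg_cst.
  apply: cvgB; first exact: cvg_cst.
  by apply: cvgM; [exact: cvg_cst|exact: cf].
have clu : closure [set y | u y != 0] `<=` V `&` K.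
  apply: (@subset_trans _ [set y | f y <= 2 / 3]).
    rewrite [X in _ `<=` X](_ : _ = f @^-1` [set r | r <= 2 / 3]) //.
    rewrite [X in _ `<=` X]((closure_id _).1 _); last first.
      by apply: closed_comp => [y _|]; [exact: cf|exact: closed_le].
    apply: closureS => y /=; apply: contraNT; rewrite -ltNge => h.
    rewrite /u /=; apply/eqP; apply/max_idPl; rewrite ge_min; apply/orP; right.
    lra.
  move=> y /= fy; suff /interior_subset : W y by [].
  apply: contrapT => /fW h.
  by move: fy; rewrite h; lra.
exists u; split => //.
- move=> y; rewrite /u /= le_max lexx /= ge_max ler01 /=.
  by rewrite ge_min lexx.
- have : \forall y \near x, f y < 1 / 3.
    have := cf x; rewrite /continuous_at fx => /cvgr_lt; apply; lra.
  apply: filterS => y h; rewrite /u /=.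
  have -> : Num.min 1 (2 - 3 * f y) = 1 by apply/min_idPl; lra.
  exact/max_idPr.
- apply: (@subclosed_compact X _ K) => //; first exact: closed_closure.
  by apply: subset_trans clu _; exact: subIsetr.
- by apply: subset_trans clu _; exact: subIsetl.
Qed.

End bump_functions.

Section commutant.
Variables (R : realType) (G : etaleGroupoid).
Hypothesis hausG : hausdorff_space G.
Hypothesis lcG : locally_compact [set: G].
Local Notation C := (R[i]^o).
Local Notation H := (iso_interior G).

Lemma Cc_bump (x : G) (V : set G) : nbhs x V -> exists u : G -> R,
  [/\ continuous u, forall y, 0 <= u y <= 1, \forall y \near x, u y = 1,
      Cc (fun g => (u g)%:C : C) & closure [set g | ((u g)%:C : C) != 0] `<=` V].
Proof.
move=> xV; have [u [cu u01 u1 cptu clu]] := @bump_function R G hausG lcG x V xV.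
have e : [set g | ((u g)%:C : C) != 0] = [set g | u g != 0].
  by apply/seteqP; split=> g /=; apply: contra => /eqP; [move=> ->|move=> []->].
exists u; split => //; last by rewrite e.
by split; [exact: continuous_complex|rewrite e].
Qed.

(** [y] and [rng y] lie in one bisection and have the same range: the unit space is open. *)
Lemma unit_near (x : G) : rng x = x -> \forall y \near x, rng y = y.
Proof.
move=> xx; have n2 : nbhs x ((@rng G) @^-1` bisection x).
  by apply: rng_continuous; rewrite xx; exact: bisection_nbhs.
apply: filterS2 (bisection_nbhs x) n2 => y xy xry.
by apply: (bisection_inj xry xy); rewrite rng_rng.
Qed.

(** If rng g and src g differ, some bump function f on units is 1 at src g and 0 at rng g.
    Convolution by f multiplies by f(rng h), so T f = f T, applied to the delta at src g and
    evaluated at g, forces the kernel to vanish at g. *)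
Lemma commutant_iso (T : l2 R G -> l2 R G) (g : G) : reduced_cstar R G T ->
  (forall f : G -> C, Cc f -> iso_supported f -> T \o regular_rep f = regular_rep f \o T) ->
  kernel_of T g != 0 -> rng g = src g.
Proof.
move=> /(reduced_cstarP hausG)[[lT _] _] comm kg; apply: contrapT => gg.
have [A [B [gA gB AB]]] := hausdorff_separate hausG gg.
have sB : nbhs (src g) (B `&` [set y | rng y = y]).
  by apply: filterI => //; apply: unit_near; rewrite rng_src.
have [u [cu u01 u1 uC clu]] := Cc_bump sB.
pose f g := (u g)%:C : C.
have funit a : f a != 0 -> B a /\ rng a = a by move=> /Cc_support /clu [].
have fH : iso_supported f.
  by move=> a /clu [_ /= <-]; exact: iso_interior_rng.
have lam (xi : l2 R G) h : regular_rep f xi h = f (rng h) * xi h.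
  rewrite regular_rep_conv // (@convolution_seq _ _ _ _ _ [:: rng h]) //.
  - by rewrite big_seq1 ginv_rng mul_rng.
  - by move=> a; rewrite inE => /eqP ->; rewrite rng_rng.
  - by move=> a ah /funit[_ aa]; rewrite inE -ah aa.
have lamd : regular_rep f (delta R (src g)) = f (src g) *: delta R (src g).
  apply: l2_ext => h; rewrite lam.
  rewrite -[RHS]/(f (src g) * delta R (src g) h) deltaE.
  by case: eqP => [->|_]; rewrite ?rng_src // !mulr0.
have fs : f (src g) = 1 by rewrite /f (nbhs_singleton u1).
have fr : f (rng g) = 0.
  apply/eqP; apply: contrapT => /negP /funit[Bg _].
  have : (A `&` B) (rng g) by split => //; exact: nbhs_singleton gA.
  by rewrite AB.
have := congr1 (fun S : l2 R G -> l2 R G => S (delta R (src g)) g) (comm f uC fH).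
rewrite /= lam fr mul0r lamd fs scale1r => k0.
by rewrite /kernel_of k0 eqxx in kg.
Qed.

Lemma commutant_kernel (T : l2 R G -> l2 R G) (g : G) : reduced_cstar R G T ->
  (forall f : G -> C, Cc f -> iso_supported f -> T \o regular_rep f = regular_rep f \o T) ->
  kernel_of T g != 0 -> H g.
Proof.
move=> rT comm kg; have /(reduced_cstarP hausG) aT := rT.
have := kernel_of_nz_open hausG aT kg.
by rewrite /iso_interior /interior; apply: filterS => h; exact: commutant_iso.
Qed.

End commutant.

(** * Restriction to the isotropy bundle near a unit *)

Section folner.
Variables (X : eqType) (L : X -> Prop) (K : nat) (m : 'I_K -> X -> X) (pt : X).
Hypothesis Lpt : L pt.
Hypothesis Lm : forall i x, L x -> L (m i x).
Hypothesis mC : forall i j x, L x -> m i (m j x) = m j (m i x).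

Let word (r : seq 'I_K) (e : 'I_K -> nat) : X :=
  foldr (fun i x => iter (e i) (m i) x) pt r.

Let L_iter i n x : L x -> L (iter n (m i) x).
Proof. by move=> Lx; elim: n => //= n; exact: Lm. Qed.

Let L_word r e : L (word r e).
Proof. by elim: r => //= i r ih; exact: L_iter. Qed.

Let m_iter i j n x : L x -> m i (iter n (m j) x) = iter n (m j) (m i x).
Proof.
by move=> Lx; elim: n => //= n <-; rewrite mC //; exact: L_iter.
Qed.

Let eq_word r e e' : {in r, e =1 e'} -> word r e = word r e'.
Proof.
elim: r => //= i r ih h; rewrite h ?mem_head // ih // => j jr.
by apply: h; rewrite inE jr orbT.
Qed.

Let m_word r e i : i \in r -> uniq r ->
  m i (word r e) = word r (fun j => (e j + (j == i))%N).
Proof.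
elim: r => //= j r ih; rewrite inE => /orP[/eqP ->|ir] /andP[jr ur].
  rewrite eqxx addn1 /=; congr (m j (iter _ _ _)); apply: eq_word => k kr.
  by case: eqP => [kj|_]; rewrite ?addn0 // -kj kr in jr *.
rewrite m_iter // ih //; case: eqP => [ji|_]; last by rewrite addn0.
by rewrite ji ir in jr.
Qed.

(** A box of exponents rather than a ball of a word metric: [m i] raises one exponent by one, so it
    maps box n into box n + 1, and the exponent vectors number (n + 1)^K. *)
Let ball n : seq X := undup [seq word (enum 'I_K) (fun i => nat_of_ord (e i)) |
  e : {ffun 'I_K -> 'I_n.+1}].

Let ballP n x : reflect (exists2 e : 'I_K -> nat, (forall i, e i <= n)%N &
  x = word (enum 'I_K) e) (x \in ball n).
Proof.
rewrite mem_undup; apply: (iffP mapP) => [[e _ ->]|[e en ->]].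
  by exists (fun i => nat_of_ord (e i)) => // i; rewrite -ltnS.
exists [ffun i => inord (e i)]; first by rewrite mem_enum.
by apply: eq_word => i _; rewrite ffunE inordK // ltnS.
Qed.

Let size_ball n : (size (ball n) <= n.+1 ^ K)%N.
Proof.
apply: leq_trans (size_undup _) _.
by rewrite size_map -cardE card_ffun !card_ord.
Qed.

Lemma exp_beats_poly (k : nat) : exists n : nat, (n.+1 ^ k < 2 ^ n)%N.
Proof.
(* With n + 1 = 2^(2a) the claim reads 2ak < 2^(2a) - 1, which follows from (a + 1)^2 <= 2^(2a) as a
   = 2k + 1. *)
pose a := (k.*2.+1)%N; pose M := (2 ^ a.*2)%N.
have M0 : (0 < M)%N by rewrite expn_gt0.
exists M.-1; rewrite prednK // /M -expnM ltn_exp2l //.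
have h : (a < 2 ^ a)%N by exact: ltn_expl.
have -> : (2 ^ a.*2 = 2 ^ a * 2 ^ a)%N by rewrite -addnn expnD.
have : (a.+1 * a.+1 <= 2 ^ a * 2 ^ a)%N by exact: leq_mul.
move: (2 ^ a * 2 ^ a)%N => Q; rewrite /a -!muln2; nia.
Qed.

(* Polynomial growth of the orbit of pt under the commuting maps m i prevents its
   balls from doubling at every step. *)
Lemma folner_set : exists A B : seq X, [/\ uniq A, uniq B, (0 < size B)%N,
  (size A <= 2 * size B)%N & [/\ forall x, x \in A -> L x, {subset B <= A} &
  forall i x, x \in B -> m i x \in A]].
Proof.
have mono n : {subset ball n <= ball n.+1}.
  by move=> x /ballP[e en ->]; apply/ballP; exists e => // i; exact: leqW.
have ball0 n : (0 < size (ball n))%N.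
  have : word (enum 'I_K) (fun=> 0%N) \in ball n by apply/ballP; exists (fun=> 0%N).
  by case: (ball n).
have [n hn] : exists n, (size (ball n.+1) <= 2 * size (ball n))%N.
  apply: contrapT => hno; have [n hn] := exp_beats_poly K.
  suff : (2 ^ n <= size (ball n))%N.
    by rewrite leqNgt (leq_ltn_trans (size_ball n) hn).
  elim: n {hn} => [|n ih]; first by rewrite expn0.
  rewrite expnS; apply: leq_trans (leq_mul (leqnn 2) ih) _.
  by apply: ltnW; rewrite ltnNge; apply/negP => h; apply: hno; exists n.
exists (ball n.+1), (ball n); split; rewrite ?undup_uniq //; split => //.
  by move=> x /ballP[e _ ->].
move=> i x /ballP[e en ->]; rewrite m_word ?enum_uniq ?mem_enum //.
apply/ballP; eexists; last reflexivity.
by move=> j /=; rewrite -addn1 leq_add // leq_b1.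
Qed.

End folner.

Lemma sum_subseq_zero (V : zmodType) (X : eqType) (A B : seq X) (F : X -> V) :
  uniq A -> uniq B -> {subset B <= A} ->
  (forall x, x \in A -> x \notin B -> F x = 0) ->
  \sum_(x <- A) F x = \sum_(x <- B) F x.
Proof.
move=> uA uB BA F0; rewrite (bigID (mem B)) /= addrC big1_seq ?add0r; last first.
  by move=> x /andP[xB xA]; exact: F0.
rewrite -big_filter; apply: perm_big; apply: uniq_perm; rewrite ?filter_uniq // => x.
by rewrite mem_filter; case: (boolP (x \in B)) => // /BA ->.
Qed.

(** * Transfer of a norm bound along a partial homomorphism *)

Section transfer.
Variables (R : realType) (G : etaleGroupoid) (x : G).
Local Notation C := (R[i]^o).
Local Notation H := (iso_interior G).
Variables (sg : G -> G) (SL A A' : seq G) (p : G -> C) (c : R).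
Hypothesis c0 : 0 <= c.
Hypotheses (uA : uniq A) (uA' : uniq A').
Hypotheses (A'0 : (0 < size A')%N) (AA' : (size A <= 2 * size A')%N).
Hypothesis A'A : {subset A' <= A}.
Hypothesis sgSL : forall a, a \in SL -> iso_fibre x (sg a).
Hypothesis sgA : forall a, a \in A -> iso_fibre x (sg a).
Hypothesis sg_div : forall a w, a \in SL -> w \in A' ->
  gmul (ginv a) w \in A /\ sg (gmul (ginv a) w) = gmul (ginv (sg a)) (sg w).
Hypothesis conv_p : forall (eta : G -> C) w, w \in A' ->
  mxapp (conv_ker p) A eta w = \sum_(a <- SL) p a * eta (gmul (ginv a) w).
Hypothesis pc : mxbound [set` A] (conv_ker p) c.

(** The push-forward of [p] along [sg]. In the application [sg a] is [sec a x] for a in the limit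
    group, and [sg_div] asks for multiplicativity on finite sets only. *)
Definition transplant (u : G) : C := \sum_(a <- SL | sg a == u) p a.

Let fP u : iso_fibre x u -> [/\ H u, src u = x & rng u = x].
Proof. by move=> [Hu ux]; split => //; rewrite (iso_interior_sub Hu). Qed.

Let fV u : iso_fibre x u -> iso_fibre x (ginv u).
Proof.
move=> /fP[Hu us ur]; split; first exact: iso_interior_inv.
by rewrite src_inv.
Qed.

Let fM u v : iso_fibre x u -> iso_fibre x v -> iso_fibre x (gmul u v).
Proof.
move=> /fP[Hu us ur] /fP[Hv vs vr]; split; last by rewrite src_mul ?us.
by apply: iso_interior_mul; rewrite ?us.
Qed.

(* For each y in the fibre, conv_ker p is tested on u |-> xi ((sg u) y), u in A: the
   sum over y of the squared norms counts xi at most |A| times, and convolution by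
   transplant at least |A'| >= |A| / 2 times. *)
Lemma transplant_bound : mxbound (iso_fibre x) (conv_ker transplant) (2 * c).
Proof.
move=> s t us ut sH tH xi; apply: fnorm_sqr_le; first by rewrite mulr_ge0.
(* The translates (sg a)^-1 y may leave [t], over which the matrix sum runs; hence the cutoff. *)
pose zeta v := if v \in t then xi v else 0.
pose ap := mxapp (conv_ker transplant) t xi.
have apE y : iso_fibre x y ->
    ap y = \sum_(a <- SL) p a * zeta (gmul (ginv (sg a)) y).
  move=> fy; have [Hy ys yr] := fP fy.
  rewrite /ap /mxapp (eq_big_seq (fun v =>
      \sum_(a <- SL) (if sg a == gdiv y v then p a * xi v else 0))); last first.
    move=> v vt; have [Hv vs vr] := fP (tH _ vt).
    rewrite conv_kerE ?ys ?vs // /transplant mulr_suml big_mkcond.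
    by apply: eq_bigr => a _; case: ifP; rewrite ?mul0r.
  rewrite exchange_big /=; apply: eq_big_seq => a aS.
  have [Ha as_ ar] := fP (sgSL aS).
  have eqv v : v \in t -> (sg a == gdiv y v) = (v == gmul (ginv (sg a)) y).
    move=> vt; have [Hv vs vr] := fP (tH _ vt).
    apply/eqP/eqP => [->|->]; first by rewrite ginv_div ?ys ?vs // divK ?ys ?vs.
    by rewrite /gdiv ginv_mulE ?src_inv ?ar // ginvK gmulVK // ar yr.
  rewrite (eq_big_seq (fun v => if v == gmul (ginv (sg a)) y then p a * xi v else 0));
    last by move=> v vt; rewrite eqv.
  rewrite -big_mkcond /= /zeta; case: ifPn => [vt|vt].
    rewrite (big_rem _ vt) /= eqxx big1_seq ?addr0 // => v /andP[/eqP ->].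
    by rewrite mem_rem_uniq // inE eqxx.
  rewrite mulr0 big1_seq // => v /andP[/eqP -> ].
  by rewrite (negbTE vt).
have step y : iso_fibre x y -> \sum_(w <- A') normc (ap (gmul (sg w) y)) ^+ 2 <=
    c ^+ 2 * \sum_(u <- A) normc (zeta (gmul (sg u) y)) ^+ 2.
  move=> fy; have [Hy ys yr] := fP fy.
  pose eta u := zeta (gmul (sg u) y).
  have hb := pc uA' uA (fun w wA => A'A wA) (fun u uA => uA) eta.
  have : fnorm A' (mxapp (conv_ker p) A eta) ^+ 2 <= (c * fnorm A eta) ^+ 2.
    by rewrite ler_sqr ?nnegrE ?mulr_ge0 ?fnorm_ge0.
  rewrite exprMn !sqr_fnorm; congr (_ <= _); apply: eq_big_seq => w wA'.
  rewrite conv_p // apE; last by apply: fM => //; exact: sgA (A'A wA').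
  congr (normc _ ^+ 2); apply: eq_big_seq => a aS.
  rewrite /eta; have [_ ->] := sg_div aS wA'; congr (_ * zeta _).
  have [_ as_ ar] := fP (sgSL aS); have [_ ws wr] := fP (sgA (A'A wA')).
  by rewrite gmul_assoc ?src_inv ?ar ?ws ?wr ?yr.
(* Every y with (sg w) y in [s] for some w in [A'], so that each w in [A'] sees the whole of [s] in
   a sum over [Y]. *)
pose Y := undup [seq gmul (ginv (sg w)) z | w <- A', z <- s].
have YP y : y \in Y -> iso_fibre x y.
  rewrite mem_undup => /allpairsP[[w z] /= [wA zs ->]].
  by apply: fM; [apply: fV; exact: sgA (A'A wA)|exact: sH].
have cancel_l w y : iso_fibre x w -> iso_fibre x y -> gmul w (gmul (ginv w) y) = y.
  by move=> /fP[_ _ wr] /fP[_ _ yr]; rewrite gmulVK // wr yr.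
have cancel_r w y : iso_fibre x w -> iso_fibre x y -> gmul (ginv w) (gmul w y) = y.
  by move=> /fP[_ ws _] /fP[_ _ yr]; rewrite gmulKV // ws yr.
have lower w : w \in A' -> \sum_(z <- s) normc (ap z) ^+ 2 <=
    \sum_(y <- Y) normc (ap (gmul (sg w) y)) ^+ 2.
  move=> wA; have fw := sgA (A'A wA).
  apply: (@le_trans _ _ (\sum_(y <- [seq gmul (ginv (sg w)) z | z <- s])
      normc (ap (gmul (sg w) y)) ^+ 2)).
    rewrite big_map le_eqVlt; apply/orP; left; apply/eqP.
    by apply: eq_big_seq => z zs; rewrite cancel_l //; exact: sH.
  apply: sum_uniq_sub => [|y /mapP[z zs ->]|y]; last exact: sqr_ge0.
    rewrite map_inj_in_uniq // => z z' zs z's e.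
    by rewrite -(cancel_l (sg w) z) ?e ?cancel_l //; exact: sH.
  by rewrite mem_undup; apply/allpairsP; exists (w, z).
have upper u : u \in A -> \sum_(y <- Y) normc (zeta (gmul (sg u) y)) ^+ 2 <=
    \sum_(z <- t) normc (xi z) ^+ 2.
  move=> uAm; have fu := sgA uAm.
  rewrite -(big_map (gmul (sg u)) xpredT (fun z => normc (zeta z) ^+ 2)).
  rewrite (bigID (mem t)) /= [X in _ + X]big1 ?addr0; last first.
    by move=> z zt; rewrite /zeta (negbTE zt) normc0 expr0n.
  rewrite -big_filter (eq_big_seq (fun z => normc (xi z) ^+ 2)); last first.
    by move=> z; rewrite mem_filter /zeta => /andP[->].
  apply: sum_uniq_sub => [|z|z]; last exact: sqr_ge0.
    rewrite filter_uniq // map_inj_in_uniq ?undup_uniq // => y y' yY y'Y e.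
    by rewrite -(cancel_r (sg u) y) ?e ?cancel_r //; exact: YP.
  by rewrite mem_filter => /andP[].
have sumc (l : seq G) (z : R) : \sum_(w <- l) z = (size l)%:R * z.
  by rewrite big_const_seq count_predT iter_addr_0 mulr_natl.
have total : (size A')%:R * \sum_(z <- s) normc (ap z) ^+ 2 <=
    c ^+ 2 * ((size A)%:R * \sum_(z <- t) normc (xi z) ^+ 2).
  apply: (@le_trans _ _ (\sum_(w <- A') \sum_(y <- Y) normc (ap (gmul (sg w) y)) ^+ 2)).
    rewrite -sumc big_seq [leRHS]big_seq.
    by apply: ler_sum => w; exact: lower.
  rewrite exchange_big /=.
  apply: (@le_trans _ _ (\sum_(y <- Y) c ^+ 2 *
      \sum_(u <- A) normc (zeta (gmul (sg u) y)) ^+ 2)).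
    by rewrite big_seq [leRHS]big_seq; apply: ler_sum => y /YP; exact: step.
  rewrite -mulr_sumr ler_wpM2l ?sqr_ge0 // exchange_big /= -sumc.
  by rewrite big_seq [leRHS]big_seq; apply: ler_sum => u; exact: upper.
have n0 : 0 < (size A')%:R :> R by rewrite ltr0n.
rewrite -(ler_pM2l n0); apply: le_trans total _.
have h2 : (size A)%:R <= 2 * (size A')%:R :> R by rewrite -natrM ler_nat.
have S0 := sumsq_ge0 t xi; set S := \sum_(z <- t) _ in S0 *.
(* [total] and [h2] give 2 c^2, that is a bound c times the root of 2; the rounder 2 c leaves a
   spare factor. *)
have -> : (2 * c) ^+ 2 = 4 * c ^+ 2 by ring.
apply: (@le_trans _ _ (c ^+ 2 * (2 * (size A')%:R * S))).
  by rewrite ler_wpM2l ?sqr_ge0 // ler_wpM2r.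
have -> : (size A')%:R * (4 * c ^+ 2 * S) = 2 * (c ^+ 2 * (2 * (size A')%:R * S)) by ring.
by rewrite ler_peMl ?ler1n // !mulr_ge0 ?sqr_ge0.
Qed.

End transfer.

(** * The limit along an ultrafilter of the isotropy fibres *)

Section limit_isotropy.
Variables (G : etaleGroupoid).
Hypothesis hausG : hausdorff_space G.
Local Notation H := (iso_interior G).
Hypothesis abelH : forall a b : G, H a -> H b -> rng a = rng b ->
  gmul a b = gmul b a.
Variables (x0 : G) (F : set_system G).
Hypothesis rngx0 : rng x0 = x0.
Hypothesis FU : UltraFilter F.
Hypothesis Fx0 : unit_filter x0 `<=` F.

Let FF : ProperFilter F := @ultra_proper _ _ FU.

Let nearI (P Q : G -> Prop) : (\forall x \near F, P x) ->
  (\forall x \near F, Q x) -> \forall x \near F, P x /\ Q x.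
Proof. exact: filterI. Qed.

(* The limit along F of the fibres of Iso(G)^o: a subgroup of the isotropy group
   at x0, possibly larger than the fibre at x0, but still abelian. *)
Definition limit_fibre (a : G) : Prop :=
  rng a = x0 /\ \forall x \near F, H (sec a x).

Lemma sec_F a (V : set G) : rng a = x0 -> nbhs a V ->
  \forall x \near F, V (sec a x) /\ rng (sec a x) = x.
Proof. by move=> ax aV; apply: Fx0; have := sec_near aV; rewrite ax. Qed.

Lemma sec_F_rng a : rng a = x0 -> \forall x \near F, rng (sec a x) = x.
Proof. by move=> /sec_F/(_ (bisection_nbhs a)); apply: filterS => x []. Qed.

Lemma limit_fibre_H a : rng a = x0 -> H a -> limit_fibre a.
Proof.
move=> ax Ha; split=> //; have aH : nbhs a H.
  by apply: open_nbhs_nbhs; split => //; exact: iso_interior_open.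
by apply: filterS (sec_F ax aH) => x [].
Qed.

(** Otherwise sources and ranges near [a] would lie in disjoint sets, although the section through
    [a] runs in H along F. *)
Lemma limit_fibre_src a : limit_fibre a -> src a = x0.
Proof.
move=> [ax Ha]; rewrite -ax; apply: contrapT => nsr.
have [A [B [aA aB AB]]] := hausdorff_separate hausG nsr.
have aV : nbhs a ((@src G) @^-1` A `&` (@rng G) @^-1` B).
  by apply: filterI; [exact: src_continuous|exact: rng_continuous].
have [x [[[/= Ax Bx] _] Hx]] := filter_ex (nearI (sec_F ax aV) Ha).
suff : (A `&` B) (src (sec a x)) by rewrite AB.
by split => //; rewrite -(iso_interior_sub Hx).
Qed.

(** Identities between arrows over x0 can thus be checked along F on sections, that is, for arrows
    of L, in the groups H_x. *)
Lemma sec_F_inj a b : rng a = x0 -> rng b = x0 ->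
  (\forall x \near F, sec a x = sec b x) -> a = b.
Proof.
move=> ax bx ab; apply: contrapT => nab.
have [A [B [aA bB AB]]] := hausdorff_separate hausG nab.
have [x [[[Ax _] [Bx _]] e]] := filter_ex (nearI (nearI (sec_F ax aA) (sec_F bx bB)) ab).
suff : (A `&` B) (sec a x) by rewrite AB.
by split => //; rewrite e.
Qed.

(** The single operation a^-1 b yields inverses and products, and it is the argument that occurs in
    a convolution. *)
Lemma limit_fibre_div a b : limit_fibre a -> limit_fibre b ->
  limit_fibre (gmul (ginv a) b) /\
  \forall x \near F, sec (gmul (ginv a) b) x = gmul (ginv (sec a x)) (sec b x).
Proof.
move=> La Lb; have [ax Ha] := La; have [bx Hb] := Lb; have sa := limit_fibre_src La.
have ab : src (ginv a) = rng b by rewrite src_inv ax bx.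
have rab : rng (gmul (ginv a) b) = x0 by rewrite rng_mul // rng_inv sa.
have [A [B [oA oB Aa Bb AB]]] := gmul_near ab (bisection_nbhs (gmul (ginv a) b)).
have nA : nbhs a ((@ginv G) @^-1` A) by apply: ginv_continuous; exact: open_nbhs_nbhs.
have nB : nbhs b B by exact: open_nbhs_nbhs.
have hA := sec_F ax nA; have hB := sec_F bx nB.
have E : \forall x \near F, sec (gmul (ginv a) b) x = gmul (ginv (sec a x)) (sec b x).
  apply: filterS3 hA hB Ha => x [Aax rax] [Bbx rbx] Hax.
  have cmp : src (ginv (sec a x)) = rng (sec b x) by rewrite src_inv rax rbx.
  rewrite -{1}(_ : rng (gmul (ginv (sec a x)) (sec b x)) = x).
    by apply: secE; exact: AB.
  by rewrite rng_mul // rng_inv -(iso_interior_sub Hax).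
split=> //; split=> //.
have hr := nearI (sec_F_rng ax) (sec_F_rng bx).
apply: filterS3 E (nearI Ha Hb) hr => x -> [Hax Hbx] [rax rbx].
by apply: iso_interior_mul; rewrite ?src_inv ?rax ?rbx //; exact: iso_interior_inv.
Qed.

(** Commutativity of the H_x passes to the limit by [sec_F_inj]. It is stated for left translations,
    the commuting maps to which [folner_set] is applied. *)
Lemma limit_fibre_comm a b w : limit_fibre a -> limit_fibre b -> limit_fibre w ->
  gmul (ginv a) (gmul (ginv b) w) = gmul (ginv b) (gmul (ginv a) w).
Proof.
move=> La Lb Lw.
have [Lbw Ebw] := limit_fibre_div Lb Lw; have [Labw Eabw] := limit_fibre_div La Lbw.
have [Law Eaw] := limit_fibre_div La Lw; have [Lbaw Ebaw] := limit_fibre_div Lb Law.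
apply: sec_F_inj; [by have [] := Labw|by have [] := Lbaw|].
have [ax Ha] := La; have [bx Hb] := Lb; have [wx Hw] := Lw.
have E1 := nearI (nearI Ebw Eabw) (nearI Eaw Ebaw).
have E2 := nearI (sec_F_rng ax) (nearI (sec_F_rng bx) (sec_F_rng wx)).
apply: filterS3 E1 E2 (nearI Ha Hb).
move=> x [[e1 e2] [e3 e4]] [rax [rbx rwx]] [Hax Hbx].
have sax := iso_interior_sub Hax; have sbx := iso_interior_sub Hbx.
rewrite e2 e1 e4 e3 !gmul_assoc ?src_inv ?rng_inv ?rax ?rbx ?rwx -?sax -?sbx ?rax ?rbx //.
congr (gmul _ _); apply: abelH; try exact: iso_interior_inv.
by rewrite !rng_inv -sax -sbx rax rbx.
Qed.

Variables (R : realType).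
Local Notation C := (R[i]^o).
Variables (p : G -> C) (c : R).
Hypothesis pC : Cc p.
Hypothesis c0 : 0 <= c.
Hypothesis pc : mxbound [set g | rng g = x0 /\ src g = x0] (conv_ker p) c.

Let near_all (r : seq G) (Q : G -> G -> Prop) :
  (forall a, a \in r -> \forall x \near F, Q a x) ->
  \forall x \near F, forall a, a \in r -> Q a x.
Proof.
elim: r => [|a r ih] h; first by apply: filterE.
have {}ih : \forall x \near F, forall b, b \in r -> Q b x.
  by apply: ih => b br; apply: h; rewrite inE br orbT.
have ha : \forall x \near F, Q a x by apply: h; rewrite mem_head.
by apply: filterS2 ha ih => x Qa hr b; rewrite inE => /orP[/eqP ->|/hr].
Qed.

(** Along F, [p] on H_x is close to the transplant of its restriction to L. [transplant_bound]
    controls the transplant, and the Schur test the difference, which is small with at most |SL|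
    nonzero values. *)
Lemma limit_bound (e : R) : 0 < e ->
  \forall x \near F, mxbound (iso_fibre x) (conv_ker p) (2 * c + e).
Proof.
move=> e0; have [S uS [Sx Sloc]] := Cc_local hausG x0 pC.
have pS a : rng a = x0 -> p a != 0 -> a \in S.
  move=> ax pa; have /mapP[b bS ab] := nbhs_singleton Sloc a ax pa.
  by rewrite ab -(Sx _ bS) sec_self.
pose SL := [seq a <- S | `[< limit_fibre a >]].
have SLP a : a \in SL -> [/\ a \in S & limit_fibre a].
  by rewrite mem_filter => /andP[/asboolP].
have uSL : uniq SL by exact: filter_uniq.
pose m (i : 'I_(size SL)) w := gmul (ginv (nth x0 SL i)) w.
have Lm (i : 'I_(size SL)) : limit_fibre (nth x0 SL i).
  by have [] := SLP _ (mem_nth x0 (ltn_ord i)).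
have Lx0 : limit_fibre x0.
  by apply: limit_fibre_H => //; rewrite -rngx0; exact: iso_interior_rng.
have [A [A' [uA uA' A'0 AA' [AL A'A mA]]]] : exists A B : seq G,
  [/\ uniq A, uniq B, (0 < size B)%N, (size A <= 2 * size B)%N &
  [/\ forall x, x \in A -> limit_fibre x, {subset B <= A} &
  forall i x, x \in B -> m i x \in A]].
  apply: (@folner_set _ limit_fibre _ m x0) => //.
    by move=> i w Lw; have [] := limit_fibre_div (Lm i) Lw.
  by move=> i j w Lw; exact: limit_fibre_comm.
have SLA a w : a \in SL -> w \in A' -> gmul (ginv a) w \in A.
  move=> aS wA; have ia : (index a SL < size SL)%N by rewrite index_mem.
  by have := mA (Ordinal ia) w wA; rewrite /m /= nth_index.
pose n := (size SL)%:R : R.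
(* At most n nonzero entries in each row and column, each below this value, add at most e to the
   norm. *)
have e1 : 0 < e / (n + 1) by rewrite divr_gt0 // ltr_wpDl.
have N1 : \forall x \near F, forall a, rng a = x -> p a != 0 ->
    a \in [seq sec b x | b <- S].
  apply: Fx0; have h : \forall x \near x0, (unit_space G x ->
      forall a, rng a = x -> p a != 0 -> a \in [seq sec b x | b <- S]).
    by apply: filterS Sloc => y hy _.
  exact: h.
have N2 : \forall x \near F, uniq [seq sec b x | b <- S].
  by apply: Fx0; exact: (sec_uniq hausG uS Sx).
have N3 : \forall x \near F, forall a, a \in SL ++ A -> iso_fibre x (sec a x).
  apply: near_all => a; rewrite mem_cat => aSA.
  have [ax Ha] : limit_fibre a by case/orP: aSA => [/SLP[]//|/AL].
  apply: filterS2 Ha (sec_F_rng ax) => x Hx rx; split=> //.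
  by rewrite -(iso_interior_sub Hx).
(* Here the ultrafilter decides: a section that is not eventually in H is eventually outside H, so
   on H_x the support of [p] comes from arrows of L only. *)
have N4 : \forall x \near F, forall a, a \in S -> ~ limit_fibre a -> ~ H (sec a x).
  apply: near_all => a aS; have [La|La] := pselect (limit_fibre a).
    by apply: filterE => x; move/(_ La).
  have [Ha|] := in_ultra_setVsetC [set x | H (sec a x)] FU.
    by exfalso; apply: La; split => //; exact: Sx.
  by apply: filterS => x Hx _.
have N5 : \forall x \near F, forall a, a \in SL -> forall w, w \in A ->
    sec (gmul (ginv a) w) x = gmul (ginv (sec a x)) (sec w x).
  apply: near_all => a /SLP[_ La]; apply: near_all => w /AL Lw.
  by have [] := limit_fibre_div La Lw.
have N6 : \forall x \near F, forall a, a \in S -> normc (p a - p (sec a x)) < e / (n + 1).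
  apply: near_all => a aS; have [cp _] := pC.
  move/cvg_normcP: (cp a) => /(_ _ e1) pa.
  by have := sec_F (Sx _ aS) pa; apply: filterS => x [].
apply: filterS3 (nearI N1 N2) (nearI N3 N4) (nearI N5 N6).
move=> x [{}N1 {}N2] [{}N3 {}N4] [{}N5 {}N6].
pose sg a := sec a x.
have sgS : {in S &, injective sg}.
  move=> a b aS bS ab; apply/eqP; rewrite -(nth_index x0 aS) -(nth_index x0 bS).
  rewrite nth_uniq ?index_mem //.
  have := nth_uniq (sg x0) _ _ N2; move=> /(_ (index a S) (index b S)).
  by rewrite size_map !index_mem !(nth_map x0) ?index_mem // !nth_index // => <- //; exact/eqP.
pose p' := transplant sg SL p.
have SL_S a : a \in SL -> a \in S by move=> /SLP[].
have p'sg a : a \in SL -> p' (sg a) = p a.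
  move=> aS; rewrite /p' /transplant big_mkcond (bigD1_seq a) //= eqxx.
  rewrite big1_seq ?addr0 // => b /andP[ba bS]; case: eqP => // /sgS ab.
  by rewrite ab ?eqxx // in ba; exact: SL_S.
have p'0 u : u \notin [seq sg a | a <- SL] -> p' u = 0.
  move=> uSL'; rewrite /p' /transplant big1_seq // => a /andP[/eqP au aS].
  by exfalso; move/negP: uSL'; apply; rewrite -au map_f.
have pSL u : iso_fibre x u -> p u != 0 -> u \in [seq sg a | a <- SL].
  move=> [Hu ux] pu; have := N1 u _ pu; rewrite (iso_interior_sub Hu) => /(_ ux).
  move=> /mapP[a aS ua]; rewrite ua; apply: map_f.
  rewrite mem_filter aS andbT; apply/asboolP; apply: contrapT => La.
  by apply: (N4 _ aS La); rewrite -ua.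
have fdiv u v : iso_fibre x u -> iso_fibre x v -> src u = src v /\ iso_fibre x (gdiv u v).
  move=> [Hu ux] [Hv vx]; have uv : src u = src v by rewrite ux vx.
  split=> //; split; first exact: iso_interior_div.
  by rewrite src_div // (iso_interior_sub Hv).
have diff : mxbound (iso_fibre x) (conv_ker (fun u => p u - p' u)) e.
  have nz u v : iso_fibre x u -> iso_fibre x v ->
      conv_ker (fun u => p u - p' u) u v != 0 -> gdiv u v \in [seq sg a | a <- SL].
    move=> fu fv; have [uv fuv] := fdiv u v fu fv; rewrite conv_kerE // => h.
    apply: contraT => h'; rewrite p'0 // subr0 in h.
    by rewrite pSL in h'.
  apply: (@mxbound_le _ _ _ _ (n * (e / (n + 1)))).
    by rewrite mulrCA ler_piMr ?(ltW e0) // ler_pdivrMr ?ltr_wpDl // mul1r lerDl.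
  apply: mxbound_schur; first exact: ltW.
  - move=> u v fu fv; have [uv fuv] := fdiv u v fu fv.
    have [->|/(nz _ _ fu fv)/mapP[a aS ea]] :=
      eqVneq (conv_ker (fun u => p u - p' u) u v) 0; first by rewrite normc0 ltW.
    by rewrite conv_kerE // ea p'sg // normcB ltW // N6 // SL_S.
  - move=> u t fu ut tP; rewrite -(size_map (gdiv u) t) -(size_map sg SL).
    apply: uniq_leq_size.
      rewrite map_inj_in_uniq // => v v' /tP[fv _] /tP[fv' _].
      by apply: divr_inj; [have [] := fdiv u v fu fv|have [] := fdiv u v' fu fv'].
    by move=> _ /mapP[v /tP[fv h] ->]; exact: nz.
  - move=> v s fv us sP; rewrite -(size_map (fun u => gdiv u v) s) -(size_map sg SL).
    apply: uniq_leq_size.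
      rewrite map_inj_in_uniq // => u u' /sP[fu _] /sP[fu' _].
      by apply: div_inj; [have [] := fdiv u v fu fv|have [] := fdiv u' v fu' fv].
    by move=> _ /mapP[u /sP[fu h] ->]; exact: nz.
have main : mxbound (iso_fibre x) (conv_ker p') (2 * c).
  apply: (@transplant_bound R G x sg SL A A' p c) => //.
  - by move=> a aS; apply: N3; rewrite mem_cat aS.
  - by move=> a aA; apply: N3; rewrite mem_cat aA orbT.
  - by move=> a w aS wA; split; [exact: SLA|exact: N5 _ aS _ (A'A _ wA)].
  - move=> eta w wA'; have Lw := AL _ (A'A _ wA').
    have sw := limit_fibre_src Lw; have [rw Hw] := Lw.
    have inj a b : a \in SL -> b \in SL -> gmul (ginv a) w = gmul (ginv b) w -> a = b.
      move=> /SLP[_ La] /SLP[_ Lb] ab; have [ra _] := La; have [rb _] := Lb.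
      have : ginv a = ginv b.
        by rewrite -[ginv a](@mulK _ _ w) ?ab ?mulK // src_inv ?ra ?rb rw.
      by move=> /(congr1 (@ginv G)); rewrite !ginvK.
    have divE a : a \in SL -> src w = src (gmul (ginv a) w) /\
        gdiv w (gmul (ginv a) w) = a.
      move=> /SLP[_ [ra _]]; split; first by rewrite src_mul // src_inv ra rw.
      by rewrite /gdiv ginv_mulE ?src_inv ?ra ?rw // ginvK gmulVK // ra rw.
    (* Restricting to [A] loses nothing in the row of w: u contributes only if a = w u^-1 is in
       [SL], and then u = a^-1 w, which lies in [A] because w is in [A']. *)
    rewrite /mxapp (@sum_subseq_zero _ _ _ [seq gmul (ginv a) w | a <- SL]) //.
    + rewrite big_map; apply: eq_big_seq => a aS; have [s1 s2] := divE a aS.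
      by rewrite conv_kerE // s2.
    + by rewrite map_inj_in_uniq.
    + by move=> _ /mapP[a aS ->]; exact: SLA.
    + move=> u uA_ uSL'; have Lu := AL _ uA_; have su := limit_fibre_src Lu.
      have wu : src w = src u by rewrite sw su.
      rewrite conv_kerE //; apply/eqP; apply: contrapT => /negP h.
      have pn : p (gdiv w u) != 0 by apply: contra h => /eqP ->; rewrite mul0r.
      have rwu : rng (gdiv w u) = x0 by rewrite rng_div.
      have Linv v : limit_fibre v -> limit_fibre (ginv v).
        move=> Lv; have [+ _] := limit_fibre_div Lv Lx0; have [rv _] := Lv.
        by rewrite -{1}rv -src_inv mul_src.
      have Lwu : limit_fibre (gdiv w u).
        by have [+ _] := limit_fibre_div (Linv _ Lw) (Linv _ Lu); rewrite ginvK.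
      move/negP: uSL'; apply; apply/mapP; exists (gdiv w u).
        by rewrite mem_filter pS // andbT; exact/asboolP.
      by rewrite ginv_div // divK.
  - apply: mxbound_sub pc => u /AL Lu; split; last exact: limit_fibre_src.
    by have [] := Lu.
apply: mxbound_ext (mxboundD main diff) => u v _ _.
by rewrite conv_kerB addrC subrK.
Qed.

End limit_isotropy.

Lemma local_bound (R : realType) (G : etaleGroupoid) (p : G -> R[i]^o) (c e : R) x0 :
  hausdorff_space G ->
  (forall a b : G, iso_interior G a -> iso_interior G b -> rng a = rng b ->
    gmul a b = gmul b a) ->
  rng x0 = x0 -> Cc p -> 0 <= c -> 0 < e ->
  mxbound [set g | rng g = x0 /\ src g = x0] (conv_ker p) c ->
  \forall x \near unit_filter x0, mxbound (iso_fibre x) (conv_ker p) (2 * c + e).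
Proof.
move=> hausG abelH rx0 pC c0 e0 pc; apply: contrapT => bad.
pose Good x := mxbound (iso_fibre x) (conv_ker p) (2 * c + e).
have ux0 : unit_space G x0 by exists x0.
have UF := unit_filter_proper ux0.
(* Bad units accumulate at x0, so restricting to them leaves a proper filter; an ultrafilter above
   it contradicts [limit_bound]. *)
have BF : ProperFilter (within (~` Good) (unit_filter x0)).
  apply: Build_ProperFilter_ex => P h; apply: contrapT => nP; apply: bad.
  apply: filterS (h : \forall x \near unit_filter x0, (~` Good) x -> P x) => x Px.
  by apply: contrapT => nG; apply: nP; exists x; exact: Px.
have [F [FU BFF]] := ultraFilterLemma BF.
have FF : ProperFilter F by exact: ultra_proper.
have Fx0 : unit_filter x0 `<=` F.
  move=> P h; apply: BFF.
  have h' : \forall x \near unit_filter x0, (~` Good) x -> P x.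
    by apply: filterS (h : \forall x \near unit_filter x0, P x) => x Px _.
  exact: h'.
have FG := limit_bound hausG abelH rx0 FU Fx0 pC c0 pc e0.
have FB : F (~` Good).
  apply: BFF; have h' : \forall x \near unit_filter x0, (~` Good) x -> (~` Good) x.
    by apply: filterE.
  exact: h'.
have [x [Gx nGx]] : exists x, Good x /\ ~ Good x.
  exact: (filter_ex (filterI (FG : F Good) FB)).
exact: nGx.
Qed.

(** * Cutoff functions and the approximation by Cc(Iso(G)^o) *)

Section masa.
Variables (R : realType) (G : etaleGroupoid).
Hypothesis hausG : hausdorff_space G.
Hypothesis lcG : locally_compact [set: G].
Local Notation C := (R[i]^o).
Local Notation H := (iso_interior G).
Hypothesis abelH : forall a b : G, H a -> H b -> rng a = rng b ->
  gmul a b = gmul b a.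

Lemma iso_supported_mull (u f : G -> C) : iso_supported f ->
  iso_supported (fun g => u g * f g).
Proof.
move=> fH; apply: subset_trans fH; apply: closureS => g /=.
by apply: contra => /eqP ->; rewrite mulr0.
Qed.

Lemma iso_cutoff (r : seq G) : (forall a, a \in r -> H a) ->
  exists th : G -> C, [/\ Cc th, iso_supported th & forall a, a \in r -> th a = 1].
Proof.
elim: r => [|a r ih] rH.
  by exists (fun=> 0); split => //; [exact: Cc_0|exact: iso_supported0].
have [th [thC thH th1]] : exists th : G -> C,
    [/\ Cc th, iso_supported th & forall b, b \in r -> th b = 1].
  by apply: ih => b br; apply: rH; rewrite inE br orbT.
have aH : nbhs a H.
  apply: open_nbhs_nbhs; split; first exact: iso_interior_open.
  by apply: rH; rewrite mem_head.
have [u [cu _ u1 uC uH]] := @Cc_bump R G hausG lcG a H aH.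
have cu' : continuous (fun g => 1 - (u g)%:C : C).
  by move=> g; apply: cvgB; [exact: cvg_cst|exact: continuous_complex].
(* This is 1 - (1 - u)(1 - th), equal to 1 wherever [u] or [th] is; the factor 1 matches the shape
   of [Cc_lin]. *)
exists (fun g => 1 * (u g)%:C + (1 - (u g)%:C) * th g); split.
- exact: (Cc_lin hausG 1 uC (Cc_mull hausG thC cu')).
- apply: (iso_supported_lin (a := 1) hausG uC (Cc_mull hausG thC cu')) => //.
  exact: iso_supported_mull.
- move=> b; rewrite inE => /orP[/eqP ->|/th1 ->]; last by ring.
  by rewrite (nbhs_singleton u1); ring.
Qed.

Lemma local_cutoff (f : G -> C) (d : R) x0 : Cc f -> 0 < d ->
  mxbound setT (conv_ker (fun g => f g - if `[< H g >] then f g else 0)) (2 * d) ->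
  rng x0 = x0 -> exists th : G -> C, [/\ Cc th, iso_supported th &
    \forall x \near unit_filter x0,
      mxbound (iso_fibre x) (conv_ker (fun g => f g * (1 - th g))) (5 * d)].
Proof.
move=> fC d0 fd rx0; have [t ut [tr ft]] := Cc_fibre_seq x0 fC.
have [|th [thC thH th1]] := @iso_cutoff [seq a <- t | `[< H a >]].
  by move=> a; rewrite mem_filter => /andP[/asboolP].
exists th; split => //.
have [cth _] := thC.
have pC : Cc (fun g => f g * (1 - th g)).
  have -> : (fun g => f g * (1 - th g)) = (fun g => (1 - th g) * f g).
    by apply/funext => g; rewrite mulrC.
  have c1 : continuous (fun g => 1 - th g : C).
    by move=> g; apply: cvgB; [exact: cvg_cst|exact: cth].
  exact: (Cc_mull hausG fC c1).
(* [local_bound] is used with c = 2d and e = d. In the isotropy group at x0, f (1 - th) is f minus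
   its restriction to H: on H, [th] is 1 where f is nonzero, and off H it vanishes. *)
have -> : 5 * d = 2 * (2 * d) + d by ring.
apply: local_bound => //; first by rewrite mulr_ge0 ?(ltW d0).
apply: mxbound_ext (mxbound_sub (@subsetT _ _) fd) => g b [rg sg] [rb sb].
have gb : src g = src b by rewrite sg sb.
rewrite !conv_kerE //; have ra : rng (gdiv g b) = x0 by rewrite rng_div.
case: asboolP => [Ha|Ha]; last first.
  have -> : th (gdiv g b) = 0; last by ring.
  by apply/eqP; apply: contrapT => /negP /(iso_supported_nz thH).
have [->|fa] := eqVneq (f (gdiv g b)) 0; first by ring.
rewrite th1; first by ring.
by rewrite mem_filter ft // andbT; exact/asboolP.
Qed.

(* The bound is convex in th, so that local cutoffs are glued by bump functions of
   rng, one element of a finite cover at a time. *)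
Lemma global_cutoff (f : G -> C) (d : R) : Cc f -> 0 < d ->
  mxbound setT (conv_ker (fun g => f g - if `[< H g >] then f g else 0)) (2 * d) ->
  exists th : G -> C, [/\ Cc th, iso_supported th &
    forall x, mxbound (iso_fibre x) (conv_ker (fun g => f g * (1 - th g))) (5 * d)].
Proof.
move=> fC d0 fd; have [cf cK] := fC.
pose K := (@rng G) @` closure [set g | f g != 0].
have cptK : compact K.
  apply: continuous_compact cK; apply: continuous_subspaceT; exact: rng_continuous.
have d5 : 0 <= 5 * d by rewrite mulr_ge0 ?(ltW d0).
pose good (th : G -> C) x :=
  mxbound (iso_fibre x) (conv_ker (fun g => f g * (1 - th g))) (5 * d).
have local x0 : exists w : (G -> R) * (G -> C), K x0 ->
  [/\ continuous w.1, forall y, 0 <= w.1 y <= 1, \forall y \near x0, w.1 y = 1,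
      Cc w.2 /\ iso_supported w.2 &
      forall y, unit_space G y -> w.1 y != 0 -> good w.2 y].
  have [[g _ gx0]|nK] := pselect (K x0); last by exists (fun=> 0, fun=> 0).
  have rx0 : rng x0 = x0 by rewrite -gx0 rng_rng.
  have [th [thC thH thg]] := local_cutoff fC d0 fd rx0.
  have [u [cu u01 u1 _ uV]] := @Cc_bump R G hausG lcG x0
    [set y | unit_space G y -> good th y] thg.
  exists (u, th) => _; split => //= y uy uy0.
  apply: uV => //; apply: subset_closure => /=; apply: contra uy0 => /eqP[->].
  by [].
pose w x := projT1 (cid (local x)).
have wP x : K x -> _ := projT2 (cid (local x)).
have [x0 Kx0|s sK scov] := @compact_finite_cover G K (fun x => [set y | (w x).1 y = 1]) cptK.
  by have [] := wP x0 Kx0.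
have [th [thC thH thg]] : exists th : G -> C, [/\ Cc th, iso_supported th &
    forall y, unit_space G y -> (exists2 a, a \in s & (w a).1 y = 1) -> good th y].
  elim: (s) sK => [|a r ih] rK.
    exists (fun=> 0); split; [exact: Cc_0|exact: iso_supported0|].
    by move=> y _ [].
  have [b br|th [thC thH thg]] := ih; first by apply: rK; rewrite inE br orbT.
  have [cu u01 _ [thaC thaH] thag] := wP a (rK a (mem_head _ _)).
  have cu1 : continuous (fun g => (1 - ((w a).1 (rng g))%:C) : C).
    move=> g; apply: cvgB; first exact: cvg_cst.
    apply: (continuous_complex (u := (w a).1 \o @rng G)) => h.
    by apply: continuous_comp; [exact: rng_continuous|exact: cu].
  have cu2 : continuous (fun g => ((w a).1 (rng g))%:C : C).
    apply: (continuous_complex (u := (w a).1 \o @rng G)) => h.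
    by apply: continuous_comp; [exact: rng_continuous|exact: cu].
  (* The weight [(w a).1 (rng g)] is constant on a fibre of H, so there f (1 - th) becomes a convex
     combination of the old and the local one. *)
  exists (fun g => 1 * ((1 - ((w a).1 (rng g))%:C) * th g) +
                   ((w a).1 (rng g))%:C * (w a).2 g); split.
  - exact: (Cc_lin hausG 1 (Cc_mull hausG thC cu1) (Cc_mull hausG thaC cu2)).
  - apply: (iso_supported_lin (a := 1) hausG (Cc_mull hausG thC cu1) (Cc_mull hausG thaC cu2)).
      by apply: iso_supported_mull.
    by apply: iso_supported_mull.
  move=> y uy hy; pose c := (w a).1 y.
  have ker u v : iso_fibre y u -> iso_fibre y v ->
      src u = src v /\ (w a).1 (rng (gdiv u v)) = c.
    move=> [Hu uy'] [Hv vy]; have uv : src u = src v by rewrite uy' vy.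
    by rewrite rng_div // (iso_interior_sub Hu) uy'.
  (* The extreme weights are separate cases: at c = 1 only the local cutoff need be good at y, at c
     = 0 only [th]. *)
  have [c1|c1] := eqVneq c 1.
    have ga : good (w a).2 y by apply: thag => //; rewrite -/c c1 oner_neq0.
    apply: mxbound_ext ga => u v fu fv; have [uv e] := ker u v fu fv.
    by rewrite !conv_kerE // e c1; ring.
  have gth : good th y.
    apply: thg => //; case: hy => b; rewrite inE => /orP[/eqP ->|br] b1; last by exists b.
    by rewrite /c b1 eqxx in c1.
  have [c0|c0] := eqVneq c 0.
    apply: mxbound_ext gth => u v fu fv; have [uv e] := ker u v fu fv.
    by rewrite !conv_kerE // e c0; ring.
  have ga : good (w a).2 y by exact: thag.
  have /andP[cge0 cle1] := u01 y; rewrite -/c in cge0 cle1.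
  have nc (z : R) : 0 <= z -> normc (z%:C : R[i]) = z.
    by move=> z0; rewrite /= expr0n /= addr0 sqrtr_sqr ger0_norm.
  have := mxboundD (mxboundZ (1 - c)%:C gth) (mxboundZ c%:C ga).
  rewrite !nc ?subr_ge0 // -mulrDl subrK mul1r.
  apply: mxbound_ext => u v fu fv; have [uv e] := ker u v fu fv.
  by rewrite !conv_kerE // e rmorphB rmorph1; ring.
exists th; split => // x.
have fib0 (P : Prop) : (forall u, iso_fibre x u -> P) -> ~ P ->
    mxbound (iso_fibre x) (conv_ker (fun g => f g * (1 - th g))) (5 * d).
  move=> h nP [|u s'] t us ut sA tA xi; first by rewrite fnorm_nil mulr_ge0 ?fnorm_ge0.
  by exfalso; apply: nP; apply: h (sA u (mem_head _ _)).
have [ux|nux] := pselect (unit_space G x); last first.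
  by apply: fib0 nux => u [_ <-]; exists (src u) => //; exact: rng_src.
have [Kx|nKx] := pselect (K x); first exact: thg (scov x Kx).
apply: mxbound_le d5 _; apply: mxbound_ext (@mxbound0 R G _) => u v [Hu ux'] [Hv vx].
have uv : src u = src v by rewrite ux' vx.
rewrite conv_kerE //; have [->|fa] := eqVneq (f (gdiv u v)) 0; first by rewrite mul0r.
exfalso; apply: nKx; exists (gdiv u v); first exact: Cc_support.
by rewrite rng_div // (iso_interior_sub Hu).
Qed.

(** On each fibre of H, k - f th = (k - f) + f (1 - th) with errors d and 5d; block diagonality
    extends the bound to l2(G), as k and [th] vanish off H. *)
Lemma iso_kernel_approximable (T : l2 R G -> l2 R G) : reduced_cstar R G T ->
  (forall g, kernel_of T g != 0 -> H g) -> approximable (@iso_supported R G) T.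
Proof.
move=> /(reduced_cstarP hausG) aT kH; have [bT _] := aT; pose k := kernel_of T.
have k0 g : ~ H g -> k g = 0.
  by move=> Hg; apply/eqP; apply: contrapT => /negP /kH.
apply: (ker_approximable hausG (k := k)) => // [g b|e e0].
  exact: (mx_of_approximable hausG _ _ aT).
(* The final error is d + 5d = 6d, within e. *)
pose d := e / 10; have d0 : 0 < d by rewrite /d; lra.
have [f [fC _ fd]] := approximable_ker hausG aT d0.
(* Discontinuous in general, as H need not be closed; it enters only through its matrix. *)
pose fH g := if `[< H g >] then f g else 0.
have fibH x u v : iso_fibre x u -> iso_fibre x v -> src u = src v /\ H (gdiv u v).
  move=> [Hu ux] [Hv vx]; have uv : src u = src v by rewrite ux vx.
  by split => //; exact: iso_interior_div.
have kfH : mxbound setT (conv_ker (fun g => k g - fH g)) d.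
  apply: mxbound_iso_fibres => [|g|x]; first exact: ltW.
    apply: contraNP => Hg; rewrite k0 // /fH; case: asboolP => // _.
    by rewrite subrr.
  apply: mxbound_ext (mxbound_sub (@subsetT _ _) fd) => u v fu fv.
  have [uv Huv] := fibH x u v fu fv; rewrite !conv_kerE // /fH.
  by case: asboolP.
have ffH : mxbound setT (conv_ker (fun g => f g - fH g)) (2 * d).
  have -> : 2 * d = d + d by ring.
  apply: mxbound_ext (mxboundB kfH fd) => u v _ _.
  by rewrite -conv_kerB; apply: conv_ker_ext => g; rewrite /k; ring.
have [th [thC thH thg]] := global_cutoff fC d0 ffH.
have [cf _] := fC; have faC := Cc_mull hausG thC cf.
exists (fun g => f g * th g); split => //; first exact: iso_supported_mull.
apply: mxbound_iso_fibres => [|g|x]; first exact: ltW.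
  apply: contraNP => Hg; rewrite k0 // (_ : th g = 0) ?mulr0 ?subrr //.
  by apply/eqP; apply: contrapT => /negP /(iso_supported_nz thH).
apply: (@mxbound_le _ _ _ _ (d + 5 * d)); first by rewrite /d; lra.
apply: mxbound_ext (mxboundD (mxbound_sub (@subsetT _ _) fd) (thg x)) => u v fu fv.
have [uv Huv] := fibH x u v fu fv; rewrite !conv_kerE //.
by rewrite /k; ring.
Qed.

End masa.

Lemma abelian_iso_interior (G : etaleGroupoid) : abelian_fibres (iso_groupoid G) ->
  forall a b : G, iso_interior G a -> iso_interior G b -> rng a = rng b ->
    gmul a b = gmul b a.
Proof.
move=> abel a b /iso_val_surj[u <-] /iso_val_surj[v <-] uv.
have val_rng (z : iso_groupoid G) : iso_val (rng z) = rng (iso_val z).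
  exact: val_iso_rng.
have isoE (z : iso_groupoid G) : src z = rng z.
  apply: iso_val_inj; rewrite iso_val_src val_rng; apply/esym/iso_interior_sub.
  exact: iso_valH.
have ruv : rng u = rng v by apply: iso_val_inj; rewrite !val_rng.
have val_mul (y z : iso_groupoid G) : rng y = rng z ->
    iso_val (gmul y z) = gmul (iso_val y) (iso_val z).
  by move=> yz; apply: val_iso_mul; rewrite -[iso_src y]/(src y) isoE.
rewrite -!val_mul //; congr iso_val.
by apply: (abel (rng v)); rewrite ?isoE ?ruv //; exists v.
Qed.

Theorem corollary5p4 (R : realType) (G : etaleGroupoid)
    (hausdorffG : hausdorff_space G)
    (locally_compactG : locally_compact [set: G])
    (abelianG : abelian_fibres (iso_groupoid G)) :
  maximal_abelian (reduced_cstar R G)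
    (iso_inclusion R G @` reduced_cstar R (iso_groupoid G)).
Proof.
have abelH := abelian_iso_interior abelianG.
rewrite (iso_inclusion_image R hausdorffG); split.
- exact: (iso_approximable_cstar R hausdorffG).
- by move=> T; exact: (approximable_reduced hausdorffG).
- exact: (@iso_approximable_abelian R G hausdorffG abelH).
(* As B is abelian and contains the operators of Cc(H), each T in B commutes with them; its kernel
   then lives on H, and [iso_kernel_approximable] puts T in the image of iota. *)
move=> B _ Bred Babel MB; apply/seteqP; split; last exact: MB.
move=> T BT; have rT := Bred T BT.
apply: (iso_kernel_approximable hausdorffG locally_compactG abelH rT) => g.
apply: (commutant_kernel hausdorffG locally_compactG rT) => f fC fH.
apply: Babel => //; apply: MB.
exact: (approximable_regular_rep hausdorffG fC fH).
Qed.
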